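(* Let $k$ be an arbitrary field. Each weak Perron number $\lambda$ is the dynamical degree of an affine-triangular automorphism of $\mathbb{A}^{n}=\mathbb{A}^n_k$ for some integer $n\ge 1$. Moreover: (1) If $\lambda>1$ is an integer, the least possible such $n$ is $2$. (2) If $\lambda$ is a quadratic integer and its conjugate is negative, the least possible such $n$ is $3$. (3) If $\lambda$ is a quadratic integer and its conjugate is positive, the least possible such $n$ is $4$.
   Context: A weak Perron number is a real number $\lambda\ge 1$ that is an algebraic integer such that all other Galois conjugates $\mu\in\mathbb{C}$ satisfy $|\mu|\le\lambda$. A quadratic integer is an algebraic integer of degree $2$ over $\mathbb{Q}$. An endomorphism of $\mathbb{A}^n=\mathbb{A}^n_k$ is a tuple $f=(f_1,\ldots,f_n)\in k[x_1,\ldots,x_n]^n$, viewed as the map $(x_1,\ldots,x_n)\mapsto(f_1,\ldots,f_n)$; composition is $(f\circ g)_i=f_i(g_1,\ldots,g_n)$, and $f^r$ is the $r$-fold iterate. $\mathrm{End}(\mathbb{A}^n)$ is the monoid of endomorphisms and $\mathrm{Aut}(\mathbb{A}^n)$ its group of invertible elements. The degree is $\deg(f)=\max_i \deg(f_i)$. For dominant $f$ the dynamical degree is $\lambda(f)=\lim_{r\to\infty}\deg(f^r)^{1/r}\in\mathbb{R}_{\ge1}$ (the limit exists). An affine automorphism is an automorphism of degree $1$; $\tau\in\mathrm{End}(\mathbb{A}^n)$ is triangular if $\tau_i\in k[x_1,\ldots,x_i]$ for each $i$. An endomorphism is affine-triangular if it is of the form $\alpha\circ\tau$ with $\alpha$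 an affine automorphism and $\tau$ a triangular endomorphism. *)

(* Defs.v *)
From mathcomp Require Import all_boot all_order all_algebra.
From mathcomp Require Import complex.
From mathcomp Require Import all_classical all_reals all_analysis.
(* The notations of mpoly clash with those of MathComp-Analysis. *)
From mathcomp Require Import -(notations) mpoly.

Set Implicit Arguments.
Unset Strict Implicit.
Unset Printing Implicit Defensive.

Import Order.TTheory GRing.Theory Num.Theory.
Import numFieldNormedType.Exports.

Local Open Scope classical_set_scope.
Local Open Scope ring_scope.
Local Open Scope complex_scope.

Definition algebraic_integer (K : fieldType) (x : K) : Prop :=
  integralOver (intr : int -> K) x.

Definition minimal_polynomial (K : fieldType) (x : K) (p : {poly rat}) : Prop :=
  [/\ p \is monic, irreducible_poly p & root (map_poly ratr p) x].

(* Includes y = x. *)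
Definition galois_conjugate (K : fieldType) (x y : K) : Prop :=
  exists2 p, minimal_polynomial x p & root (map_poly ratr p) y.

(* normc (a +i* b) is the R-valued modulus, the square root of a ^+ 2 + b ^+ 2. *)
Definition weak_perron (R : realType) (lambda : R) : Prop :=
  [/\ 1 <= lambda, algebraic_integer lambda &
      forall mu : R[i], galois_conjugate lambda%:C mu -> mu != lambda%:C ->
        Normc.normc mu <= lambda].

Definition quadratic_integer (K : fieldType) (x : K) : Prop :=
  algebraic_integer x /\ exists2 p, minimal_polynomial x p & size p = 3%N.

Section Endomorphisms.
Variables (k : fieldType) (n : nat).

Definition endo : Type := n.-tuple (mpoly n k).
Implicit Types f g : endo.

Definition endo_id : endo := [tuple mpolyX k (mnm1 i) | i < n].

(* comp_mpoly g p substitutes the components of g for the variables of p. *)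
Definition endo_comp f g : endo := [tuple comp_mpoly g (tnth f i) | i < n].

Definition endo_iter (r : nat) f : endo := iter r (endo_comp f) endo_id.

(* msize p is the total degree plus one, and 0 for p = 0, which is thus given
   degree 0 here; no component of an automorphism is zero. *)
Definition endo_deg f : nat := \max_(i < n) (msize (tnth f i)).-1.

Definition automorphism f : Prop :=
  exists g : endo, endo_comp f g = endo_id /\ endo_comp g f = endo_id.

Definition affine_automorphism f : Prop := automorphism f /\ endo_deg f = 1%N.

Definition triangular f : Prop :=
  forall i j : 'I_n, (i < j)%N ->
    forall m, m \in msupp (tnth f i) -> m j = 0%N.

Definition affine_triangular f : Prop :=
  exists alpha tau : endo,
    [/\ affine_automorphism alpha, triangular tau & f = endo_comp alpha tau].

(* At r = 0 the exponent 0^-1 is 0, and the value is irrelevant to the limit. *)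
Definition dynamical_degree (R : realType) f (lambda : R) : Prop :=
  (endo_deg (endo_iter r f))%:R `^ r%:R^-1 @[r --> \oo] --> lambda.

End Endomorphisms.

Definition realized (k : fieldType) (R : realType) (lambda : R) (n : nat) : Prop :=
  (1 <= n)%N /\
  exists f : endo k n,
    [/\ automorphism f, affine_triangular f & dynamical_degree f lambda].

Definition least_nat (P : nat -> Prop) (n : nat) : Prop :=
  P n /\ forall m, P m -> (n <= m)%N.

(* Main.v *)
Require Import Defs.
From mathcomp Require Import all_boot all_order all_algebra.
From mathcomp Require Import complex.
From mathcomp Require Import all_classical all_reals all_analysis.
From mathcomp Require Import all_field fingroup perm.
From mathcomp Require Import -(notations) mpoly.
From mathcomp Require Import ring lra zify.
Import Order.TTheory GRing.Theory Num.Theory.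
Import numFieldNormedType.Exports.
Local Open Scope ring_scope.
Local Open Scope complex_scope.

Set Implicit Arguments.
Unset Strict Implicit.
Unset Printing Implicit Defensive.

(** If finitely many reals mu_i > 0 satisfy lambda mu_i = sum_j a_ij mu_j with natural
    numbers a_ij and lambda > 1, then (x, y) |-> (y_i + prod_j x_j^a_ij, x) multiplies
    the degree with weights (lambda mu, mu) by exactly lambda, because its leading part
    is monomial. For a weak Perron number lambda, such mu_i come from an argument of
    Lind. If |z| = lambda for a conjugate z, then z/lambda is a root of unity, so that
    some power beta of lambda exceeds all its other conjugates in modulus. The
    elements v of Z[beta] with |v'| <= v <= M for all conjugates v' form a finite set,
    and beta v is a sum of such elements.

    For the lower bounds, the Bruhat decomposition conjugates an affine-triangular
    automorphism to a permutation of the components of a triangular one. In dimension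
    at most 3, weights adapted to each permutation show that the dynamical degree
    satisfies lambda^2 = a lambda + b with natural numbers a and b (and is 1 in
    dimension 1, a natural number in dimension 2); then every other conjugate mu has
    lambda mu = -b <= 0. *)

(** * Weighted degrees *)

(** Growth is read off from weights that a map multiplies by a scalar. Positive weights bound
    degrees from above; from below the obstacle is cancellation, since the iterated leading parts
    might vanish. The calculus of leading parts therefore tolerates zero, and non-vanishing is
    settled separately: it is immediate for monomial maps, and in dimensions 2 and 3 it follows from
    injectivity of a substitution in one or two variables. The upper bound is proved only for every
    t above the growth rate: the degrees of the iterates of (x_0, x_2 + x_0 x_1, x_1) grow linearly,
    although the rate is 1. As the field is arbitrary, a Jacobian says too little about
    invertibility (in characteristic p that of x + x^p is 1), so the shape of triangular
    automorphisms is also obtained from weights. No Galois group acts in the argument on conjugates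
    of maximal modulus: conjugate points are compared by the degree of a gcd, which is the same at
    both. *)

Definition mnm_of n (e : 'I_n -> nat) : multinom n := Multinom [tuple e i | i < n].

Lemma mnm_ofE n (e : 'I_n -> nat) i : mnm_of e i = e i.
Proof. exact: mnmE. Qed.

Section Weights.
Variables (k : fieldType) (R : realFieldType) (n : nat).
Implicit Types (p q l : mpoly n k) (mu d : 'I_n -> R) (D E : R) (m : multinom n).

Definition wt mu m : R := \sum_i mu i *+ m i.

Definition wle mu D p := forall m, m \in msupp p -> wt mu m <= D.
Definition wlt mu D p := forall m, m \in msupp p -> wt mu m < D.
Definition whom mu D p := forall m, m \in msupp p -> wt mu m = D.

(* [lead mu D p l]: the part of weight [D] of [p] is [l] (possibly zero), and
   [p] has no part of larger weight. *)
Definition lead mu D p l := whom mu D l /\ wlt mu D (p - l).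

Definition top mu D p : mpoly n k :=
  \sum_(m <- msupp p | wt mu m == D) mcoeff m p *: mpolyX k m.

Lemma wtD mu m1 m2 : wt mu (mnm_add m1 m2) = wt mu m1 + wt mu m2.
Proof.
by rewrite /wt -big_split; apply: eq_bigr => i _; rewrite mnmDE mulrnDr.
Qed.

Lemma wt0 mu : wt mu mnm0 = 0.
Proof. by rewrite /wt big1 // => i _; rewrite mnm0E mulr0n. Qed.

Lemma wtU mu i : wt mu (mnm1 i) = mu i.
Proof.
rewrite /wt (bigD1 i) //= mnm1E eqxx mulr1n big1 ?addr0 // => j ji.
by rewrite mnm1E eq_sym (negbTE ji).
Qed.

Lemma wt_scale mu c m : wt (fun i => c * mu i) m = c * wt mu m.
Proof. by rewrite /wt mulr_sumr; apply: eq_bigr => i _; rewrite mulrnAr. Qed.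

Lemma wt_le mu d m : (forall i, mu i <= d i) -> wt mu m <= wt d m.
Proof. by move=> h; apply: ler_sum => i _; rewrite lerMn2r h orbT. Qed.

Lemma wt_const c m : wt (fun=> c) m = c *+ mdeg m.
Proof. by rewrite /wt sumrMnr mdegE. Qed.

Lemma wle0 mu D : wle mu D 0.
Proof. by move=> m; rewrite msupp0. Qed.

Lemma wlt0 mu D : wlt mu D 0.
Proof. by move=> m; rewrite msupp0. Qed.

Lemma wlt_wle mu D p : wlt mu D p -> wle mu D p.
Proof. by move=> h m /h /ltW. Qed.

Lemma whom_wle mu D p : whom mu D p -> wle mu D p.
Proof. by move=> h m /h ->. Qed.

Lemma wleD mu D p q : wle mu D p -> wle mu D q -> wle mu D (p + q).
Proof. by move=> hp hq m /msuppD_le; rewrite mem_cat => /orP[/hp|/hq]. Qed.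

Lemma wltD mu D p q : wlt mu D p -> wlt mu D q -> wlt mu D (p + q).
Proof. by move=> hp hq m /msuppD_le; rewrite mem_cat => /orP[/hp|/hq]. Qed.

Lemma whomD mu D p q : whom mu D p -> whom mu D q -> whom mu D (p + q).
Proof. by move=> hp hq m /msuppD_le; rewrite mem_cat => /orP[/hp|/hq]. Qed.

Lemma wleZ mu D c p : wle mu D p -> wle mu D (c *: p).
Proof. by move=> hp m /msuppZ_le /hp. Qed.

Lemma wltZ mu D c p : wlt mu D p -> wlt mu D (c *: p).
Proof. by move=> hp m /msuppZ_le /hp. Qed.

Lemma whomZ mu D c p : whom mu D p -> whom mu D (c *: p).
Proof. by move=> hp m /msuppZ_le /hp. Qed.

Lemma whomM mu D E p q : whom mu D p -> whom mu E q -> whom mu (D + E) (p * q).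
Proof.
by move=> hp hq m /msuppM_le/allpairsP[[a b] /= [/hp <- /hq <- ->]]; rewrite wtD.
Qed.

Lemma wltMr mu D E p q : wle mu D p -> wlt mu E q -> wlt mu (D + E) (p * q).
Proof.
move=> hp hq m /msuppM_le/allpairsP[[a b] /= [/hp ? /hq ? ->]].
by rewrite wtD ler_ltD.
Qed.

Lemma wleX mu m : wle mu (wt mu m) (mpolyX k m).
Proof. by move=> x; rewrite msuppX inE => /eqP ->. Qed.

Lemma wle_wlt mu D E p : wle mu D p -> D < E -> wlt mu E p.
Proof. by move=> h DE m /h /le_lt_trans; apply. Qed.

Lemma wle_le mu D E p : wle mu D p -> D <= E -> wle mu E p.
Proof. by move=> h DE m /h /le_trans; apply. Qed.

Lemma lead_wle mu D p l : lead mu D p l -> wle mu D p.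
Proof.
by move=> [hl hp]; rewrite -(subrK l p); apply: wleD (wlt_wle hp) (whom_wle hl).
Qed.

Lemma lead_wlt mu D p : wlt mu D p -> lead mu D p 0.
Proof. by move=> h; split; [move=> m; rewrite msupp0 | rewrite subr0]. Qed.

Lemma lead_whom mu D p : whom mu D p -> lead mu D p p.
Proof. by move=> h; split => //; rewrite subrr; apply: wlt0. Qed.

Lemma leadD mu D p q l l' :
  lead mu D p l -> lead mu D q l' -> lead mu D (p + q) (l + l').
Proof.
move=> [hl hp] [hl' hq]; split; first exact: whomD.
by rewrite opprD addrACA; apply: wltD.
Qed.

Lemma leadZ mu D c p l : lead mu D p l -> lead mu D (c *: p) (c *: l).
Proof.
by move=> [hl hp]; split; [exact: whomZ | rewrite -scalerBr; exact: wltZ].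
Qed.

Lemma leadM mu D E p q l l' :
  lead mu D p l -> lead mu E q l' -> lead mu (D + E) (p * q) (l * l').
Proof.
move=> hpl [hl' hq]; have [hl hp] := hpl; split; first exact: whomM.
have -> : p * q - l * l' = p * (q - l') + l' * (p - l) by ring.
apply: wltD; first exact: wltMr (lead_wle hpl) hq.
by rewrite addrC; apply: wltMr (whom_wle hl') hp.
Qed.

Lemma lead1 mu : lead mu 0 1 1.
Proof.
apply: lead_whom => m.
by rewrite msupp1 inE => /eqP ->; rewrite wt0.
Qed.

Lemma leadXn mu D p l e : lead mu D p l -> lead mu (D *+ e) (p ^+ e) (l ^+ e).
Proof.
move=> h; elim: e => [|e ih]; first by rewrite mulr0n !expr0; apply: lead1.
by rewrite mulrS !exprS; apply: leadM.
Qed.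

Lemma lead_prod mu (I : Type) (r : seq I) (D : I -> R) (p l : I -> mpoly n k) :
  (forall i, lead mu (D i) (p i) (l i)) ->
  lead mu (\sum_(i <- r) D i) (\prod_(i <- r) p i) (\prod_(i <- r) l i).
Proof.
move=> h; elim: r => [|i r ih]; first by rewrite !big_nil; apply: lead1.
by rewrite !big_cons; apply: leadM.
Qed.

Lemma lead_sum mu D (I : eqType) (r : seq I) (p l : I -> mpoly n k) :
  (forall i, i \in r -> lead mu D (p i) (l i)) ->
  lead mu D (\sum_(i <- r) p i) (\sum_(i <- r) l i).
Proof.
elim: r => [|i r ih] h; first by rewrite !big_nil; apply/lead_wlt/wlt0.
rewrite !big_cons; apply: leadD; first by apply: h; rewrite inE eqxx.
by apply: ih => j jr; apply: h; rewrite inE jr orbT.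
Qed.

Lemma lead_uniq mu D p l l' : lead mu D p l -> lead mu D p l' -> l = l'.
Proof.
move=> [hl hp] [hl' hp']; apply/eqP; rewrite -subr_eq0; apply/negPn/negP.
move=> /mlead_supp hm.
have h1 : whom mu D (l - l') by rewrite -[X in _ + X]scaleN1r; apply/whomD/whomZ.
have h2 : wlt mu D (l - l').
  have -> : l - l' = (p - l') - (p - l).
    by rewrite opprB [p - l' + _]addrC addrA subrK.
  rewrite -[X in _ + X]scaleN1r.
  by apply/wltD/wltZ.
by move: (h2 _ hm); rewrite (h1 _ hm) ltxx.
Qed.

Lemma lead_msupp mu D p l : lead mu D p l -> l != 0 ->
  exists2 m, m \in msupp p & wt mu m = D.
Proof.
move=> [hl hp] l0; have lm : mlead l \in msupp l by apply: mlead_supp.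
exists (mlead l); last exact: hl.
rewrite mcoeff_msupp -(subrK l p) mcoeffD memN_msupp_eq0 ?add0r -?mcoeff_msupp //.
by apply/negP => /hp; rewrite (hl _ lm) ltxx.
Qed.

End Weights.

Section WeightsComp.
Variables (k : fieldType) (R : realFieldType) (n n' : nat).

Lemma lead_top (mu : 'I_n -> R) D (p : mpoly n k) :
  wle mu D p -> lead mu D p (top mu D p).
Proof.
move=> hp; suff : lead mu D (\sum_(m <- msupp p) mcoeff m p *: mpolyX k m)
    (\sum_(m <- msupp p) if wt mu m == D then mcoeff m p *: mpolyX k m else 0).
  by rewrite -mpolyE -big_mkcond.
apply: lead_sum => m hm; case: eqP => [<-|/eqP ne].
  by apply/leadZ/lead_whom => x; rewrite msuppX inE => /eqP ->.
apply/lead_wlt/wltZ; apply: (wle_wlt (@wleX _ _ _ mu m)).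
by rewrite lt_neqAle ne hp.
Qed.

End WeightsComp.

Section WeightsComp2.
Variables (k : fieldType) (R : realFieldType) (n n' : nat).

Lemma comp_top (d : 'I_n' -> R) D (q : mpoly n' k) (l : n'.-tuple (mpoly n k)) :
  comp_mpoly l (top d D q) =
  \sum_(m <- msupp q)
    mcoeff m q *: (if wt d m == D then \prod_(i < n') tnth l i ^+ m i else 0).
Proof.
rewrite /top raddf_sum big_mkcond /=; apply: eq_bigr => m _.
by case: ifP => _; rewrite ?scaler0 // comp_mpolyZ comp_mpolyX.
Qed.

(** Monomials of [q] of [d]-weight below [D] contribute only weights below [D], so the part of
    weight [D] depends on leading parts alone. These may be zero, so cancellation has not to be
    excluded here. *)
Lemma lead_comp (mu : 'I_n -> R) (d : 'I_n' -> R) D (q l' : mpoly n' k)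
    (v l : n'.-tuple (mpoly n k)) :
  (forall i, lead mu (d i) (tnth v i) (tnth l i)) -> lead d D q l' ->
  lead mu D (comp_mpoly v q) (comp_mpoly l l').
Proof.
move=> hvl hq.
rewrite (lead_uniq hq (lead_top (lead_wle hq))) comp_top comp_mpolyE.
apply: lead_sum => m /(lead_wle hq) hm; apply: leadZ.
have hl : lead mu (wt d m) (\prod_(i < n') tnth v i ^+ m i)
            (\prod_(i < n') tnth l i ^+ m i).
  by apply: lead_prod => i; apply: leadXn.
case: eqP => [<-//|/eqP ne]; apply/lead_wlt; apply: wle_wlt (lead_wle hl) _.
by rewrite lt_neqAle ne.
Qed.

Lemma lead_scale (mu : 'I_n -> R) c D (p l : mpoly n k) : 0 < c ->
  lead mu D p l -> lead (fun i => c * mu i) (c * D) p l.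
Proof.
move=> c0 [hl hp]; split=> m; rewrite wt_scale; first by move=> /hl ->.
by move=> /hp; rewrite ltr_pM2l.
Qed.

End WeightsComp2.

Lemma wle_comp (k : fieldType) (R : realFieldType) (n n' : nat) (mu : 'I_n -> R)
    (d : 'I_n' -> R) D (q : mpoly n' k) (v : n'.-tuple (mpoly n k)) :
  (forall i, wle mu (d i) (tnth v i)) -> wle d D q -> wle mu D (comp_mpoly v q).
Proof.
move=> hv hq; apply: lead_wle.
apply: (@lead_comp _ _ _ _ _ _ _ _ _ _ [tuple top mu (d i) (tnth v i) | i < n']) (lead_top hq).
by move=> i; rewrite tnth_mktuple; apply: lead_top.
Qed.

(** * Degrees of iterates from weights *)

Section Growth.
Variables (k : fieldType) (R : realType) (n : nat).
Implicit Types (f g : endo k n) (mu : 'I_n -> R) (th : R).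

Lemma tnth_comp f g i : tnth (endo_comp f g) i = comp_mpoly g (tnth f i).
Proof. by rewrite tnth_mktuple. Qed.

Lemma tnth_id i : tnth (endo_id k n) i = mpolyX k (mnm1 i).
Proof. by rewrite tnth_mktuple. Qed.

Lemma endo_iterS r f : endo_iter r.+1 f = endo_comp f (endo_iter r f).
Proof. by []. Qed.

Definition growth_le f th :=
  exists2 C : R, 0 < C & forall r, (endo_deg (endo_iter r f))%:R <= C * th ^+ r.

Definition growth_ge f th :=
  exists2 c : R, 0 < c & forall r, c * th ^+ r <= (endo_deg (endo_iter r f))%:R.

(** Multiplying all weights by [th ^+ r] preserves the hypothesis, so each iteration is one more
    application of [lead_comp]; the leading map [g] is iterated along with [f]. *)
Lemma lead_iter f g mu th : 0 < th ->
  (forall i, lead mu (th * mu i) (tnth f i) (tnth g i)) ->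
  forall r i, lead mu (th ^+ r * mu i) (tnth (endo_iter r f) i)
    (tnth (endo_iter r g) i).
Proof.
move=> th0 hf; elim=> [|r ih] i.
  rewrite expr0 mul1r /= tnth_id; apply: lead_whom => m.
  by rewrite msuppX inE => /eqP ->; rewrite wtU.
rewrite !endo_iterS !tnth_comp.
have c0 : 0 < th ^+ r by rewrite exprn_gt0.
rewrite exprSr -mulrA; apply: (lead_comp ih); exact: lead_scale.
Qed.

Lemma wle_iter f mu th : 0 < th -> (forall i, wle mu (th * mu i) (tnth f i)) ->
  forall r i, wle mu (th ^+ r * mu i) (tnth (endo_iter r f) i).
Proof.
move=> th0 hf r i; apply: lead_wle.
apply: (@lead_iter f [tuple top mu (th * mu j) (tnth f j) | j < n]) => // j.
by rewrite tnth_mktuple; apply: lead_top.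
Qed.

Lemma mdeg_endo_deg f i m : m \in msupp (tnth f i) -> (mdeg m <= endo_deg f)%N.
Proof.
move=> hm; have h := msize_mdeg_lt hm.
have := @leq_bigmax _ (fun i => (msize (tnth f i)).-1) i.
rewrite -/(endo_deg f); case: (msize (tnth f i)) h => // s; rewrite ltnS /=.
exact: leq_trans.
Qed.

Lemma endo_degP f (B : nat) :
  (forall i m, m \in msupp (tnth f i) -> (mdeg m <= B)%N) <-> (endo_deg f <= B)%N.
Proof.
split=> [h|h i m /mdeg_endo_deg/leq_trans]; last exact.
apply/bigmax_leqP => i _.
have : (msize (tnth f i) <= B.+1)%N.
  by rewrite msizeE; apply/bigmax_leqP_seq => m hm _; apply: (h i).
by case: (msize _).
Qed.

(** Positive weights lie between two positive constants [a] and [b], so that weight and degree bound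
    each other up to a factor. *)
Lemma growth_le_wle f mu th : 0 < th ->
  (forall i, 0 < mu i) -> (forall i, wle mu (th * mu i) (tnth f i)) ->
  growth_le f th.
Proof.
(* A product of factors in (0, 1] lies below each factor, hence below each weight; it is positive
   for [n = 0] too. *)
move=> th0 mu0 hf; pose a := \prod_i (Num.min 1 (mu i)).
have a0 : 0 < a by apply: prodr_gt0 => i _; rewrite lt_min ltr01 mu0.
have amu i : a <= mu i.
  rewrite /a (bigD1 i) //= -[leRHS]mulr1 ler_pM ?ge_min ?lexx ?orbT ?(ltW (lt_min _ _ _)) //.
  - by rewrite le_min ler01 ltW.
  - by apply: prodr_ge0 => j _; rewrite le_min ler01 ltW.
  - by apply: prodr_ile1 => j _; rewrite le_min ler01 (ltW (mu0 j)) ge_min lexx.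
pose b := \sum_i mu i + 1.
have bmu i : mu i <= b.
  rewrite /b (bigD1 i) //= -addrA lerDl addr_ge0 // sumr_ge0 // => j _; exact: ltW.
have b0 : 0 < b by rewrite ltr_wpDl // sumr_ge0 // => j _; exact: ltW.
exists (b / a) => [|r]; first exact: divr_gt0.
have tr0 : 0 <= b * th ^+ r / a by rewrite ltW // divr_gt0 // mulr_gt0 // exprn_gt0.
have -> : b / a * th ^+ r = b * th ^+ r / a by rewrite mulrAC.
have /endo_degP : forall i m, m \in msupp (tnth (endo_iter r f) i) ->
    (mdeg m <= Num.truncn (b * th ^+ r / a))%N.
  move=> i m /(wle_iter th0 hf) hm; rewrite truncn_ge_nat //.
  rewrite ler_pdivlMr // [_ * a]mulrC.
  have : wt (fun=> a) m <= wt mu m by apply: wt_le.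
  rewrite wt_const mulr_natr => h; apply: le_trans h _; apply: le_trans hm _.
  by rewrite [leRHS]mulrC ler_pM2l ?exprn_gt0.
by rewrite -(ler_nat R) => /le_trans; apply; rewrite truncn_le.
Qed.

(** An upper bound for the weights suffices to turn a monomial of large weight into one of large
    degree. So the weights other than [mu i] may be zero or negative; [has_growth_fibered] uses a
    weight 0. *)
Lemma growth_ge_lead f g mu th i : 0 < th -> 0 < mu i ->
  (forall j, lead mu (th * mu j) (tnth f j) (tnth g j)) ->
  (forall r, tnth (endo_iter r g) i != 0) ->
  growth_ge f th.
Proof.
move=> th0 mui0 hf hg; pose b := \sum_j `|mu j|.
have bmu j : mu j <= b.
  apply: le_trans (ler_norm _) _.
  by rewrite /b (bigD1 j) //= lerDl; apply: sumr_ge0.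
have b0 : 0 < b := lt_le_trans mui0 (bmu i).
exists (mu i / b) => [|r]; first exact: divr_gt0.
have [m hm wm] := lead_msupp (lead_iter th0 hf r i) (hg r).
rewrite mulrAC ler_pdivrMr // [mu i * _]mulrC -wm.
have : wt mu m <= wt (fun=> b) m by apply: wt_le.
move=> /le_trans; apply; rewrite wt_const mulr_natl ler_wpMn2l ?(ltW b0) //.
exact: mdeg_endo_deg hm.
Qed.

End Growth.

(** * Dynamical degrees *)

Section DynamicalDegree.
Variables (k : fieldType) (R : realType) (n : nat).
Implicit Types (f g h : endo k n) (th lambda C : R).

(** C^(1/r) = exp(ln C / r) tends to 1, so constant factors do not affect dynamical degrees. *)
Lemma cvg_root_geometric C th : 0 < C -> 0 < th ->
  ((C * th ^+ r) `^ r%:R^-1 @[r --> \oo] --> th)%classic.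
Proof.
move=> C0 th0.
have inv0 : ((r%:R^-1 : R) @[r --> \oo] --> (0 : R))%classic.
  apply/(@gtr0_cvgV0 _ _ _ _ (fun r : nat => r%:R : R)); last exact: cvgr_idn.
  by near=> r; rewrite ltr0n; near: r; exists 1%N.
have h1 : (expR (r%:R^-1 * ln C) * th @[r --> \oo] --> th)%classic.
  have h0 : (expR (r%:R^-1 * ln C) @[r --> \oo] --> expR (0 * ln C))%classic.
    apply: continuous_cvg; first exact: continuous_expR.
    exact: cvgMr_tmp inv0.
  have := cvgMr_tmp (b := th) h0; rewrite mul0r expR0 mul1r; exact.
apply: cvg_trans h1; apply: near_eq_cvg; near=> r.
have r0 : (0 < r)%N by near: r; exists 1%N.
rewrite powRM ?(ltW C0) ?exprn_ge0 ?(ltW th0) //.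
rewrite -powR_mulrn ?(ltW th0) // -powRrM mulfV ?pnatr_eq0 -?lt0n //.
by rewrite powRr1 ?(ltW th0) // /powR gt_eqF.
Unshelve. all: by end_near. Qed.

Lemma root_ler (a b : R) (r : nat) : 0 <= a -> a <= b -> a `^ r%:R^-1 <= b `^ r%:R^-1.
Proof.
move=> a0 ab; apply: ge0_ler_powR; rewrite ?nnegrE ?invr_ge0 ?ler0n //.
exact: le_trans ab.
Qed.

Lemma dynamical_degree_le f th lambda : 0 < th ->
  growth_le f th -> dynamical_degree f lambda -> lambda <= th.
Proof.
move=> th0 [C C0 h] dl; apply: ler_cvg_to dl (cvg_root_geometric C0 th0) _.
by apply: nearW => r; apply: root_ler.
Qed.

Lemma dynamical_degree_ge f th lambda : 0 < th ->
  growth_ge f th -> dynamical_degree f lambda -> th <= lambda.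
Proof.
move=> th0 [C C0 h] dl; apply: ler_cvg_to (cvg_root_geometric C0 th0) dl _.
by apply: nearW => r; apply: root_ler => //; rewrite mulr_ge0 ?exprn_ge0 ?ltW.
Qed.

Lemma growth_dynamical_degree f th : 0 < th ->
  growth_le f th -> growth_ge f th -> dynamical_degree f th.
Proof.
move=> th0 [C C0 h] [c c0 h'].
apply: squeeze_cvgr (cvg_root_geometric c0 th0) (cvg_root_geometric C0 th0).
apply: nearW => r; rewrite !root_ler // mulr_ge0 ?exprn_ge0 ?ltW //.
Qed.

Lemma endo_eqP f g : (forall i, tnth f i = tnth g i) -> f = g.
Proof. exact: eq_from_tnth. Qed.

Lemma comp_mpolyA (p : mpoly n k) g h :
  comp_mpoly (endo_comp g h) p = comp_mpoly h (comp_mpoly g p).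
Proof.
rewrite (comp_mpolyE p (endo_comp g h)) (comp_mpolyE p g).
rewrite raddf_sum /=; apply: eq_bigr => m _.
rewrite comp_mpolyZ; congr (_ *: _); rewrite rmorph_prod /=.
by apply: eq_bigr => j _; rewrite rmorphXn /= tnth_comp.
Qed.

Lemma endo_compA f g h : endo_comp f (endo_comp g h) = endo_comp (endo_comp f g) h.
Proof. by apply: endo_eqP => i; rewrite !tnth_comp comp_mpolyA. Qed.

Lemma endo_comp1 f : endo_comp f (endo_id k n) = f.
Proof. by apply: endo_eqP => i; rewrite tnth_comp comp_mpoly_id. Qed.

Lemma comp_id_mpoly (g : endo k n) i :
  comp_mpoly g (mpolyX k (mnm1 i)) = tnth g i.
Proof. by rewrite comp_mpolyXU -tnth_nth. Qed.

Lemma endo_1comp f : endo_comp (endo_id k n) f = f.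
Proof. by apply: endo_eqP => i; rewrite tnth_comp tnth_id comp_id_mpoly. Qed.

Lemma endo_deg_comp f g : (endo_deg (endo_comp f g) <= endo_deg f * endo_deg g)%N.
Proof.
apply/endo_degP => i m; rewrite tnth_comp => hm.
have hw : wle (fun=> 1 : R) (endo_deg f * endo_deg g)%:R (comp_mpoly g (tnth f i)).
  apply: (@wle_comp _ _ _ _ _ (fun=> (endo_deg g)%:R)) => [j|] x hx.
    by rewrite wt_const ler_nat (mdeg_endo_deg hx).
  by rewrite wt_const -mulrnA ler_nat mulnC leq_mul2r (mdeg_endo_deg hx) orbT.
by move: (hw _ hm); rewrite wt_const ler_nat.
Qed.

Lemma endo_deg_comp3 f g h :
  (endo_deg (endo_comp f (endo_comp g h)) <=
   endo_deg f * (endo_deg g * endo_deg h))%N.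
Proof.
by rewrite (leq_trans (endo_deg_comp _ _)) // leq_mul2l endo_deg_comp orbT.
Qed.

Definition endo_conj f g := exists phi psi : endo k n,
  [/\ endo_comp phi psi = endo_id k n, endo_comp psi phi = endo_id k n &
      g = endo_comp psi (endo_comp f phi)].

Lemma endo_conj_sym f g : endo_conj f g -> endo_conj g f.
Proof.
move=> [phi [psi [h1 h2 ->]]]; exists psi, phi; split=> //.
by rewrite -!endo_compA h1 endo_comp1 !endo_compA h1 endo_1comp.
Qed.

Lemma endo_conj_trans f g h : endo_conj f g -> endo_conj g h -> endo_conj f h.
Proof.
move=> [phi [psi [h1 h2 ->]]] [phi' [psi' [h1' h2' ->]]].
exists (endo_comp phi phi'), (endo_comp psi' psi); split.
- by rewrite -endo_compA [endo_comp phi' _]endo_compA h1' endo_1comp.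
- by rewrite -endo_compA [endo_comp psi _]endo_compA h2 endo_1comp.
- by rewrite -!endo_compA.
Qed.

Lemma endo_iter_conj f phi psi r : endo_comp phi psi = endo_id k n ->
  endo_comp psi phi = endo_id k n ->
  endo_iter r (endo_comp psi (endo_comp f phi)) =
  endo_comp psi (endo_comp (endo_iter r f) phi).
Proof.
move=> h1 h2; elim: r => [|r ih]; first by rewrite /= endo_1comp h2.
rewrite !endo_iterS ih -!endo_compA; congr endo_comp.
by rewrite [endo_comp phi _]endo_compA h1 endo_1comp endo_compA.
Qed.

Lemma endo_conj_deg f g : endo_conj f g ->
  exists2 C : R, 0 < C &
    forall r, (endo_deg (endo_iter r g))%:R <= C * (endo_deg (endo_iter r f))%:R.
Proof.
move=> [phi [psi [h1 h2 ->]]].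
(* The successor keeps the constant positive even if a degree is 0. *)
exists (endo_deg psi * endo_deg phi).+1%:R => [|r]; first by rewrite ltr0n.
rewrite endo_iter_conj // -natrM ler_nat (leq_trans (endo_deg_comp3 _ _ _)) //.
by rewrite mulnCA mulnC leq_mul2r leqnSn orbT.
Qed.

Lemma endo_conj_growth_le f g th : endo_conj f g -> growth_le g th -> growth_le f th.
Proof.
move=> /endo_conj_sym/endo_conj_deg[C C0 h] [C' C'0 h'].
exists (C * C') => [|r]; first exact: mulr_gt0.
by apply: le_trans (h r) _; rewrite -mulrA ler_pM2l.
Qed.

Lemma endo_conj_growth_ge f g th : endo_conj f g -> growth_ge g th -> growth_ge f th.
Proof.
move=> /endo_conj_deg[C C0 h] [c c0 h'].
exists (c / C) => [|r]; first exact: divr_gt0.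
by rewrite mulrAC ler_pdivrMr // (le_trans (h' r)) // [leRHS]mulrC.
Qed.

End DynamicalDegree.

(** * Realization by monomial maps *)

Section Realization.
Variables (k : fieldType) (R : realType) (n : nat).

Lemma automorphism_comp (f g : endo k n) :
  automorphism f -> automorphism g -> automorphism (endo_comp f g).
Proof.
move=> [f' [h1 h2]] [g' [h3 h4]]; exists (endo_comp g' f'); split.
- by rewrite -endo_compA [endo_comp g _]endo_compA h3 endo_1comp.
- by rewrite -endo_compA [endo_comp f' _]endo_compA h2 endo_1comp.
Qed.

Definition perm_endo (s : 'S_n) : endo k n := [tuple mpolyX k (mnm1 (s i)) | i < n].

Lemma tnth_perm_comp s (f : endo k n) i :
  tnth (endo_comp (perm_endo s) f) i = tnth f (s i).
Proof. by rewrite tnth_comp tnth_mktuple comp_id_mpoly. Qed.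


Lemma perm_endo_affine (s : 'S_n) : (0 < n)%N -> affine_automorphism (perm_endo s).
Proof.
move=> n0; split.
  exists (perm_endo (s^-1)%g); split; apply: endo_eqP => i;
  by rewrite tnth_perm_comp tnth_mktuple tnth_id ?permK ?permKV.
apply/eqP; rewrite eqn_leq; apply/andP; split.
  apply/endo_degP => i m; rewrite tnth_mktuple msuppX inE => /eqP ->.
  by rewrite mdeg1.
rewrite -(mdeg1 (s (Ordinal n0))); apply: (@mdeg_endo_deg _ _ _ (Ordinal n0)).
by rewrite tnth_mktuple msuppX inE.
Qed.

Lemma comp_mpoly_eq (v w : endo k n) (m : multinom n) :
  (forall j, m j != 0%N -> tnth v j = tnth w j) ->
  comp_mpoly v (mpolyX k m) = comp_mpoly w (mpolyX k m).
Proof.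
move=> h; rewrite !comp_mpolyX; apply: eq_bigr => j _.
by have [->|/h ->//] := eqVneq (m j) 0%N; rewrite !expr0.
Qed.

(** The map is [perm_endo s] after [tau 1], which adds the monomial with exponents [M i] to each x_i
    outside [F]. These monomials involve only variables that [tau] fixes, so a change of sign
    inverts it, and only variables of smaller index, so it is triangular. As [M i] outweighs x_i,
    the leading map is monomial, and its iterates cannot vanish. *)
Lemma realized_monomial (s : 'S_n) (F : pred 'I_n) (M : 'I_n -> multinom n)
    (mu : 'I_n -> R) (th : R) : (0 < n)%N -> 0 < th ->
  (forall i j, ~~ F i -> M i j != 0%N -> F j && (j < i)%N) ->
  (forall i, 0 < mu i) -> (forall i, ~~ F i -> mu i < wt mu (M i)) ->
  (forall i, th * mu i = if F (s i) then mu (s i) else wt mu (M (s i))) ->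
  realized k th n.
Proof.
move=> n0 th0 hM mu0 hmu hth; split=> //.
pose x i : mpoly n k := mpolyX k (mnm1 i).
pose tau c : endo k n :=
  [tuple x i + (if F i then 0 else c *: mpolyX k (M i)) | i < n].
have tauK c : endo_comp (tau c) (tau (- c)) = endo_id k n.
  apply: endo_eqP => i; rewrite tnth_comp !tnth_mktuple comp_mpolyD.
  rewrite comp_id_mpoly tnth_mktuple /=.
  case Fi: (F i); first by rewrite comp_mpoly0 !addr0.
  rewrite comp_mpolyZ (comp_mpoly_eq (w := endo_id k n)) ?comp_mpoly_id.
    by rewrite scaleNr subrK.
  move=> j /hM; rewrite Fi => /(_ isT)/andP[Fj _].
  by rewrite tnth_mktuple Fj addr0 tnth_id.
pose f := endo_comp (perm_endo s) (tau 1).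
pose N i := if F (s i) then mnm1 (s i) else M (s i).
pose g : endo k n := [tuple mpolyX k (N i) | i < n].
have fE i : tnth f i = x (s i) + (if F (s i) then 0 else mpolyX k (M (s i))).
  by rewrite tnth_perm_comp tnth_mktuple scale1r.
have hX m : lead mu (wt mu m) (mpolyX k m) (mpolyX k m).
  by apply: lead_whom => y; rewrite msuppX inE => /eqP ->.
have hl i : lead mu (th * mu i) (tnth f i) (tnth g i).
  rewrite fE tnth_mktuple hth /N; case: ifP => [_|/negbT Fs].
    by rewrite addr0 -[X in lead _ X](wtU mu).
  rewrite -[X in lead _ _ _ X]add0r; apply: leadD => //.
  by apply/lead_wlt; apply: wle_wlt (@wleX _ _ _ mu _) _; rewrite wtU hmu.
exists f; split.
- apply: automorphism_comp; first by case: (perm_endo_affine s n0).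
  by exists (tau (-1)); split; [exact: tauK | have := tauK (-1); rewrite opprK].
- exists (perm_endo s), (tau 1); split=> //; first exact: perm_endo_affine.
  move=> i j ij m; rewrite tnth_mktuple => /msuppD_le; rewrite mem_cat.
  case/orP.
    rewrite msuppX inE => /eqP ->; rewrite mnm1E.
    by case: eqP ij => // ->; rewrite ltnn.
  case Fi: (F i); first by rewrite msupp0.
  rewrite scale1r msuppX inE => /eqP ->.
  apply/eqP/negPn/negP => /hM; rewrite Fi => /(_ isT)/andP[_].
  by rewrite ltnNge ltnW.
- apply: growth_dynamical_degree => //.
    by apply: (growth_le_wle th0 mu0) => i; apply: lead_wle (hl i).
  apply: (growth_ge_lead (i := Ordinal n0) th0 _ hl) => // r.
  have : forall i, tnth (endo_iter r g) i != 0.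
    elim: r => [|r ih] i; first by rewrite /= tnth_id -msupp_eq0 msuppX.
    rewrite endo_iterS tnth_comp tnth_mktuple comp_mpolyX.
    by apply/prodf_neq0 => j _; rewrite expf_neq0 // ih.
  exact.
Qed.

End Realization.

Section Systems.
Variables (k : fieldType) (R : realType).

(** The first N coordinates are the x_i, of weights [th * mu i], the last N the y_i, of weights
    [mu i], and [sw] exchanges the halves. The monomial added to y_i has weight th^2 mu_i, which
    exceeds mu_i because th > 1. *)
Lemma realized_system (N : nat) (A : 'I_N -> 'I_N -> nat) (mu : 'I_N -> R) (th : R) :
  (0 < N)%N -> 1 < th -> (forall i, 0 < mu i) ->
  (forall i, th * mu i = \sum_j mu j *+ A i j) -> realized k th (N + N).
Proof.
move=> N0 th1 mu0 hA; have th0 : 0 < th := lt_trans ltr01 th1.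
pose sw (u : 'I_(N + N)) : 'I_(N + N) :=
  match fintype.split u with inl i => rshift N i | inr i => lshift N i end.
have swK : involutive sw.
  move=> u; rewrite /sw; case: (split_ordP u) => i ->;
  by rewrite ?(unsplitK (inl _)) ?(unsplitK (inr _)).
have swl i : sw (lshift N i) = rshift N i by rewrite /sw (unsplitK (inl i)).
have swr i : sw (rshift N i) = lshift N i by rewrite /sw (unsplitK (inr i)).
pose F (u : 'I_(N + N)) := if fintype.split u is inl _ then true else false.
pose M (u : 'I_(N + N)) : multinom (N + N) :=
  mnm_of (fun v => match fintype.split u, fintype.split v with
                   | inr i, inl j => A i j | _, _ => 0%N end).
pose w (u : 'I_(N + N)) := match fintype.split u with inl i => th * mu i | inr i => mu i end.
have wM i : wt w (M (rshift N i)) = th * (th * mu i).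
  rewrite /wt big_split_ord /= [X in _ + X]big1 ?addr0 => [|j _].
    rewrite [in RHS]hA mulr_sumr; apply: eq_bigr => j _.
    by rewrite mnm_ofE /w !(unsplitK (inl _)) (unsplitK (inr _)) mulrnAr.
  by rewrite mnm_ofE !(unsplitK (inr _)).
apply: (@realized_monomial k R _ (perm (inv_inj swK)) F M w th) => //.
- by rewrite addn_gt0 N0.
- move=> u v; rewrite /F /M mnm_ofE.
  case: (split_ordP u) => i -> //; case: (split_ordP v) => j -> // _ _.
  by rewrite /= ltn_addr.
- by move=> u; rewrite /w; case: (fintype.split u) => i; rewrite ?mulr_gt0.
- move=> u; case: (split_ordP u) => i ->; rewrite /F ?(unsplitK (inl _)) // => _.
  rewrite wM /w (unsplitK (inr _)) mulrA -[ltLHS]mul1r ltr_pM2r //.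
  by rewrite -expr2 expr_gt1 ?ltW.
- move=> u; rewrite permE; case: (split_ordP u) => i ->.
    by rewrite swl /F (unsplitK (inr _)) wM /w (unsplitK (inl _)).
  by rewrite swr /F /w (unsplitK (inl _)) (unsplitK (inr _)).
Qed.

Lemma realized_int (d : nat) : (1 < d)%N -> realized k (d%:R : R) 2.
Proof.
move=> d1; apply: (@realized_system 1 (fun _ _ => d) (fun=> 1)) => //.
- by rewrite ltr1n.
- by move=> i; rewrite big_ord1 mulr1.
Qed.

(** The map is (x_2 + x_0^a x_1^b, x_0, x_1) with weights (th^2, th, 1), where [ord_pred] shifts the
    indices cyclically. The monomial has weight a th^2 + b th = th^3. *)
Lemma realized_quadratic_neg (a b : nat) (th : R) : 1 < th ->
  th ^+ 2 = a%:R * th + b%:R -> realized k th 3.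
Proof.
move=> th1 hth; have th0 : 0 < th := lt_trans ltr01 th1.
have pI : injective (@ord_pred 3) by exact: ord_pred_inj.
pose mu (i : 'I_3) := th ^+ (2 - i).
pose M (i : 'I_3) : multinom 3 := mnm_of (fun j => nth 0%N [:: a; b; 0%N] j).
have wM i : wt mu (M i) = th ^+ 3.
  rewrite /wt !big_ord_recl big_ord0 /= /M !mnm_ofE /mu /= addr0 mulr0n addr0.
  rewrite subn0 expr1 [th ^+ 3]exprS {2}hth.
  rewrite -(mulr_natr (th ^+ 2)) -(mulr_natr th); ring.
apply: (@realized_monomial k R _ (perm pI) (fun i => (i < 2)%N) M mu th) => //.
- move=> i j; rewrite -leqNgt => i2; rewrite mnm_ofE.
  by case: j => [[|[|[|]]] //= ?] _; rewrite ?(leq_trans _ i2).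
- by move=> i; rewrite exprn_gt0.
- by move=> i; rewrite wM => _; rewrite /mu ltr_eXn2l // ltnS leq_subr.
- move=> i; rewrite permE.
  case: i => [[|[|[|]]] //= ?]; rewrite ?wM /mu -exprS //.
Qed.

(** As b enters with a minus sign, it cannot serve as an exponent. Instead th is an eigenvalue of a
    2 by 2 matrix of natural numbers with trace a and determinant b: its rows are (p, 1) and (p(a -
    p) - b, a - p), with eigenvector (1, th - p). The choice p = floor(a/2) makes p(a - p) largest,
    and a < 2 th gives th > p. *)
Lemma realized_quadratic_pos (a b : nat) (th : R) : 1 < th ->
  a%:R < 2%:R * th -> (4 * b <= a ^ 2)%N ->
  th ^+ 2 = a%:R * th - b%:R -> realized k th 4.
Proof.
move=> th1 ath ab hth; set p := (a %/ 2)%N.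
(* As a^2 is 0 or 1 modulo 4, 4b <= a^2 implies b <= floor(a^2/4) = p(a - p). *)
have hs : (b <= p * (a - p))%N.
  have [r r2 e] : exists2 r, (r < 2)%N & a = (r + p * 2)%N.
    by exists (a %% 2)%N; rewrite ?ltn_mod // addnC /p -divn_eq.
  have -> : (a - p = r + p)%N by rewrite e muln2 -addnn addnA addnK.
  rewrite e in ab.
  have -> : (p * (r + p) = r * p + p ^ 2)%N by ring.
  have {}ab : (4 * b <= r ^ 2 + 4 * (r * p + p ^ 2))%N.
    by apply: leq_trans ab _; apply/eq_leq; ring.
  by case: r r2 ab {e} => [|[|]] // _ ab; lia.
have pa : (p <= a)%N by rewrite leq_div.
have pth : 0 < th - p%:R.
  have : (2 * p <= a)%N by rewrite mulnC leq_trunc_div.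
  rewrite -(ler_nat R) natrM => h; lra.
pose A (i j : 'I_2) : nat :=
  nth 0%N (nth [::] [:: [:: p; 1%N]; [:: (p * (a - p) - b)%N; (a - p)%N]] i) j.
apply: (@realized_system 2 A (fun i => if val i == 0%N then 1 else th - p%:R)) => //.
  by move=> i; case: eqP.
move=> i; rewrite !big_ord_recl big_ord0 /= addr0 /A.
case: i => [[|[|]] //= ?]; first by rewrite mulr1n; ring.
rewrite -[(th - _) *+ _]mulr_natr natrB // natrM natrB //.
have -> : th * (th - p%:R) = th ^+ 2 - th * p%:R by ring.
by rewrite hth; ring.
Qed.

End Systems.

(** * Normal form of affine-triangular automorphisms *)

Section Bruhat.
Variables (F : fieldType) (n : nat).
Implicit Types (A B L : 'M[F]_n).

(** A Borel subgroup of the general linear group; [unit] refers to invertibility, not to a diagonal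
    of ones. *)
Definition lower_unit L := is_trig_mx L /\ L \in unitmx.

Lemma lower_unit1 : lower_unit 1%:M.
Proof. by split; [apply: scalar_mx_is_trig | apply: unitmx1]. Qed.

Lemma lower_unitM L L' : lower_unit L -> lower_unit L' -> lower_unit (L *m L').
Proof.
move=> [/is_trig_mxP t u] [/is_trig_mxP t' u']; split; last by rewrite unitmx_mul u.
apply/is_trig_mxP => i j ij; rewrite mxE big1 // => l _.
have [il|li] := ltnP i l; first by rewrite t ?mul0r.
by rewrite t' ?mulr0 // (leq_ltn_trans li).
Qed.

Lemma lower_unit_diag L : is_trig_mx L -> (forall i, L i i = 1) -> lower_unit L.
Proof.
by move=> t d; split=> //; rewrite unitmxE det_trig // big1 ?unitr1.
Qed.

Lemma lower_unit_diag_neq0 L i : lower_unit L -> L i i != 0.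
Proof.
move=> [t]; rewrite unitmxE det_trig // unitfE => /prodf_neq0.
exact.
Qed.

Lemma lower_unitV L : lower_unit L -> lower_unit (invmx L).
Proof.
move=> hL; have [/is_trig_mxP t u] := hL; split; last by rewrite unitmx_inv.
apply/is_trig_mxP => i; have [N] := ubnP i; elim: N i => [//|N ih] i iN j ij.
have := mulmxV u => /matrixP/(_ i j); rewrite !mxE -val_eqE /= ltn_eqF //.
rewrite (bigD1 i) //= big1 ?addr0 => [/eqP|l li].
  by rewrite mulf_eq0 (negbTE (lower_unit_diag_neq0 i hL)) => /eqP.
have [il|] := ltnP i l; first by rewrite t ?mul0r.
rewrite leq_eqVlt val_eqE (negbTE li) /= => h.
by rewrite ih ?mulr0 //; [apply: leq_trans h _ | apply: ltn_trans ij].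
Qed.

(* Elementary operations clear row and column of the rightmost nonzero entry of
   the first row that is not yet monomial. *)
Lemma bruhat A : A \in unitmx -> exists L1 L2 (s : 'S_n),
  [/\ lower_unit L1, lower_unit L2 &
      forall i j, ((L1 *m A *m L2) i j != 0) = (j == s i)].
Proof.
move=> Au.
have step r : (r <= n)%N -> exists L1 L2 (c : 'I_n -> 'I_n), let B := L1 *m A *m L2 in
    [/\ lower_unit L1, lower_unit L2 &
      forall i : 'I_n, (i < r)%N -> [/\ B i (c i) != 0, forall j, j != c i -> B i j = 0 &
        forall i', i' != i -> B i' (c i) = 0]].
  elim: r => [|r ih] rn.
    by exists 1%:M, 1%:M, id; split=> //; apply: lower_unit1.
  have [L1 [L2 [c [h1 h2 hB]]]] := ih (ltnW rn).
  set B := L1 *m A *m L2 in hB; pose r' := Ordinal rn.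
  have Bu : B \in unitmx.
    by have [[_ u1] [_ u2]] := (h1, h2); rewrite !unitmx_mul Au u1 u2.
  have [j0 hj0] : exists j0, B r' j0 != 0.
    apply/existsP; apply: contraLR Bu; rewrite negb_exists => /forallP h.
    rewrite unitmxE unitfE (expand_det_row _ r') big1 ?eqxx // => j _.
    by move: (h j); rewrite negbK => /eqP ->; rewrite mul0r.
  (* With the rightmost nonzero entry, only columns to its left remain to be cleared; subtracting
     multiples of column j from these is right multiplication by a lower triangular matrix. *)
  have [j jB jmax] := @arg_maxnP _ j0 (fun j => B r' j != 0) val hj0.
  have right (l : 'I_n) : (j < l)%N -> B r' l = 0.
    by move=> jl; apply/eqP; apply: contraLR jl => /jmax; rewrite -leqNgt.
  have cj (a : 'I_n) : (a < r)%N -> c a != j.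
    move=> ar; apply: contra jB => /eqP <-; have [_ _ ->//] := hB a ar.
    by rewrite -val_eqE /= gtn_eqF.
  pose E2 : 'M[F]_n := \matrix_(a, b)
    ((a == b)%:R - (if (a == j) && (b < j)%N then B r' b / B r' j else 0)).
  have E2E a b : E2 a b =
      (a == b)%:R - (if (a == j) && (b < j)%N then B r' b / B r' j else 0).
    by rewrite mxE.
  have E2l : lower_unit E2.
    apply: lower_unit_diag => [|i]; last first.
      by rewrite mxE eqxx; case: eqP => [->|]; rewrite /= ?ltnn subr0.
    apply/is_trig_mxP => a b ab; rewrite mxE -val_eqE /= ltn_eqF //.
    by case: eqP => [e|_]; rewrite /= ?subr0 // e in ab *; rewrite ltnNge ltnW // subr0.
  pose B' := B *m E2.
  have B'E a l : B' a l = B a l - (if (l < j)%N then B a j * B r' l / B r' j else 0).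
    rewrite mxE; under eq_bigr do rewrite E2E mulrBr; rewrite sumrB; congr (_ - _).
      rewrite (bigD1 l) //= eqxx mulr1 big1 ?addr0 // => b /negbTE bl.
      by rewrite bl mulr0.
    rewrite (bigD1 j) //= eqxx /= big1 ?addr0 => [|b /negbTE ->]; last by rewrite mulr0.
    by case: ifP => _; rewrite ?mulr0 // mulrA.
  have B'r l : l != j -> B' r' l = 0.
    move=> lj; rewrite B'E; have [jl|jl] := ltnP l j.
      by rewrite mulrAC mulfV // mul1r subrr.
    by rewrite subr0 right // ltn_neqAle eq_sym lj.
  have B'j a : B' a j = B a j by rewrite B'E ltnn subr0.
  (* Rows above r' already vanish in column j, so only lower rows have to be cleared, which is again
     a lower triangular operation. *)
  pose E1 : 'M[F]_n := \matrix_(a, b)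
    ((a == b)%:R - (if (b == r') && (r' < a)%N then B a j / B r' j else 0)).
  have E1E a b : E1 a b =
      (a == b)%:R - (if (b == r') && (r' < a)%N then B a j / B r' j else 0).
    by rewrite mxE.
  have E1l : lower_unit E1.
    apply: lower_unit_diag => [|i]; last first.
      by rewrite mxE eqxx; case: eqP => [->|]; rewrite /= ?ltnn subr0.
    apply/is_trig_mxP => a b ab; rewrite mxE -val_eqE /= ltn_eqF //.
    case: eqP => [e|_]; rewrite /= ?subr0 //; rewrite e /= in ab.
    by rewrite ltnNge ltnW // subr0.
  pose C := E1 *m B'.
  have CE a l : C a l = B' a l - (if (r' < a)%N then B a j / B r' j * B' r' l else 0).
    rewrite mxE; under eq_bigr do rewrite E1E mulrBl; rewrite sumrB; congr (_ - _).
      rewrite (bigD1 a) //= eqxx mul1r big1 ?addr0 // => b.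
      by rewrite eq_sym => /negbTE ->; rewrite mul0r.
    rewrite (bigD1 r') //= eqxx /= big1 ?addr0 => [|b /negbTE ->]; last by rewrite mul0r.
    by case: ifP => _; rewrite ?mul0r.
  have Cn a l : l != j -> C a l = B' a l.
    by move=> lj; rewrite CE B'r // mulr0 if_same subr0.
  exists (E1 *m L1), (L2 *m E2), (fun i => if i == r' then j else c i).
  have -> : E1 *m L1 *m A *m (L2 *m E2) = C by rewrite /C /B' /B !mulmxA.
  split; [exact: lower_unitM | exact: lower_unitM | move=> i].
  rewrite ltnS leq_eqVlt => /orP[/eqP ir|ir].
    have -> : i = r' by apply: val_inj.
    rewrite eqxx; split.
    - by rewrite CE ltnn subr0 B'j.
    - by move=> l lj; rewrite Cn // B'r.
    - move=> a ar; rewrite CE B'j; case: ltnP => h; first by rewrite B'j divfK ?subrr.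
      rewrite subr0; have {}ar : (a < r)%N by rewrite ltn_neqAle -val_eqE in ar *; rewrite ar.
      by have [_ -> //] := hB a ar; rewrite eq_sym cj.
  have ne : (i == r') = false by rewrite -val_eqE /= ltn_eqF.
  rewrite ne; have [b1 b2 b3] := hB i ir; have ci := cj i ir.
  have Bij : B i j = 0 by rewrite b2 // eq_sym.
  have B'i l : B' i l = B i l by rewrite B'E Bij mul0r mul0r if_same subr0.
  have Brc : B r' (c i) = 0 by rewrite b3 // eq_sym ne.
  split.
  - by rewrite Cn // B'i.
  - move=> l lc; have [->|lj] := eqVneq l j; last by rewrite Cn // B'i b2.
    by rewrite CE B'i Bij sub0r ltnNge ltnW // oppr0.
  - move=> a ai; rewrite Cn // B'E Brc mulr0 mul0r if_same subr0.
    exact: b3.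
have [L1 [L2 [c [h1 h2 hB]]]] := step n (leqnn n).
have cI : injective c.
  move=> i i' e; apply/eqP/negPn/negP => ne.
  have [_ _ h] := hB i (ltn_ord i); have [h' _ _] := hB i' (ltn_ord i').
  by move: h'; rewrite -e h ?eqxx // eq_sym.
exists L1, L2, (perm cI); split=> // i j; rewrite permE.
have [b1 b2 _] := hB i (ltn_ord i).
have [->|jc] := eqVneq j (c i); first exact: b1.
by rewrite b2 ?eqxx.
Qed.

End Bruhat.

Section LeadMore.
Variables (k : fieldType) (R : realFieldType) (n n' : nat).

Lemma comp_mpoly_supp (p : mpoly n' k) (v w : n'.-tuple (mpoly n k)) :
  (forall m, m \in msupp p -> forall j, m j != 0%N -> tnth v j = tnth w j) ->
  comp_mpoly v p = comp_mpoly w p.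
Proof.
move=> h; rewrite !comp_mpolyE; apply: eq_big_seq => m hm; congr (_ *: _).
by apply: eq_bigr => j _; have [->|/(h m hm)->//] := eqVneq (m j) 0%N; rewrite !expr0.
Qed.

Lemma max_weight (mu : 'I_n -> R) (p : mpoly n k) : p != 0 ->
  exists2 m, m \in msupp p & wle mu (wt mu m) p.
Proof.
rewrite -msupp_eq0 /wle; elim: (msupp p) => [//|m [|m' s] ih] _.
  by exists m => [|x]; rewrite inE // => /eqP ->.
have [//|m1 h1 h2] := ih; have [h|h] := leP (wt mu m) (wt mu m1).
  by exists m1 => [|x]; [rewrite inE h1 orbT | rewrite inE => /orP[/eqP ->|/h2]].
exists m => [|x]; first by rewrite inE eqxx.
by rewrite inE => /orP[/eqP ->//|/h2/le_trans]; apply; apply: ltW.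
Qed.

Lemma lead_exists (mu : 'I_n -> R) (p : mpoly n k) : p != 0 ->
  exists m l, [/\ m \in msupp p, lead mu (wt mu m) p l & l != 0].
Proof.
move=> /(max_weight mu)[m hm h]; exists m, (top mu (wt mu m) p); split=> //.
  exact: lead_top.
apply/eqP => t0; have [_] := lead_top h; rewrite t0 subr0 => /(_ _ hm).
by rewrite ltxx.
Qed.

End LeadMore.

Section LeadInjective.
Variables (k : fieldType) (R : realFieldType) (n n' : nat).

(** Different monomials of [q] have different weights, so nothing can cancel the image of the
    heaviest one. This takes the place of arguments by algebraic independence. *)
Lemma lead_comp_inj (mu : 'I_n -> R) (d : 'I_n' -> R) (q : mpoly n' k)
    (v l : n'.-tuple (mpoly n k)) : q != 0 ->
  (forall i, lead mu (d i) (tnth v i) (tnth l i)) -> (forall i, tnth l i != 0) ->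
  {in msupp q &, injective (wt d)} ->
  exists m L, [/\ m \in msupp q, wle d (wt d m) q,
    lead mu (wt d m) (comp_mpoly v q) L & L != 0].
Proof.
move=> /(max_weight d)[m hm hmax] hv hl inj.
exists m, (mcoeff m q *: \prod_(i < n') tnth l i ^+ m i); split=> //; last first.
  rewrite -mul_mpolyC mulf_neq0 ?mpolyC_eq0 -?mcoeff_msupp //.
  by apply/prodf_neq0 => i _; rewrite expf_neq0.
rewrite comp_mpolyE.
have -> : mcoeff m q *: \prod_(i < n') tnth l i ^+ m i =
    \sum_(m' <- msupp q) if m' == m then mcoeff m q *: \prod_(i < n') tnth l i ^+ m i else 0.
  by rewrite (bigD1_seq m) ?msupp_uniq //= eqxx [X in _ + X]big1 ?addr0 // => m' /negbTE ->.
have hp m' : lead mu (wt d m') (\prod_(i < n') tnth v i ^+ m' i)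
                  (\prod_(i < n') tnth l i ^+ m' i).
  by apply: lead_prod => i; apply: leadXn.
apply: lead_sum => m' hm'; have [->|ne] := eqVneq m' m; first exact: leadZ.
apply/lead_wlt/wltZ; apply: wle_wlt (lead_wle (hp m')) _.
rewrite lt_neqAle hmax // andbT; apply: contra ne => /eqP/inj -> //.
Qed.

End LeadInjective.

Section NormalForm.
Variables (k : fieldType) (n : nat).
Implicit Types (f g : endo k n) (p q : mpoly n k) (A B : 'M[k]_n) (b c : 'I_n -> k).

Let x (i : 'I_n) : mpoly n k := mpolyX k (mnm1 i).

(** Membership in k[x_0, ..., x_(i-1)]; [below 0] singles out the constants. *)
Definition below (i : nat) p :=
  forall m, m \in msupp p -> forall j : 'I_n, (i <= j)%N -> m j = 0%N.

Lemma below_comp i i' p g : below i p ->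
  (forall j : 'I_n, (j < i)%N -> below i' (tnth g j)) -> below i' (comp_mpoly g p).
Proof.
move=> hp hg; pose g' : endo k n := [tuple if (j < i)%N then tnth g j else 0 | j < n].
have -> : comp_mpoly g p = comp_mpoly g' p.
  apply: comp_mpoly_supp => m hm j mj; rewrite tnth_mktuple; case: ltnP => // ij.
  by rewrite (hp m hm j ij) in mj.
(* This weight counts the variables of index at least i', with multiplicity, so [below i'] becomes a
   bound by weight 0 and [wle_comp] applies. *)
pose e (j : 'I_n) : rat := (i' <= j)%N%:R.
have wE (m : multinom n) : (forall j : 'I_n, (i' <= j)%N -> m j = 0%N) <-> wt e m <= 0.
  split=> [h|].
    rewrite /wt big1 // => j _; rewrite /e; case: leqP => ij; last by rewrite mul0rn.
    by rewrite h.
  move=> h j ij; apply/eqP/negPn/negP => mj; move: h; rewrite leNgt => /negP; apply.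
  rewrite /wt (bigD1 j) //= ltr_wpDr ?sumr_ge0 // /e ?ij => *; rewrite ?mulrn_wge0 //.
  by rewrite pmulrn_lgt0 ?ltr01 // lt0n.
have hw : wle e 0 (comp_mpoly g' p).
  apply: (@wle_comp _ _ _ _ _ (fun=> 0)) => [j|m hm].
    rewrite tnth_mktuple; case: ltnP => ji; last exact: wle0.
    by move=> m hm; apply/wE; apply: hg hm.
  by rewrite wt_const mul0rn.
by move=> m /hw/wE.
Qed.

Lemma belowD i p q : below i p -> below i q -> below i (p + q).
Proof. by move=> hp hq m /msuppD_le; rewrite mem_cat => /orP[/hp|/hq]. Qed.

Lemma belowZ i a p : below i p -> below i (a *: p).
Proof. by move=> hp m /msuppZ_le/hp. Qed.

Lemma belowC i a : below i (mpolyC n a).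
Proof.
move=> m; rewrite msuppC; case: ifP => // _; rewrite inE => /eqP -> j _.
by rewrite mnm0E.
Qed.

Lemma below_le i j p : (i <= j)%N -> below i p -> below j p.
Proof. by move=> ij h m hm l jl; apply: h hm _ (leq_trans ij jl). Qed.

Lemma belowX (i : nat) (j : 'I_n) : (j < i)%N -> below i (x j).
Proof.
move=> ji m; rewrite msuppX inE => /eqP -> l il; rewrite mnm1E.
by case: eqP => // e; move: il; rewrite -e leqNgt ji.
Qed.

Definition tri f := forall i : 'I_n, exists a p,
  [/\ a != 0, below i p & tnth f i = a *: x i + p].

Lemma tri_below f (i : 'I_n) : tri f -> below i.+1 (tnth f i).
Proof.
move=> /(_ i)[a [p [_ hp ->]]]; apply: belowD; first exact/belowZ/belowX.
exact: below_le hp.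
Qed.

Lemma tri_comp f g : tri f -> tri g -> tri (endo_comp f g).
Proof.
move=> hf hg i; have [a [p [a0 hp fE]]] := hf i; have [b [q [b0 hq gE]]] := hg i.
exists (a * b), (a *: q + comp_mpoly g p); split; first by rewrite mulf_neq0.
  apply: belowD; first exact: belowZ.
  by apply: (below_comp hp) => j ji; apply: below_le (tri_below hg).
by rewrite tnth_comp fE comp_mpolyD comp_mpolyZ comp_id_mpoly gE scalerDr scalerA addrA.
Qed.

Definition affine_endo A b : endo k n :=
  [tuple \sum_j A i j *: x j + mpolyC n (b i) | i < n].

Lemma tnth_lin_comp A b g i :
  tnth (endo_comp (affine_endo A b) g) i = \sum_j A i j *: tnth g j + mpolyC n (b i).
Proof.
rewrite tnth_comp tnth_mktuple comp_mpolyD comp_mpolyC raddf_sum /=.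
by congr (_ + _); apply: eq_bigr => j _; rewrite comp_mpolyZ comp_id_mpoly.
Qed.

Lemma lin_comp A b B c :
  endo_comp (affine_endo A b) (affine_endo B c) = affine_endo (A *m B) (fun i => \sum_j A i j * c j + b i).
Proof.
apply: endo_eqP => i; rewrite tnth_lin_comp tnth_mktuple mpolyCD addrA; congr (_ + _).
under eq_bigr do rewrite tnth_mktuple scalerDr scaler_sumr.
rewrite big_split /= exchange_big /=; congr (_ + _).
  apply: eq_bigr => j _; rewrite mxE scaler_suml.
  by apply: eq_bigr => l _; rewrite scalerA.
by rewrite raddf_sum /=; apply: eq_bigr => j _; rewrite mpolyCM mul_mpolyC.
Qed.

Lemma lin1 : affine_endo 1%:M (fun=> 0) = endo_id k n.
Proof.
apply: endo_eqP => i; rewrite !tnth_mktuple mpolyC0 addr0 (bigD1 i) //= mxE eqxx scale1r.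
rewrite big1 ?addr0 // => j ji.
by rewrite mxE eq_sym (negbTE ji) scale0r.
Qed.

Lemma mcoeff_lin A b i j : mcoeff (mnm1 j) (tnth (affine_endo A b) i) = A i j.
Proof.
rewrite tnth_mktuple mcoeffD mcoeffC mnm1_eq0 mulr0 addr0 raddf_sum /= (bigD1 j) //=.
rewrite mcoeffZ mcoeffX eqxx mulr1 big1 ?addr0 // => l lj.
by rewrite mcoeffZ mcoeffX eq_mnm1 (negbTE lj) mulr0.
Qed.

(** The matrix is invertible because the linear coefficients of f o g depend only on those of g when
    f has degree 1, whatever the degree of g. *)
Lemma affine_lin f : affine_automorphism f ->
  exists A b, A \in unitmx /\ f = affine_endo A b.
Proof.
move=> [[g [fg gf]] f1].
pose A : 'M[k]_n := \matrix_(i, j) mcoeff (mnm1 j) (tnth f i).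
pose b i := mcoeff mnm0 (tnth f i).
have fE : f = affine_endo A b.
  apply: endo_eqP => i; apply/mpolyP => m.
  have [m1|] := boolP (mdeg m == 1%N).
    by move: m1 => /mdeg1P[j /eqP ->]; rewrite mcoeff_lin mxE.
  have [|m0 m1] := boolP (mdeg m == 0%N).
    rewrite mdeg_eq0 => /eqP -> _; rewrite tnth_mktuple mcoeffD mcoeffC eqxx mulr1.
    rewrite raddf_sum /= big1 ?add0r // => j _.
    by rewrite mcoeffZ mcoeffX mnm1_eq0 mulr0.
  have hm : (1 < mdeg m)%N by case: (mdeg m) m0 m1 => [|[]].
  rewrite tnth_mktuple mcoeffD mcoeffC -mdeg_eq0 (negbTE m0) mulr0 addr0.
  rewrite raddf_sum /= big1 => [|j _]; last first.
    rewrite mcoeffZ mcoeffX; case: eqP => [e|_]; last by rewrite mulr0.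
    by move: m1; rewrite -e mdeg1.
  by apply: memN_msupp_eq0; apply/negP => /mdeg_endo_deg; rewrite f1 leqNgt hm.
exists A, b; split=> //.
have : A *m (\matrix_(i, j) mcoeff (mnm1 j) (tnth g i)) = 1%:M.
  apply/matrixP => i j; have := congr1 (fun h => mcoeff (mnm1 j) (tnth h i)) fg.
  rewrite fE tnth_lin_comp tnth_id mcoeffD mcoeffC mnm1_eq0 mulr0 addr0 mcoeffX.
  rewrite raddf_sum /= !mxE eq_mnm1 => <-; apply: eq_bigr => l _.
  by rewrite mcoeffZ; congr (_ * _); rewrite mxE.
by move=> /mulmx1_unit[].
Qed.

End NormalForm.

(** * Monomials as numbers in base M *)

Section Digits.
Variables (n M : nat).
Implicit Types (m : multinom n).

Definition digits m := (\sum_(l < n) m l * M ^ l)%N.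

Lemma digits_inj m m' : (forall l, (m l < M)%N) -> (forall l, (m' l < M)%N) ->
  digits m = digits m' -> m = m'.
Proof.
move=> h h' e; apply/mnmP.
suff gen N (a b : nat -> nat) : (forall l, (l < N)%N -> (a l < M)%N /\ (b l < M)%N) ->
    (\sum_(l < N) a l * M ^ l = \sum_(l < N) b l * M ^ l)%N ->
    forall l, (l < N)%N -> a l = b l.
  move=> l.
  have := gen n (fun j => if insub j is Some i then m i else 0%N)
    (fun j => if insub j is Some i then m' i else 0%N) _ _ l (ltn_ord l).
  rewrite valK; apply=> [j jn|]; first by rewrite insubT.
  by transitivity (digits m); [|rewrite e]; apply: eq_bigr => j _; rewrite valK.
elim: N a b => [//|N ih] a b hab.
rewrite !big_ord_recl /= !expn0 !muln1.
have [a0 b0] := hab 0%N isT.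
have shift (c : nat -> nat) : (\sum_(l < N) c (bump 0 l) * M ^ bump 0 l =
    (\sum_(l < N) c l.+1 * M ^ l) * M)%N.
  by rewrite big_distrl; apply: eq_bigr => l _; rewrite /bump /= add1n expnSr mulnA.
rewrite !shift => eab.
have ab0 : a 0%N = b 0%N.
  by move/(congr1 (modn^~ M)): eab; rewrite ![(_ + _ * M)%N]addnC !modnMDl !modn_small.
case=> [//|l] lN; apply: (ih (a \o succn) (b \o succn)) => //= [j jN|].
  by apply: hab.
move: eab; rewrite ab0 => /addnI/eqP; rewrite eqn_pmul2r; first by move/eqP.
exact: leq_ltn_trans b0.
Qed.

(** Each of the fewer than M variables in m, counted with multiplicity, contributes at most M^(i-1).
    The proof multiplies by M to avoid the exponent i - 1. *)
Lemma digits_lt m i : (0 < M)%N -> (mdeg m < M)%N ->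
  (forall l : 'I_n, (i <= l)%N -> m l = 0%N) -> (digits m < M ^ i)%N.
Proof.
move=> M0 hm h; rewrite -(ltn_pmul2l M0); apply: leq_ltn_trans (_ : mdeg m * M ^ i < _)%N.
  rewrite /digits big_distrr mdegE big_distrl /=; apply: leq_sum => l _.
  have [il|li] := leqP i l; first by rewrite h // muln0.
  by rewrite mulnCA leq_mul2l -expnS leq_pexp2l ?orbT.
by rewrite ltn_pmul2r // expn_gt0 M0.
Qed.

Lemma digits_ge m (l : 'I_n) : m l != 0%N -> (M ^ l <= digits m)%N.
Proof.
move=> ml; rewrite /digits (bigD1 l) //= (leq_trans _ (leq_addr _ _)) //.
by rewrite leq_pmull // lt0n.
Qed.

Lemma digitsU i : digits (mnm1 i) = (M ^ i)%N.
Proof.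
rewrite /digits (bigD1 i) //= mnm1E eqxx mul1n big1 ?addn0 // => l li.
by rewrite mnm1E eq_sym (negbTE li).
Qed.

Lemma wt_digits m : wt (fun l : 'I_n => (M ^ l)%N%:R : rat) m = (digits m)%:R.
Proof.
by rewrite /wt /digits natr_sum; apply: eq_bigr => l _; rewrite mulnC natrM mulr_natr.
Qed.

End Digits.

Section TriangularAutomorphism.
Variables (k : fieldType) (n : nat).
Implicit Types (f g : endo k n) (p q : mpoly n k).

Lemma split_linear (p : mpoly n k) (i : 'I_n) : mnm1 i \in msupp p ->
  (forall m, m \in msupp p -> m != mnm1 i -> forall j : 'I_n, (i <= j)%N -> m j = 0%N) ->
  exists a q, [/\ a != 0, below i q & p = a *: mpolyX k (mnm1 i) + q].
Proof.
move=> hi h; exists (mcoeff (mnm1 i) p), (p - mcoeff (mnm1 i) p *: mpolyX k (mnm1 i)).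
split; first by rewrite -mcoeff_msupp.
  move=> m hm; have [e|ne] := eqVneq m (mnm1 i).
    by move: hm; rewrite e mcoeff_msupp mcoeffB mcoeffZ mcoeffX eqxx mulr1 subrr eqxx.
  apply: h => //; move: hm; rewrite !mcoeff_msupp mcoeffB mcoeffZ mcoeffX.
  by rewrite (eq_sym (mnm1 i)) (negbTE ne) mulr0 subr0.
by rewrite addrC subrK.
Qed.

Lemma automorphism_neq0 f g i : endo_comp f g = endo_id k n -> tnth f i != 0.
Proof.
move=> /(congr1 (fun h => tnth h i)); rewrite tnth_comp tnth_id => e.
apply/eqP => f0; move: e; rewrite f0 comp_mpoly0 => /(congr1 (mcoeff (mnm1 i))).
by rewrite mcoeff0 mcoeffX eqxx => /eqP; rewrite eq_sym oner_eq0.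
Qed.

(* With weights M^l for M large, distinct monomials of f o g get distinct weights;
   comparing the leading term of the i-th component of f o g with x_i shows that
   x_i is the leading monomial of both f_i and g_i. *)
Lemma triangular_automorphism f : triangular f -> automorphism f -> tri f.
Proof.
move=> tf [g [fg gf]].
(* All exponents in f and g are digits in base M, and M >= 2 makes the exponent 1 of x_i a digit as
   well. *)
pose M := (endo_deg f + endo_deg g).+2.
have M0 : (0 < M)%N by [].
pose nu (l : 'I_n) : rat := (M ^ l)%N%:R.
have fM i m : m \in msupp (tnth f i) -> (mdeg m < M)%N.
  by move=> /mdeg_endo_deg h; rewrite /M; lia.
have gM i m : m \in msupp (tnth g i) -> (mdeg m < M)%N.
  by move=> /mdeg_endo_deg h; rewrite /M; lia.
have digit m l : (mdeg m < M)%N -> (m l < M)%N.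
  by apply: leq_ltn_trans; rewrite mdegE (bigD1 l) //= leq_addr.
have g0 i : tnth g i != 0 := automorphism_neq0 i gf.
have f0 i : tnth f i != 0 := automorphism_neq0 i fg.
suff H (N : nat) : forall i : 'I_n, (i < N)%N ->
    (exists a p, [/\ a != 0, below i p & tnth f i = a *: mpolyX k (mnm1 i) + p]) /\
    (exists a p, [/\ a != 0, below i p & tnth g i = a *: mpolyX k (mnm1 i) + p]).
  by move=> i; have [] := H n i (ltn_ord i).
elim: N => [//|N ih] i; rewrite ltnS leq_eqVlt => /orP[/eqP iN|]; last exact: ih.
have {}ih (j : 'I_n) : (j < i)%N -> exists a p,
    [/\ a != 0, below j p & tnth g j = a *: mpolyX k (mnm1 j) + p].
  by rewrite iN => /ih[].
have fb : below i.+1 (tnth f i) by move=> m hm j ij; apply: tf hm.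
have /choice[D hD] : forall j, exists d : nat * mpoly n k,
    [/\ lead nu d.1%:R (tnth g j) d.2, d.2 != 0, (j < i)%N -> d.1 = (M ^ j)%N &
      exists2 m, m \in msupp (tnth g j) & digits M m = d.1].
  move=> j; have [m [l [hm hl l0]]] := lead_exists nu (g0 j).
  exists (digits M m, l); split=> //=; first by rewrite -wt_digits.
    move=> /ih[a [p [a0 hp gE]]].
    have Uj : mnm1 j \in msupp (tnth g j).
      rewrite mcoeff_msupp gE mcoeffD mcoeffZ mcoeffX eqxx mulr1 memN_msupp_eq0 ?addr0 //.
      by apply/negP => /hp/(_ j (leqnn j)); rewrite mnm1E eqxx.
    have := lead_wle hl Uj; rewrite !wt_digits ler_nat digitsU => h.
    apply/eqP; rewrite eqn_leq h andbT; move: (hm); rewrite gE => /msuppD_le.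
    rewrite mem_cat => /orP[/msuppZ_le|/hp hm'].
      by rewrite msuppX inE => /eqP ->; rewrite digitsU.
    by apply/ltnW/digits_lt => //; apply: gM hm.
  by exists m.
(* Otherwise g_0, ..., g_i would involve only variables before x_i, and so would f_i(g) = x_i. *)
have MD : (M ^ i <= (D i).1)%N.
  apply/negPn/negP; rewrite -ltnNge => Di.
  have gb (j : 'I_n) : (j < i.+1)%N -> below i (tnth g j).
    rewrite ltnS leq_eqVlt => /orP[/eqP/val_inj -> m hm l il|ji].
      apply/eqP/negPn/negP => ml; have [hl _ _ _] := hD i.
      have := lead_wle hl hm; rewrite wt_digits ler_nat => h.
      have := leq_trans (digits_ge M ml) h; rewrite leqNgt (leq_trans Di) //.
      by rewrite leq_pexp2l.
    have [a [p [_ hp ->]]] := ih j ji.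
    by apply: belowD; [apply/belowZ/belowX | apply: below_le hp; apply: ltnW].
  have := congr1 (fun h => tnth h i) fg; rewrite tnth_comp tnth_id => e.
  have := below_comp fb gb; rewrite e => /(_ (mnm1 i)); rewrite msuppX inE eqxx.
  by move=> /(_ isT i (leqnn i)); rewrite mnm1E eqxx.
pose low (m : multinom n) : multinom n :=
  mnm_of (fun l : 'I_n => if (l < i)%N then m l else 0%N).
have low_lt m : m \in msupp (tnth f i) -> (mdeg (low m) < M)%N.
  move=> /fM; apply: leq_ltn_trans; rewrite !mdegE; apply: leq_sum => l _.
  by rewrite mnm_ofE; case: ifP.
have dlow m : m \in msupp (tnth f i) -> (digits M (low m) < M ^ i)%N.
  move=> /low_lt h; apply: digits_lt => // l il.
  by rewrite mnm_ofE ltnNge il.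
pose d (l : 'I_n) : rat := (D l).1%:R.
(* This is a division with remainder by the weight of g_i: by [dlow] the second summand is below
   M^i, hence below that weight. So the weight determines [m i] and [low m]. *)
have wd m : m \in msupp (tnth f i) ->
    wt d m = (m i * (D i).1 + digits M (low m))%N%:R.
  move=> hm; transitivity ((\sum_l m l * (D l).1)%N%:R : rat).
    rewrite natr_sum; apply: eq_bigr => l _.
    by rewrite mulnC natrM mulr_natr.
  congr (_%:R); rewrite /digits (bigD1 i) //= [in RHS](bigD1 i) //=.
  rewrite mnm_ofE ltnn mul0n add0n; congr addn; apply: eq_bigr => l li.
  rewrite mnm_ofE; case: ltngtP => [h|h|/val_inj e]; last by rewrite e eqxx in li.
    by have [_ _ -> //] := hD l.
  by rewrite (fb m hm l h) !mul0n.
have inj : {in msupp (tnth f i) &, injective (wt d)}.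
  move=> m m' hm hm'; rewrite !wd // => /eqP; rewrite eqr_nat => /eqP e.
  have Di0 : (0 < (D i).1)%N by apply: leq_trans MD; rewrite expn_gt0.
  have ei : m i = m' i.
    move/(congr1 (divn^~ (D i).1)): e; rewrite !divnMDl // !divn_small ?addn0 //.
      by apply: leq_trans (dlow m' hm') MD.
    by apply: leq_trans (dlow m hm) MD.
  move: e; rewrite ei => /addnI e.
  have el : low m = low m'.
    by apply: (digits_inj (M := M)) e => l; apply: digit; apply: low_lt.
  apply/mnmP => l; have := congr1 (fun w : multinom n => w l) el; rewrite !mnm_ofE.
  case: ltngtP => // [h _|/val_inj -> //].
  by rewrite (fb m hm l h) (fb m' hm' l h).
have hl j : lead nu (d j) (tnth g j) (tnth [tuple (D j).2 | j < n] j).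
  by rewrite tnth_mktuple; have [] := hD j.
have hl0 j : tnth [tuple (D j).2 | j < n] j != 0.
  by rewrite tnth_mktuple; have [] := hD j.
have [m0 [L [hm0 hmax hL L0]]] := lead_comp_inj (f0 i) hl hl0 inj.
have := congr1 (fun h => tnth h i) fg; rewrite tnth_comp tnth_id => fgi.
rewrite fgi in hL; have [mu] := lead_msupp hL L0.
rewrite msuppX inE => /eqP ->; rewrite wt_digits digitsU wd // => /eqP.
rewrite eqr_nat => /eqP eM.
(* The leading weight of f_i(g) = x_i is M^i. Its decomposition forces [m0 i] to be positive and
   then [(D i).1] to be M^i, so x_i is the only monomial of f_i that contains x_i. *)
have m0i : m0 i != 0%N.
  by apply/eqP => z; have := dlow m0 hm0; rewrite eM z mul0n add0n ltnn.
have DM : (D i).1 = (M ^ i)%N.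
  apply/eqP; rewrite eqn_leq MD andbT eM (leq_trans _ (leq_addr _ _)) //.
  by rewrite leq_pmull // lt0n.
have key m : m \in msupp (tnth f i) -> m i != 0%N -> m = mnm1 i.
  move=> hm mi; have := hmax m hm; rewrite !wd // ler_nat -eM DM.
  have P0 : (0 < M ^ i)%N by rewrite expn_gt0.
  move=> h; have m1 : m i = 1%N.
    apply/eqP; rewrite eqn_leq lt0n mi andbT -(leq_pmul2r P0) mul1n.
    exact: leq_trans (leq_addr _ _) h.
  move: h; rewrite m1 mul1n -[leqRHS]addn0 leq_add2l leqn0 => /eqP dl0.
  apply/mnmP => l; rewrite mnm1E -val_eqE /=; case: ltngtP => [h|h|/val_inj <- //].
    by rewrite (fb m hm l h).
  apply/eqP/negPn/negP => ml; have := @digits_ge n M (low m) l.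
  by rewrite mnm_ofE h ml dl0 leqNgt expn_gt0 => /(_ isT).
split.
  apply: split_linear; first by rewrite -(key m0 hm0 m0i).
  move=> m hm ne j; rewrite leq_eqVlt => /orP[/eqP/val_inj <-|]; last exact: fb.
  by apply/eqP/negPn/negP => mi; move: ne; rewrite (key m hm mi) eqxx.
have [hli _ _ [m1 hm1 em1]] := hD i; rewrite DM in hli em1.
have gU m : m \in msupp (tnth g i) -> digits M m = (M ^ i)%N -> m = mnm1 i.
  move=> hm; rewrite -(digitsU M i); apply: digits_inj => l; first exact/digit/(gM i).
  by rewrite mnm1E; case: (_ == _).
apply: split_linear; first by rewrite -(gU m1).
move=> m hm ne j ij; apply/eqP/negPn/negP => mj; move/negP: ne; apply.
have := lead_wle hli hm; rewrite wt_digits ler_nat => h; apply/eqP/gU => //.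
apply/eqP; rewrite eqn_leq h; apply: leq_trans (digits_ge M mj).
by rewrite leq_pexp2l.
Qed.

End TriangularAutomorphism.

Section NormalForm.
Variables (k : fieldType) (n : nat).
Implicit Types (f g h : endo k n) (A L : 'M[k]_n).

Lemma tri_lin (A : 'M[k]_n) b : is_trig_mx A -> (forall i, A i i != 0) -> tri (affine_endo A b).
Proof.
move=> /is_trig_mxP t d i.
exists (A i i), (\sum_(j | j != i) A i j *: mpolyX k (mnm1 j) + mpolyC n (b i)).
split=> //; last by rewrite tnth_mktuple (bigD1 i) //= addrA.
apply: belowD; last exact: belowC.
elim/big_ind: _ => [m||j ji]; first by rewrite msupp0.
  by move=> p q; apply: belowD.
have [ij|ji'] := ltnP i j; first by rewrite t // scale0r => m; rewrite msupp0.
by apply/belowZ/belowX; rewrite ltn_neqAle val_eqE ji.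
Qed.

(** Let A be the linear part of [al]. Conjugation by L1 puts L1 before [al] and its inverse after
    [tau]. If B = L1 A L2 is monomial, L1 A = B L2^-1 is a permutation matrix times a lower
    triangular one; the latter, [tau] and the inverse of L1 compose to [h]. *)
Lemma affine_triangular_normal f : automorphism f -> affine_triangular f ->
  exists (s : 'S_n) h, tri h /\ endo_conj f (endo_comp (perm_endo k s) h).
Proof.
move=> fa [al [tau [ala taut fE]]].
have [A [b [Au alE]]] := affine_lin ala.
(* Triangular endomorphisms need not be invertible; [tau] is, because [al] and [f] are. *)
have taua : automorphism tau.
  have [[al' [h1 h2]] _] := ala.
  have -> : tau = endo_comp al' f by rewrite fE endo_compA h2 endo_1comp.
  by apply: automorphism_comp => //; exists al.
have [L1 [L2 [s [h1 h2 hB]]]] := bruhat Au.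
pose phi := affine_endo (invmx L1) (fun=> 0); pose psi := affine_endo L1 (fun=> 0).
have [[_ u1] [_ u2]] := (h1, h2).
have lin0 (B C : 'M[k]_n) : B *m C = 1%:M ->
    endo_comp (affine_endo B (fun=> 0)) (affine_endo C (fun=> 0)) = endo_id k n.
  move=> BC; rewrite lin_comp BC -lin1; congr affine_endo; apply/funext => i.
  by rewrite addr0 big1 // => j _; rewrite mulr0.
pose c i := \sum_j L1 i j * b j + 0.
pose h0 : endo k n := [tuple tnth (affine_endo (L1 *m A) c) ((s^-1)%g i) | i < n].
exists s, (endo_comp h0 (endo_comp tau phi)); split; last first.
  exists phi, psi; split; [exact/lin0/mulVmx | exact/lin0/mulmxV |].
  rewrite fE alE -!endo_compA [endo_comp psi _]endo_compA lin_comp.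
  rewrite [in LHS]endo_compA; congr endo_comp; apply: endo_eqP => i.
  by rewrite tnth_perm_comp tnth_mktuple permK.
have tphi : tri phi.
  have hV := lower_unitV h1; apply: tri_lin; first by case: hV.
  by move=> i; apply: lower_unit_diag_neq0.
apply: tri_comp; last by apply: tri_comp => //; apply: triangular_automorphism.
pose B := L1 *m A *m L2; pose D := \matrix_(i, j) (L1 *m A) ((s^-1)%g i) j.
(* Row i of [D] is a nonzero multiple of row i of the inverse of [L2], since each row of [B] has a
   single nonzero entry. *)
have DE i j : D i j = B ((s^-1)%g i) i * invmx L2 i j.
  have -> : D i j = (B *m invmx L2) ((s^-1)%g i) j by rewrite mulmxK // mxE.
  rewrite mxE (bigD1 i) //= big1 ?addr0 // => l li.
  have := hB ((s^-1)%g i) l; rewrite permKV (negbTE li) => /negbT.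
  by rewrite negbK => /eqP ->; rewrite mul0r.
have -> : h0 = affine_endo D (fun i => c ((s^-1)%g i)).
  apply: endo_eqP => i; rewrite !tnth_mktuple; congr (_ + _).
  by apply: eq_bigr => j _; rewrite [in RHS]mxE.
have hV := lower_unitV h2; apply: tri_lin => [|i].
  apply/is_trig_mxP => i j ij; rewrite DE.
  by have [/is_trig_mxP ->] := hV; rewrite ?mulr0.
rewrite DE mulf_neq0 ?lower_unit_diag_neq0 //.
by rewrite hB permKV.
Qed.

End NormalForm.

Section HasGrowth.
Variables (k : fieldType) (R : realType).

(* No lower bound is required for [th = 1], as dynamical degrees are at least 1. *)
Definition has_growth n (g : endo k n) (th : R) :=
  (forall t, th < t -> growth_le g t) /\ (1 < th -> growth_ge g th).

Lemma has_growth_unique n (f g : endo k n) (th lambda : R) :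
  endo_conj f g -> 1 <= th -> 1 <= lambda -> has_growth g th ->
  dynamical_degree f lambda -> lambda = th.
Proof.
move=> fg th1 l1 [hu hl] dl; apply/eqP; rewrite eq_le; apply/andP; split.
  apply/ler_addgt0Pr => e e0; apply: (dynamical_degree_le _ _ dl).
    by rewrite addr_gt0 // (lt_le_trans ltr01).
  by apply: (endo_conj_growth_le fg); apply: hu; rewrite ltrDl.
move: th1; rewrite [1 <= th]le_eqVlt => /predU1P[<- //|th1].
apply: (dynamical_degree_ge _ _ dl); first exact: lt_trans th1.
exact: (endo_conj_growth_ge fg) (hl th1).
Qed.

Lemma wle_linear n (mu : 'I_n -> R) D a i (p : mpoly n k) :
  mu i <= D -> wle mu D p -> wle mu D (a *: mpolyX k (mnm1 i) + p).
Proof.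
move=> h hp; apply: wleD => //; apply/wleZ/(wle_le (@wleX _ _ _ _ _)).
by rewrite wtU.
Qed.

Lemma lead_linear n (mu : 'I_n -> R) D a i (p : mpoly n k) :
  mu i < D -> wle mu D p -> lead mu D (a *: mpolyX k (mnm1 i) + p) (top mu D p).
Proof.
move=> h hp; rewrite -[top _ _ _]add0r; apply: leadD; last exact: lead_top.
by apply/lead_wlt/wltZ; apply: (wle_wlt (@wleX _ _ _ _ _)); rewrite wtU.
Qed.

Lemma msupp_top n (mu : 'I_n -> R) D (p : mpoly n k) m :
  (m \in msupp (top mu D p)) = (m \in msupp p) && (wt mu m == D).
Proof.
rewrite !mcoeff_msupp /top raddf_sum /=.
have [wm|wm] := eqVneq (wt mu m) D; last first.
  rewrite andbF big1 ?eqxx // => m' /eqP wm'; rewrite mcoeffZ mcoeffX.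
  case: eqP => [e|_]; last by rewrite mulr0.
  by move: wm; rewrite -e wm' eqxx.
rewrite andbT; have [mp|mp] := boolP (m \in msupp p); last first.
  rewrite big1_seq ?memN_msupp_eq0 ?eqxx // => m' /andP[_ mp'].
  rewrite mcoeffZ mcoeffX; case: eqP => [e|_]; last by rewrite mulr0.
  by rewrite -e mp' in mp.
rewrite big_mkcond (bigD1_seq m) ?msupp_uniq //= wm eqxx big1 ?addr0 => [|m' ne].
  by rewrite mcoeffZ mcoeffX eqxx mulr1.
by case: ifP => // _; rewrite mcoeffZ mcoeffX (negbTE ne) mulr0.
Qed.

(** With weights M^i and M > deg h, the part of h_i in earlier variables weighs less than x_i, so h
    does not raise weights. *)
Lemma has_growth_tri n (h : endo k n) : tri h -> has_growth h 1.
Proof.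
move=> th; split=> [t t1|]; last by rewrite ltxx.
pose M := (endo_deg h).+1.
have t0 : 0 < t := lt_trans ltr01 t1.
apply: (@growth_le_wle _ _ _ _ (fun i : 'I_n => (M ^ i)%N%:R)) => // i.
  by rewrite ltr0n expn_gt0.
have [a [p [_ hp hE]]] := th i.
have Mi : (M ^ i)%N%:R <= t * (M ^ i)%N%:R by rewrite ler_peMl ?ler0n // ltW.
rewrite hE; apply: wle_linear => // m hm; apply: le_trans Mi.
have -> : wt (fun l : 'I_n => (M ^ l)%N%:R) m = (digits M m)%:R :> R.
  rewrite /wt /digits natr_sum; apply: eq_bigr => l _.
  by rewrite mulnC natrM mulr_natr.
rewrite ler_nat ltnW // digits_lt //; last by move=> l; apply: hp.
rewrite ltnS; apply: (@mdeg_endo_deg _ _ _ i); rewrite hE mcoeff_msupp mcoeffD.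
rewrite mcoeffZ mcoeffX; case: (mnm1 i =P m) => [e|_].
  by move: (hp m hm i (leqnn i)); rewrite -e mnm1E eqxx.
by rewrite mulr0 add0r -mcoeff_msupp.
Qed.

End HasGrowth.

(** * Injective substitutions, for lower bounds on growth *)

Section Injectivity.
Variables (k : fieldType).

(** The iterate of order r + 1 first substitutes [G] into p. A substitution that maps
    k[x_0, ..., x_(N-1)] injectively to itself can be repeated without reaching 0. *)
Lemma iter_neq0 n (G : endo k n) (N : nat) :
  (forall p, p != 0 -> below N p -> comp_mpoly G p != 0 /\ below N (comp_mpoly G p)) ->
  forall (i : 'I_n) r, (i < N)%N -> tnth (endo_iter r G) i != 0.
Proof.
move=> hG i r iN.
suff : forall p, p != 0 -> below N p -> comp_mpoly (endo_iter r G) p != 0.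
  move=> /(_ (mpolyX k (mnm1 i))); rewrite comp_id_mpoly; apply; last exact: belowX.
  by rewrite -msupp_eq0 msuppX.
elim: r => [|r ih] p p0 hp; first by rewrite /= comp_mpoly_id.
rewrite endo_iterS comp_mpolyA.
by have [h1 h2] := hG p p0 hp; apply: ih.
Qed.

Lemma comp_below1_neq0 n (G : endo k n.+1) :
  below 1 (tnth G ord0) -> (exists2 m, m \in msupp (tnth G ord0) & m ord0 != 0%N) ->
  forall p, p != 0 -> below 1 p -> comp_mpoly G p != 0 /\ below 1 (comp_mpoly G p).
Proof.
move=> G1 [m0 hm0 m00] p p0 hp; split; last first.
  by apply: (below_comp hp) => j; rewrite ltnS leqn0 => /eqP j0;
     have -> : j = ord0 by apply: val_inj.
pose nu (l : 'I_n.+1) : rat := 1.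
have G0 : tnth G ord0 != 0 by apply/eqP => e; rewrite e msupp0 in hm0.
have [m [l [hm hl l0]]] := lead_exists nu G0.
(* Components other than the first do not enter p; they are replaced by 1 because [lead_comp_inj]
   needs nonzero leading parts everywhere. *)
pose v : endo k n.+1 := [tuple if i == ord0 then tnth G ord0 else 1 | i < n.+1].
pose w : endo k n.+1 := [tuple if i == ord0 then l else 1 | i < n.+1].
have -> : comp_mpoly G p = comp_mpoly v p.
  apply: comp_mpoly_supp => m' hm' j mj; rewrite tnth_mktuple; case: eqP => [->//|/eqP j0].
  by rewrite (hp m' hm' j) // lt0n in mj.
pose d (i : 'I_n.+1) : rat := if i == ord0 then wt nu m else 0.
have wd m' : m' \in msupp p -> wt d m' = wt nu m *+ m' ord0.
  move=> hm'; rewrite /wt (bigD1 ord0) //= big1 ?addr0 // => j j0.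
  by rewrite /d (negbTE j0) mul0rn.
have wm : 0 < wt nu m.
  apply: lt_le_trans (lead_wle hl hm0).
  rewrite wt_const pmulrn_lgt0 ?ltr01 // lt0n mdeg_eq0; apply: contra m00 => /eqP ->.
  by rewrite mnm0E.
have [||m' m'' hm' hm''|m1 [L [_ _ hL L0]]] := lead_comp_inj (mu := nu) (d := d) (v := v) (l := w) p0.
- by move=> i; rewrite !tnth_mktuple /d; case: eqP => // _; apply: lead1.
- by move=> i; rewrite tnth_mktuple; case: ifP; rewrite ?oner_neq0.
- rewrite !wd // => /(mulrIn (lt0r_neq0 wm)) e.
  apply/mnmP => j; have [->//|j0] := eqVneq j ord0.
  by rewrite (hp m' hm') ?(hp m'' hm'') // lt0n.
by have [m2 hm2 _] := lead_msupp hL L0; apply/eqP => e; rewrite e msupp0 in hm2.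
Qed.


(* Injectivity of P(x_0, x_1) |-> P(G_0, G_1) when one component involves x_0 only:
   for weights (1, M) with M large the images of the monomials of P have distinct
   weights. *)
Lemma comp_below2_neq0 n (G : endo k n.+2) (a b : 'I_n.+2) :
  (a < 2)%N -> (b < 2)%N -> a != b ->
  below 1 (tnth G a) -> (exists2 m, m \in msupp (tnth G a) & m ord0 != 0%N) ->
  below 2 (tnth G b) -> ~ below 1 (tnth G b) ->
  forall p, p != 0 -> below 2 p -> comp_mpoly G p != 0 /\ below 2 (comp_mpoly G p).
Proof.
move=> a2 b2 ab Ga [m0 hm0 m00] Gb Gb1 p p0 hp.
have only (j : 'I_n.+2) : (j < 2)%N -> j != a -> j = b.
  move=> j2 ja; apply: val_inj => /=; move: a2 b2 j2 ab ja; rewrite -!val_eqE /=; lia.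
split; last first.
  apply: (below_comp hp) => j j2; have [->|/(only j j2)->//] := eqVneq j a.
  exact: below_le Ga.
pose ord_one : 'I_n.+2 := lift ord0 ord0.
(* M exceeds what component a contributes to the weight of any monomial of p, whereas the weight of
   G_b is at least M. So the exponent of b is a quotient and the contribution of a the remainder. *)
pose M := (endo_deg G * msize p).+1.
pose nu (l : 'I_n.+2) : rat := if l == ord0 then 1 else if l == ord_one then M%:R else 0.
have wnu m : wt nu m = (m ord0 + m ord_one * M)%N%:R.
  rewrite /wt (bigD1 ord0) //= (bigD1 ord_one) //= big1 ?addr0 => [|j /andP[j0 j1]].
    by rewrite /nu /= -mulrnA mulnC natrD.
  by rewrite /nu (negbTE j0) (negbTE j1) mul0rn.
have G0 (c : 'I_n.+2) : (c < 2)%N -> tnth G c != 0.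
  move=> c2; have [->|/(only c c2)->] := eqVneq c a.
    by apply/eqP => e; rewrite e msupp0 in hm0.
  by apply/eqP => e; apply: Gb1 => m; rewrite e msupp0.
have [ma [la [hma hla la0]]] := lead_exists nu (G0 a a2).
have [mb [lb [hmb hlb lb0]]] := lead_exists nu (G0 b b2).
have wa : wt nu ma = (ma ord0)%:R by rewrite wnu (Ga ma hma ord_one) // mul0n addn0.
have da0 : (0 < ma ord0)%N.
  have := lead_wle hla hm0; rewrite wa wnu ler_nat; apply: leq_trans.
  by rewrite addn_gt0 lt0n m00.
have daM : (ma ord0 <= endo_deg G)%N.
  apply: leq_trans (mdeg_endo_deg hma).
  by rewrite mdegE (bigD1 ord0) //= leq_addr.
have [db [wb dbM]] : exists db, wt nu mb = db%:R /\ (M <= db)%N.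
  exists (mb ord0 + mb ord_one * M)%N; split; first exact: wnu.
  have [m hm m1] : exists2 m, m \in msupp (tnth G b) & m ord_one != 0%N.
    apply: contrapT => h; apply: Gb1 => m hm j j1; have [j2|j2] := ltnP j 2; last exact: Gb hm j j2.
    have -> : j = ord_one by apply: val_inj; rewrite /= /bump; lia.
    by apply/eqP/negPn/negP => mi; apply: h; exists m.
  have := lead_wle hlb hm; rewrite !wnu ler_nat; apply: leq_trans.
  by rewrite (leq_trans _ (leq_addl _ _)) // leq_pmull // lt0n.
pose v : endo k n.+2 := [tuple if i == a then tnth G a else if i == b then tnth G b else 1 | i < n.+2].
pose w : endo k n.+2 := [tuple if i == a then la else if i == b then lb else 1 | i < n.+2].
have -> : comp_mpoly G p = comp_mpoly v p.
  apply: comp_mpoly_supp => m' hm' j mj; rewrite tnth_mktuple.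
  case: eqP => [->//|/eqP ja]; case: eqP => [->//|/eqP jb].
  have [j2|j2] := ltnP j 2; last by rewrite (hp m' hm' j j2) in mj.
  by rewrite (only j j2 ja) eqxx in jb.
pose d (i : 'I_n.+2) : rat := if i == a then wt nu ma else if i == b then wt nu mb else 0.
have wd m' : wt d m' = (m' a * ma ord0 + m' b * db)%N%:R.
  rewrite /wt (bigD1 a) //= (bigD1 b) 1?eq_sym //= big1 ?addr0 => [|j /andP[ja jb]].
    rewrite /d eqxx (eq_sym b) (negbTE ab) eqxx wa wb -!mulrnA natrD.
    by rewrite [(ma _ * _)%N]mulnC [(db * _)%N]mulnC.
  by rewrite /d (negbTE ja) (negbTE jb) mul0rn.
have small m' : m' \in msupp p -> (m' a * ma ord0 < db)%N.
  move=> hm'; apply: leq_trans dbM; rewrite ltnS mulnC leq_mul //.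
  apply: leq_trans (ltnW (msize_mdeg_lt hm')).
  by rewrite mdegE (bigD1 a) //= leq_addr.
have inj : {in msupp p &, injective (wt d)}.
  move=> m' m'' hm' hm''; rewrite !wd => /eqP; rewrite eqr_nat => /eqP e.
  have db0 : (0 < db)%N by apply: leq_trans dbM.
  have eb : m' b = m'' b.
    move/(congr1 (divn^~ db)): e; rewrite ![(_ + _ * db)%N]addnC !divnMDl //.
    by rewrite !divn_small ?small // !addn0.
  have ea : m' a = m'' a.
    by move/eqP: e; rewrite eb eqn_add2r eqn_pmul2r // => /eqP.
  apply/mnmP => j; have [j2|j2] := ltnP j 2; last by rewrite (hp m' hm') ?(hp m'' hm'').
  by have [->//|/(only j j2)->] := eqVneq j a.
have hv i : lead nu (d i) (tnth v i) (tnth w i).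
  rewrite !tnth_mktuple /d; case: eqP => // _; case: eqP => // _; exact: lead1.
have w0 i : tnth w i != 0.
  by rewrite tnth_mktuple; case: ifP => // _; case: ifP => // _; rewrite oner_neq0.
have [m1 [L [_ _ hL L0]]] := lead_comp_inj p0 hv w0 inj.
by have [m2 hm2 _] := lead_msupp hL L0; apply/eqP => e; rewrite e msupp0 in hm2.
Qed.

End Injectivity.

(** * Dynamical degrees in dimension at most 3 *)

Section MaxExponent.
Variables (k : fieldType) (n : nat) (i : 'I_n) (p : mpoly n k).

Definition max_exp := (\max_(m <- msupp p) m i)%N.

Lemma max_exp_ge m : m \in msupp p -> (m i <= max_exp)%N.
Proof. by move=> hm; apply: leq_bigmax_seq. Qed.

Lemma max_expP : (0 < max_exp)%N -> exists2 m, m \in msupp p & m i = max_exp.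
Proof.
move=> h; have p0 : p != 0.
  by apply/eqP => e; move: h; rewrite /max_exp e msupp0 big_nil.
have [m hm hmax] := max_weight (fun j => (j == i)%:R : rat) p0.
have wE m' : wt (fun j => (j == i)%:R : rat) m' = (m' i)%:R.
  rewrite /wt (bigD1 i) //= eqxx big1 ?addr0 // => j /negbTE ->.
  by rewrite mul0rn.
exists m => //; apply/eqP; rewrite eqn_leq max_exp_ge //=.
by apply/bigmax_leqP_seq => m' /hmax; rewrite !wE ler_nat.
Qed.

End MaxExponent.

Section Henon.
Variables (k : fieldType) (R : realType) (n : nat).

Definition ord_one : 'I_n.+2 := lift ord0 ord0.

(** The first two coordinates form a map of Henon type, for which the weights (t, 1) are multiplied
    at most by t as soon as t >= 1 and t >= d. The other coordinates are triangular over it and get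
    weights so large that they do not affect the growth. *)
Lemma has_growth_henon (g : endo k n.+2) a P b C :
  tnth g ord0 = a *: mpolyX k (mnm1 ord_one) + P -> below 1 P ->
  tnth g ord_one = b *: mpolyX k (mnm1 ord0) + C -> below 0 C ->
  (forall i : 'I_n.+2, (2 <= i)%N -> exists c q,
    below i q /\ tnth g i = c *: mpolyX k (mnm1 i) + q) ->
  exists d : nat, (1 <= d)%N /\ has_growth g (d%:R : R).
Proof.
move=> g0 hP g1 hC hg; pose d := max_exp ord0 P; have dP := @max_exp_ge _ _ ord0 P.
exists (maxn 1 d); split; first exact: leq_maxl.
pose mu (t K : R) (i : 'I_n.+2) :=
  if i == ord0 then t else if i == ord_one then 1 else K ^+ i.
(* K >= t dominates the weights of x_0 and x_1, and K >= deg g makes a monomial in variables before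
   x_i weigh at most K^(i-1) deg g <= K^i. *)
pose K (t : R) : R := t + (endo_deg g)%:R.
have wP t m : m \in msupp P -> wt (mu t (K t)) m = t *+ m ord0.
  move=> hm; rewrite /wt (bigD1 ord0) //= big1 ?addr0 // => j j0.
  by rewrite (hP m hm j) ?mulr0n // lt0n.
have mu0 (t : R) : 1 <= t -> forall i, 0 < mu t (K t) i.
  move=> t1 i; have t0 : 0 < t := lt_le_trans ltr01 t1.
  rewrite /mu; case: ifP => // _; case: ifP => // _.
  by rewrite exprn_gt0 // ltr_wpDr ?ler0n.
have hwle (t : R) : (maxn 1 d)%:R <= t ->
    forall i, wle (mu t (K t)) (t * mu t (K t) i) (tnth g i).
  move=> td; have t1 : 1 <= t.
    by apply: le_trans td; rewrite -[leLHS]/(1%:R) ler_nat leq_maxl.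
  have dt : d%:R <= t by apply: le_trans td; rewrite ler_nat leq_maxr.
  have t0 : 0 < t := lt_le_trans ltr01 t1.
  have K1 : 1 <= K t by rewrite /K (le_trans t1) // lerDl ler0n.
  move=> i; have [->|i0] := eqVneq i ord0.
    rewrite g0; apply: wle_linear => [|m hm].
      by rewrite /mu /= mulr_ege1.
    rewrite wP // -mulr_natr /mu eqxx ler_pM2l //; apply: le_trans dt.
    by rewrite ler_nat dP.
  have [->|ii1] := eqVneq i ord_one.
    rewrite g1; apply: wle_linear => [|m hm]; rewrite /mu /= mulr1 //.
    rewrite /wt big1 ?ltW // => j _; by rewrite (hC m hm j) ?mulr0n.
  have i2 : (2 <= i)%N by case: i i0 ii1 => [[|[|i]] hi].
  have [c [q [hq gi]]] := hg i i2; rewrite gi.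
  have muK : mu t (K t) i = K t ^+ i by rewrite /mu (negbTE i0) (negbTE ii1).
  have Kle : K t ^+ i <= t * K t ^+ i by rewrite ler_peMl // exprn_ge0 // (le_trans ler01).
  apply: wle_linear => [|m hm]; rewrite muK //; apply: le_trans Kle.
  have hm' : m \in msupp (tnth g i).
    rewrite gi mcoeff_msupp mcoeffD mcoeffZ mcoeffX.
    case: (mnm1 i =P m) => [e|_]; last by rewrite mulr0 add0r -mcoeff_msupp.
    by move: (hq m hm i (leqnn i)); rewrite -e mnm1E eqxx.
  apply: (@le_trans _ _ (K t ^+ i.-1 *+ mdeg m)).
    rewrite -wt_const; apply: ler_sum => j _.
    have [ij|ji] := leqP i j; first by rewrite (hq m hm j ij) !mulr0n.
    rewrite lerMn2r /mu; apply/orP; right.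
    have i10 : i.-1 != 0%N by case: (val i) i2 => [|[]].
    case: eqP => [_|_].
      apply: (@le_trans _ _ (K t)); first by rewrite lerDl ler0n.
      by rewrite -[leLHS]expr1 ler_weXn2l // lt0n.
    case: eqP => [_|_]; first by rewrite exprn_ege1.
    by rewrite ler_weXn2l // -ltnS prednK // (leq_trans _ i2).
  rewrite -[(i : nat) in leRHS](@prednK i) ?(leq_trans _ i2) // exprSr -mulr_natr.
  rewrite ler_pM2l ?exprn_gt0 ?(lt_le_trans ltr01) //.
  apply: (@le_trans _ _ (endo_deg g)%:R); first by rewrite ler_nat (mdeg_endo_deg hm').
  by rewrite lerDr ltW.
split=> [t tm|].
  have t1 : 1 <= t by apply/ltW/le_lt_trans/tm; rewrite -[leLHS]/(1%:R) ler_nat leq_maxl.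
  apply: (@growth_le_wle _ _ _ _ (mu t (K t))).
  - exact: lt_le_trans t1.
  - exact: mu0.
  - exact/hwle/ltW.
rewrite -[ltLHS]/(1%:R) ltr_nat => m1.
have d2 : (1 < d)%N by move: m1; rewrite leq_max ltnn.
have -> : maxn 1 d = d by apply/maxn_idPr/ltnW.
have dd : (maxn 1 d)%:R <= d%:R :> R by rewrite ler_nat geq_max leqnn ltnW.
pose t : R := d%:R; pose nu := mu t (K t).
have t1 : 1 < t by rewrite /t ltr1n.
(* The first component keeps only the multiple of x_0^d, so [G] acts injectively on k[x_0]; the
   other leading parts may be anything. *)
pose G : endo k n.+2 := [tuple if i == ord0 then top nu (t * nu ord0) P
                          else top nu (t * nu i) (tnth g i) | i < n.+2].
have G0 : tnth G ord0 = top nu (t * nu ord0) P by rewrite tnth_mktuple.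
have wP0 : wle nu (t * nu ord0) P.
  move=> m hm; rewrite wP // /nu /mu eqxx -mulr_natr ler_pM2l ?(lt_trans ltr01) //.
  by rewrite ler_nat dP.
apply: (@growth_ge_lead _ _ _ _ G nu _ ord0).
- exact: lt_trans t1.
- exact: mu0 (ltW t1) _.
- move=> j; have [->|j0] := eqVneq j ord0.
    rewrite G0 g0; apply: lead_linear => //.
    by rewrite /nu /mu /= -expr2 exprn_egt1.
  by rewrite tnth_mktuple (negbTE j0); apply: lead_top; apply: hwle.
move=> r; apply: (@iter_neq0 _ _ _ 1) => //.
apply: comp_below1_neq0; rewrite G0.
  by move=> m; rewrite msupp_top => /andP[/hP].
have [m hm dm] := max_expP (ltnW d2).
exists m; last by rewrite dm -lt0n ltnW.
by rewrite msupp_top hm wP // dm /nu /mu eqxx -[t *+ d]mulr_natr eqxx.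
Qed.

End Henon.

Section Dimension3.
Variables (k : fieldType) (R : realType).
Implicit Types (g : endo k 3) (m : multinom 3) (P Q C E : mpoly 3 k).

Definition o0 : 'I_3 := ord0.
Definition o1 : 'I_3 := lift ord0 ord0.
Definition o2 : 'I_3 := lift ord0 (lift ord0 ord0).

Lemma ord3P (i : 'I_3) : [\/ i = o0, i = o1 | i = o2].
Proof.
by case: i => [[|[|[|]]]] // ?; [apply: Or31 | apply: Or32 | apply: Or33]; apply: val_inj.
Qed.

Definition mu3 (a b c : R) (i : 'I_3) : R := nth 0 [:: a; b; c] i.

Lemma wt3 a b c m : wt (mu3 a b c) m = a *+ m o0 + b *+ m o1 + c *+ m o2.
Proof. by rewrite /wt !big_ord_recl big_ord0 addr0 addrA. Qed.

Lemma mu3_gt0 a b c : 0 < a -> 0 < b -> 0 < c -> forall i, 0 < mu3 a b c i.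
Proof. by move=> a0 b0 c0 i; have [->|->|->] := ord3P i. Qed.

Lemma mdeg_ge n (m : multinom n) i : (m i <= mdeg m)%N.
Proof. by rewrite mdegE (bigD1 i) //= leq_addr. Qed.

(* Upper bound: weights (1, K t, K) with K large. Lower bound: weights (0, d, 1). *)
Lemma has_growth_fibered g a C al Q ga P :
  tnth g o0 = a *: mpolyX k (mnm1 o0) + C -> below 0 C -> a != 0 ->
  tnth g o1 = al *: mpolyX k (mnm1 o2) + Q -> below 2 Q ->
  tnth g o2 = ga *: mpolyX k (mnm1 o1) + P -> below 1 P ->
  exists d : nat, (1 <= d)%N /\ has_growth g (d%:R : R).
Proof.
move=> g0 hC a0 g1 hQ g2 hP; pose d := max_exp o1 Q; have dQ := @max_exp_ge _ _ o1 Q.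
exists (maxn 1 d); split; first exact: leq_maxl.
set de : R := (maxn 1 d)%:R.
have de1 : 1 <= de by rewrite /de -[leLHS]/(1%:R) ler_nat leq_maxl.
have dde : d%:R <= de by rewrite /de ler_nat leq_maxr.
pose B : R := (msize P + msize Q)%:R.
have BP m : m \in msupp P -> (m o0)%:R <= B.
  move=> hm; rewrite /B ler_nat (leq_trans (mdeg_ge m o0)) //.
  by rewrite ltnW // (leq_trans (msize_mdeg_lt hm)) // leq_addr.
have BQ m : m \in msupp Q -> (m o0)%:R <= B.
  move=> hm; rewrite /B ler_nat (leq_trans (mdeg_ge m o0)) //.
  by rewrite ltnW // (leq_trans (msize_mdeg_lt hm)) // leq_addl.
have B0 : 0 <= B by rewrite ler0n.
have wC (mu : 'I_3 -> R) D : 0 <= D -> wle mu D C.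
  by move=> D0 m hm; rewrite /wt big1 // => j _; rewrite (hC m hm j) ?mulr0n.
split=> [t det|].
  have t1 : 1 < t := le_lt_trans de1 det.
  have t0 : 0 < t := lt_trans ltr01 t1.
  have td : 0 < t - de by rewrite subr_gt0.
  (* [B] bounds the exponents of x_0 in P and Q. The slack t - de, amplified by K, pays for them. *)
  pose K : R := 1 + B + B / (t - de).
  have Kd : B <= K * (t - de).
    rewrite /K mulrDl divfK ?gt_eqF // lerDr mulr_ge0 ?(ltW td) //.
    by rewrite addr_ge0.
  have KB : B <= K by rewrite /K addrAC lerDr addr_ge0 // divr_ge0 // ltW.
  have K1 : 1 <= K by rewrite /K -addrA lerDl addr_ge0 // divr_ge0 // ltW.
  have K0 : 0 < K := lt_le_trans ltr01 K1.
  clearbody K.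
  apply: (@growth_le_wle _ _ _ _ (mu3 1 (K * t) K)) => //.
    by apply: mu3_gt0; rewrite ?mulr_gt0.
  move=> i; have [->|->|->] := ord3P i.
  - rewrite g0; apply: wle_linear; last by apply: wC; rewrite mulr1 ltW.
    by rewrite mulr1 ltW.
  - rewrite g1; apply: wle_linear => [|m hm].
      rewrite /mu3 /=; have h : K <= t * K by rewrite ler_peMl // ltW.
      apply: (le_trans h); rewrite mulrA [t * K]mulrC ler_peMr ?mulr_ge0 // ltW //.
    rewrite wt3 (hQ m hm o2) // mulr0n addr0 /mu3 /=.
    rewrite -(mulr_natr (K * t)).
    have h1 : (m o1)%:R <= de by apply: le_trans dde; rewrite ler_nat dQ.
    have h2 : K * t * (t - de) <= K * t * (t - (m o1)%:R).
      by rewrite ler_pM2l ?mulr_gt0 // lerD2l lerN2.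
    have h3 : B <= t * (K * (t - de)).
      by apply: le_trans Kd _; rewrite ler_peMl ?mulr_ge0 ?(ltW td) ?(ltW K0) // ltW.
    have h4 := BQ m hm.
    have e1 : K * t * (t - de) = t * (K * (t - de)) by rewrite mulrA [t * K]mulrC.
    have e2 : K * t * (t - (m o1)%:R) = t * (K * t) - K * t * (m o1)%:R.
      by rewrite mulrBr; congr (_ - _); rewrite mulrC.
    rewrite e1 e2 in h2; rewrite -lerBrDr; apply: le_trans h4 _; exact: le_trans h3 h2.
  - rewrite g2; apply: wle_linear => [|m hm]; first by rewrite /mu3 /= mulrC.
    rewrite wt3 (hP m hm o1) // (hP m hm o2) // !mulr0n !addr0 /mu3 /=.
    apply: (le_trans (BP m hm)); apply: (le_trans KB).
    by rewrite ler_peMl ?(ltW K0) // ltW.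
rewrite /de -[ltLHS]/(1%:R) ltr_nat => m1.
have d2 : (1 < d)%N by move: m1; rewrite leq_max ltnn.
have -> : maxn 1 d = d by apply/maxn_idPr/ltnW.
pose t : R := d%:R; have t1 : 1 < t by rewrite /t ltr1n.
have t0 : 0 < t := lt_trans ltr01 t1.
(* Weight 0 for x_0 makes the leading part of Q the whole term in x_1^d, with its nonzero
   coefficient in k[x_0]. *)
pose mu := mu3 0 t 1.
have wQ : wle mu (t * t) Q.
  move=> m hm; rewrite wt3 (hQ m hm o2) // mul0rn add0r mulr0n addr0.
  by rewrite -mulr_natr ler_pM2l // /t ler_nat dQ.
pose G : endo k 3 := [tuple if i == o1 then top mu (t * t) Q else
   if i == o0 then tnth g o0 else top mu (t * mu i) (tnth g i) | i < 3].
have G0 : tnth G o0 = tnth g o0 by rewrite tnth_mktuple.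
have G1 : tnth G o1 = top mu (t * t) Q by rewrite tnth_mktuple.
apply: (@growth_ge_lead _ _ _ _ G mu _ o1) => //.
  move=> j; have [->|->|->] := ord3P j.
  - rewrite G0 mulr0; apply: lead_whom => m.
    rewrite g0 => /msuppD_le; rewrite mem_cat => /orP[/msuppZ_le|hm].
      by rewrite msuppX inE => /eqP ->; rewrite wtU.
    by rewrite /wt big1 // => i _; rewrite (hC m hm i) ?mulr0n.
  - rewrite G1 g1; apply: lead_linear => //.
    by rewrite /mu /mu3 /= -expr2 exprn_egt1.
  - rewrite tnth_mktuple /=; apply: lead_top; rewrite g2.
    apply: wle_linear => [|m hm]; first by rewrite /mu /mu3 /= mulr1.
    rewrite wt3 (hP m hm o1) // (hP m hm o2) // !mulr0n !addr0 mul0rn.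
    by rewrite /mu /mu3 /= mulr1 ltW.
move=> r; apply: (@iter_neq0 _ _ _ 2) => //.
apply: (@comp_below2_neq0 _ _ G o0 o1) => //.
- rewrite G0 g0; apply: belowD; first exact/belowZ/belowX.
  exact: below_le hC.
- exists (mnm1 o0); last by rewrite mnm1E eqxx.
  rewrite G0 g0 mcoeff_msupp mcoeffD mcoeffZ mcoeffX eqxx mulr1 memN_msupp_eq0 ?addr0 //.
  by apply/negP => /hC/(_ o0 isT); rewrite mnm1E eqxx.
- by rewrite G1 => m; rewrite msupp_top => /andP[/hQ].
rewrite G1 => h; have [m hm dm] := max_expP (ltnW d2).
have : m \in msupp (top mu (t * t) Q).
  rewrite msupp_top hm wt3 (hQ m hm o2) // mul0rn add0r mulr0n addr0.
  by rewrite -mulr_natr dm eqxx.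
by move=> /h/(_ o1 isT) e; move: d2; rewrite /d -dm e.
Qed.

(** r = (i + sqrt(i^2 + 4j))/2 is at least i, and t(t - i) increases for t >= i. *)
Lemma quadratic_root (i j : nat) : exists r : R, [/\ 0 <= r,
  r ^+ 2 = i%:R * r + j%:R & forall t, r <= t -> i%:R * t + j%:R <= t ^+ 2].
Proof.
pose D : R := i%:R ^+ 2 + 4%:R * j%:R.
have i0 : 0 <= i%:R :> R by rewrite ler0n.
have j0 : 0 <= j%:R :> R by rewrite ler0n.
have D0 : 0 <= D by rewrite addr_ge0 ?sqr_ge0 // mulr_ge0 ?ler0n.
pose s := Num.sqrt D; have sE : s ^+ 2 = D by rewrite sqr_sqrtr.
have s0 : 0 <= s by rewrite sqrtr_ge0.
have si : i%:R <= s.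
  by rewrite -(ger0_norm i0) -sqrtr_sqr ler_wsqrtr // lerDl mulr_ge0 ?ler0n.
have e : ((i%:R + s) / 2) ^+ 2 = i%:R * ((i%:R + s) / 2) + j%:R.
  have : 4 * j%:R = s ^+ 2 - i%:R ^+ 2 by rewrite sE /D addrC addKr.
  move: (i%:R : R) (j%:R : R) => x y h; lra.
exists ((i%:R + s) / 2); split=> // [|t rt]; first by rewrite divr_ge0 // addr_ge0.
set r := (i%:R + s) / 2 in e rt *.
have ri : i%:R <= r by rewrite /r ler_pdivlMr //; lra.
have r0 : 0 <= r := le_trans i0 ri.
have h : r * (r - i%:R) <= t * (t - i%:R).
  by apply: ler_pM; rewrite ?subr_ge0 // lerD2r.
move: h; rewrite !mulrBr -!expr2 e => h.
rewrite -lerBrDl [i%:R * t]mulrC; apply: le_trans h.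
by rewrite [r * _]mulrC addrC addKr.
Qed.

End Dimension3.

Section ShiftLike.
Variables (k : fieldType) (R : realType).
Implicit Types (g : endo k 3) (m : multinom 3) (P Q C E : mpoly 3 k).

Lemma max_quadratic_root (c : nat) (s : seq (multinom 3)) : exists th : R, [/\ 1 <= th,
  forall m, m \in s -> forall t, th <= t -> (m o0)%:R * t + (m o1 * c)%N%:R <= t ^+ 2 &
  th = 1 \/ exists2 m, m \in s & th ^+ 2 = (m o0)%:R * th + (m o1 * c)%N%:R].
Proof.
elim: s => [|m s [th [th1 hs eth]]]; first by exists 1; split=> //; left.
have [r [r0 re hr]] := quadratic_root R (m o0) (m o1 * c).
have [rth|thr] := leP r th.
  exists th; split=> // [x|].
    by rewrite inE => /predU1P[->|/hs//] t ht; apply: hr; apply: le_trans ht.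
  by case: eth => [->|[x xs ex]]; [left | right; exists x => //; rewrite inE xs orbT].
exists r; split=> [|x|]; first exact: le_trans (ltW thr).
  rewrite inE => /predU1P[->//|/hs h] t ht; apply: h.
  by apply: le_trans ht; apply: ltW.
by right; exists m => //; rewrite inE eqxx.
Qed.

(* The weights are (th, c, 1) with c = deg P and th the largest root of
   t^2 = i t + c j over the monomials x_0^i x_1^j of Q. *)
Lemma has_growth_shift g al Q be P ga de E :
  tnth g o0 = al *: mpolyX k (mnm1 o2) + Q -> below 2 Q ->
  tnth g o1 = be *: mpolyX k (mnm1 o1) + P -> below 1 P -> (0 < max_exp o0 P)%N ->
  tnth g o2 = ga *: mpolyX k (mnm1 o0) + (de *: mpolyX k (mnm1 o1) + E) -> below 0 E ->
  (de = 0 \/ max_exp o0 P = 1%N) ->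
  exists (th : R) (a b : nat), [/\ 1 <= th, th ^+ 2 = a%:R * th + b%:R & has_growth g th].
Proof.
move=> g0 hQ g1 hP; set c := max_exp o0 P => c0 g2 hE dec.
have cP := @max_exp_ge _ _ o0 P.
have [th [th1 hth eth]] := max_quadratic_root c (msupp Q).
have th0 : 0 < th := lt_le_trans ltr01 th1.
have cR0 : 0 < c%:R :> R by rewrite ltr0n.
have wQ t m : m \in msupp Q ->
    wt (mu3 t c%:R 1) m = (m o0)%:R * t + (m o1 * c)%N%:R.
  move=> hm; rewrite wt3 (hQ m hm o2) // mulr0n addr0 mulr_natl; congr (_ + _).
  by rewrite -mulrnA mulnC.
have wP t m : m \in msupp P -> wt (mu3 t c%:R 1) m = t *+ m o0.
  by move=> hm; rewrite wt3 (hP m hm o1) // (hP m hm o2) // !mulr0n !addr0.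
have wE (mu : 'I_3 -> R) D : 0 <= D -> wle mu D E.
  by move=> D0 m hm; rewrite /wt big1 // => j _; rewrite (hE m hm j) ?mulr0n.
have hwQ t : th <= t -> wle (mu3 t c%:R 1) (t * t) Q.
  by move=> tht m hm; rewrite wQ // -expr2 hth.
have hwP t : th <= t -> wle (mu3 t c%:R 1) (t * c%:R) P.
  move=> tht m hm; rewrite wP // -[t *+ _]mulr_natr ler_pM2l ?(lt_le_trans th0) //.
  by rewrite ler_nat cP.
have hwle t : th <= t -> forall i,
    wle (mu3 t c%:R 1) (t * mu3 t c%:R 1 i) (tnth g i).
  move=> tht i; have t1 : 1 <= t := le_trans th1 tht.
  have t0 : 0 < t := lt_le_trans ltr01 t1.
  have [->|->|->] := ord3P i.
  - rewrite g0; apply: wle_linear; last exact: hwQ.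
    by rewrite /mu3 /= mulr_ege1.
  - rewrite g1; apply: wle_linear; last exact: hwP.
    by rewrite /mu3 /= ler_peMl // ltW.
  - rewrite g2; apply: wle_linear; first by rewrite /mu3 /= mulr1.
    have wE' : wle (mu3 t c%:R 1) (t * mu3 t c%:R 1 o2) E.
      by apply: wE; rewrite /mu3 /= mulr1 ltW.
    (* The term in x_1 has weight c, and the last component may weigh at most t. This holds if c =
       1; for larger c the term must be absent. *)
    case: dec => [->|c1]; first by rewrite scale0r add0r.
    by apply: wle_linear => //; rewrite /mu3 /= mulr1 c1.
have [a [b ab]] : exists a b : nat, th ^+ 2 = a%:R * th + b%:R.
  case: eth => [->|[m _ ->]]; last by exists (m o0), (m o1 * c)%N.
  by exists 1%N, 0%N; rewrite expr1n mulr1 addr0.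
exists th, a, b; split=> //; split=> [t tht|t1].
  apply: (@growth_le_wle _ _ _ _ (mu3 t c%:R 1)).
  - exact: lt_trans tht.
  - by apply: mu3_gt0 => //; apply: lt_trans tht.
  - exact/hwle/ltW.
(* As th > 1, it is the root that belongs to some monomial of Q, and this monomial lies in the
   leading part. *)
have [m hm em] : exists2 m, m \in msupp Q & th ^+ 2 = (m o0)%:R * th + (m o1 * c)%N%:R.
  by case: eth => // e; rewrite e ltxx in t1.
pose mu := mu3 th c%:R 1.
pose G : endo k 3 := [tuple if i == o0 then top mu (th * th) Q else
   if i == o1 then top mu (th * c%:R) P else top mu (th * mu i) (tnth g i) | i < 3].
have G0 : tnth G o0 = top mu (th * th) Q by rewrite tnth_mktuple.
have G1 : tnth G o1 = top mu (th * c%:R) P by rewrite tnth_mktuple.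
apply: (@growth_ge_lead _ _ _ _ G mu _ o0) => //.
  move=> j; have [->|->|->] := ord3P j.
  - rewrite G0 g0; apply: lead_linear; last exact: hwQ.
    by rewrite /mu /mu3 /= -expr2 exprn_egt1.
  - rewrite G1 g1; apply: lead_linear; last exact: hwP.
    by rewrite /mu /mu3 /= ltr_pMl.
  - by rewrite tnth_mktuple /=; apply: lead_top; apply: hwle.
have mG : m \in msupp (tnth G o0) by rewrite G0 msupp_top hm wQ // -em expr2 eqxx.
have Gb : below 2 (tnth G o0).
  by rewrite G0 => m'; rewrite msupp_top => /andP[/hQ].
(* If the leading part of Q involves x_0 only, injectivity on k[x_0] suffices. Otherwise the leading
   part of P is the component in x_0 alone that [comp_below2_neq0] asks for. *)
have [Gb1|Gb1] := pselect (below 1 (tnth G o0)).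
  move=> r; apply: (@iter_neq0 _ _ _ 1) => //.
  apply: comp_below1_neq0 => //; exists m => //; apply/eqP => m0.
  move: em; rewrite m0 (Gb1 m mG o1) // mul0n mul0r addr0 => /eqP.
  by rewrite expf_eq0 gt_eqF.
move=> r; apply: (@iter_neq0 _ _ _ 2) => //.
apply: (@comp_below2_neq0 _ _ G o1 o0) => //.
  by rewrite G1 => m'; rewrite msupp_top => /andP[/hP].
have [m' hm' dm'] := max_expP c0.
exists m'; last by rewrite dm' -lt0n.
by rewrite G1 msupp_top hm' wP // dm' -[th *+ _]mulr_natr eqxx.
Qed.

End ShiftLike.

Section SmallDimension.
Variables (k : fieldType) (R : realType).

Lemma comp_fix n N (g : endo k n) (p : mpoly n k) : below N p ->
  (forall j : 'I_n, (j < N)%N -> tnth g j = mpolyX k (mnm1 j)) -> comp_mpoly g p = p.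
Proof.
move=> hp hg; rewrite -[RHS]comp_mpoly_id; apply: comp_mpoly_supp => m hm j mj.
rewrite tnth_mktuple hg // ltnNge; apply/negP => /(hp m hm) e.
by rewrite e in mj.
Qed.

Lemma comp_linear n (g : endo k n) a i (p : mpoly n k) :
  comp_mpoly g (a *: mpolyX k (mnm1 i) + p) = a *: tnth g i + comp_mpoly g p.
Proof. by rewrite comp_mpolyD comp_mpolyZ comp_id_mpoly. Qed.

Lemma tri_growth n (f : endo k n) (s : 'S_n) h lambda : (forall i, s i = i) -> tri h ->
  endo_conj f (endo_comp (perm_endo k s) h) -> 1 <= lambda ->
  dynamical_degree f (lambda : R) -> lambda = 1.
Proof.
move=> s1 th fh l1 dl; apply: (has_growth_unique fh (lexx _) l1 _ dl).
have -> : endo_comp (perm_endo k s) h = h.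
  by apply: endo_eqP => i; rewrite tnth_perm_comp s1.
exact: has_growth_tri.
Qed.

Lemma realized_dim1 (lambda : R) : 1 <= lambda -> realized k lambda 1 -> lambda = 1.
Proof.
move=> l1 [_ [f [fa ft dl]]]; have [s [h [th fh]]] := affine_triangular_normal fa ft.
by apply: (tri_growth _ th fh) => // i; rewrite (ord1 (s i)) (ord1 i).
Qed.

Lemma realized_dim2 (lambda : R) : 1 <= lambda -> realized k lambda 2 ->
  exists d : nat, lambda = d%:R.
Proof.
move=> l1 [_ [f [fa ft dl]]]; have [s [h [th fh]]] := affine_triangular_normal fa ft.
have ord2P (i : 'I_2) : i = ord0 \/ i = ord_one 0.
  by case: i => [[|[|]] // ?]; [left | right]; apply: val_inj.
have ne : s ord0 != s (ord_one 0) by rewrite (inj_eq perm_inj).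
have [e0|e0] := ord2P (s ord0); have [e1|e1] := ord2P (s (ord_one 0));
  try by rewrite e0 e1 eqxx in ne.
  exists 1%N; apply: (tri_growth _ th fh) => // i.
  by have [->|->] := ord2P i.
have [a0 [C [_ hC h0]]] := th ord0; have [a1 [P [_ hP h1]]] := th (ord_one 0).
have [|||d [d1 hd]] := @has_growth_henon k R 0 (endo_comp (perm_endo k s) h) a1 P a0 C _ hP _ hC.
- by rewrite tnth_perm_comp e0.
- by rewrite tnth_perm_comp e1.
- by move=> i; rewrite leqNgt ltn_ord.
by exists d; apply: (has_growth_unique fh _ l1 hd dl); rewrite ler1n.
Qed.

Lemma perm3P (s : 'S_3) :
  [/\ s o0 = o0, s o1 = o1 & s o2 = o2] \/ [/\ s o0 = o1, s o1 = o0 & s o2 = o2] \/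
  [/\ s o0 = o0, s o1 = o2 & s o2 = o1] \/ [/\ s o0 = o2, s o1 = o1 & s o2 = o0] \/
  [/\ s o0 = o1, s o1 = o2 & s o2 = o0] \/ [/\ s o0 = o2, s o1 = o0 & s o2 = o1].
Proof.
have n01 : s o0 != s o1 by rewrite (inj_eq perm_inj).
have n02 : s o0 != s o2 by rewrite (inj_eq perm_inj).
have n12 : s o1 != s o2 by rewrite (inj_eq perm_inj).
move: n01 n02 n12; case: (ord3P (s o0)) => ->; case: (ord3P (s o1)) => ->;
  case: (ord3P (s o2)) => ->; rewrite ?eqxx // => _ _ _;
  by do ?[by left; split | by split | right].
Qed.

Lemma max_exp_linear (a : k) (C : mpoly 3 k) : a != 0 -> below 0 C ->
  max_exp o0 (a *: mpolyX k (mnm1 o0) + C) = 1%N.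
Proof.
move=> a0 hC; apply/eqP; rewrite eqn_leq; apply/andP; split.
  apply/bigmax_leqP_seq => m /msuppD_le; rewrite mem_cat => /orP[/msuppZ_le|/hC-> //].
  by rewrite msuppX inE => /eqP -> _; rewrite mnm1E eqxx.
have : mnm1 o0 \in msupp (a *: mpolyX k (mnm1 o0) + C).
  rewrite mcoeff_msupp mcoeffD mcoeffZ mcoeffX eqxx mulr1 memN_msupp_eq0 ?addr0 //.
  by apply/negP => /hC/(_ o0 isT); rewrite mnm1E eqxx.
by move=> /(max_exp_ge o0); rewrite mnm1E eqxx.
Qed.

Lemma below_const n (C : mpoly n k) (g : endo k n) : below 0 C -> comp_mpoly g C = C.
Proof. by move=> hC; apply: comp_fix hC _. Qed.

Definition endo3 (f0 f1 f2 : mpoly 3 k) : endo k 3 :=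
  [tuple if i == o0 then f0 else if i == o1 then f1 else f2 | i < 3].

Lemma endo3E f0 f1 f2 : [/\ tnth (endo3 f0 f1 f2) o0 = f0,
  tnth (endo3 f0 f1 f2) o1 = f1 & tnth (endo3 f0 f1 f2) o2 = f2].
Proof. by split; rewrite tnth_mktuple. Qed.

Let x (i : 'I_3) : mpoly 3 k := mpolyX k (mnm1 i).

Lemma endo3_eqP (f g : endo k 3) : tnth f o0 = tnth g o0 -> tnth f o1 = tnth g o1 ->
  tnth f o2 = tnth g o2 -> f = g.
Proof. by move=> h0 h1 h2; apply: endo_eqP => i; have [->|->|->] := ord3P i. Qed.

Definition quadratic_growth (f : endo k 3) := exists g (th : R) (a b : nat),
  [/\ endo_conj f g, 1 <= th, th ^+ 2 = a%:R * th + b%:R & has_growth g th].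

Lemma endo_conj_refl n (f : endo k n) : endo_conj f f.
Proof.
exists (endo_id k n), (endo_id k n).
by rewrite !endo_1comp endo_comp1; split.
Qed.

Lemma nat_quadratic (f g : endo k 3) (d : nat) : endo_conj f g -> (1 <= d)%N ->
  has_growth g (d%:R : R) -> quadratic_growth f.
Proof.
move=> fg d1 hg; exists g, d%:R, d, 0%N; split=> //; first by rewrite ler1n.
by rewrite addr0 expr2.
Qed.

(* The five nontrivial permutations of the components U, V, W of a triangular
   automorphism. *)
Section Cases.
Variables (f : endo k 3) (a0 a1 a2 : k) (C P Q : mpoly 3 k).
Hypotheses (a00 : a0 != 0) (a10 : a1 != 0) (a20 : a2 != 0).
Hypotheses (hC : below 0 C) (hP : below 1 P) (hQ : below 2 Q).
Let U := a0 *: x o0 + C.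
Let V := a1 *: x o1 + P.
Let W := a2 *: x o2 + Q.

Lemma growth_VUW : tnth f o0 = V -> tnth f o1 = U -> tnth f o2 = W -> quadratic_growth f.
Proof.
move=> f0 f1 f2.
have [i i2|d [d1 hd]] := @has_growth_henon k R 1 f a1 P a0 C f0 hP f1 hC.
  have -> : i = o2 by case: (ord3P i) i2 => ->.
  by exists a2, Q.
exact: nat_quadratic (endo_conj_refl f) d1 hd.
Qed.

Lemma growth_UWV : tnth f o0 = U -> tnth f o1 = W -> tnth f o2 = V -> quadratic_growth f.
Proof.
move=> f0 f1 f2.
have [d [d1 hd]] := has_growth_fibered R f0 hC a00 f1 hQ f2 hP.
exact: nat_quadratic (endo_conj_refl f) d1 hd.
Qed.

(** If P is constant, its degree would give x_1 the weight 0. But then x_1 evolves by itself, and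
    exchanging x_0 and x_1 yields the fibered form. *)
Lemma growth_WVU : tnth f o0 = W -> tnth f o1 = V -> tnth f o2 = U -> quadratic_growth f.
Proof.
move=> f0 f1 f2; have [c0|c0] := posnP (max_exp o0 P).
  have hP0 : below 0 P.
    move=> m hm j _; have [->|->|->] := ord3P j; [|by apply: (hP hm)..].
    by have := max_exp_ge o0 hm; rewrite c0 leqn0 => /eqP.
  pose t : 'S_3 := tperm o0 o1; pose ph := perm_endo k t.
  have phK : endo_comp ph ph = endo_id k 3.
    by apply: endo_eqP => i; rewrite tnth_perm_comp tnth_mktuple tnth_id tpermK.
  have phE i : tnth ph i = x (t i) by rewrite tnth_mktuple.
  have [t0 t1 t2] : [/\ t o0 = o1, t o1 = o0 & t o2 = o2].
    by split; rewrite ?tpermL ?tpermR ?tpermD.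
  pose g := endo_comp ph (endo_comp f ph).
  have fg : endo_conj f g by exists ph, ph.
  have g0 : tnth g o0 = a1 *: x o0 + P.
    by rewrite tnth_perm_comp t0 tnth_comp f1 comp_linear phE t1 below_const.
  have g1 : tnth g o1 = a2 *: x o2 + comp_mpoly ph Q.
    by rewrite tnth_perm_comp t1 tnth_comp f0 comp_linear phE t2.
  have g2 : tnth g o2 = a0 *: x o1 + C.
    by rewrite tnth_perm_comp t2 tnth_comp f2 comp_linear phE t0 below_const.
  have hQ' : below 2 (comp_mpoly ph Q).
    apply: (below_comp hQ) => j j2; rewrite phE; apply: belowX.
    by case: (ord3P j) j2 => ->; rewrite ?t0 ?t1.
  have [d [d1 hd]] := has_growth_fibered R g0 hP0 a10 g1 hQ' g2 (below_le (leq0n 1) hC).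
  exact: nat_quadratic fg d1 hd.
have f2' : tnth f o2 = a0 *: x o0 + (0 *: x o1 + C) by rewrite scale0r add0r.
have [th [a [b [h1 h2 h3]]]] := has_growth_shift R f0 hQ f1 hP c0 f2' hC (or_introl erefl).
by exists f, th, a, b; split=> //; apply: endo_conj_refl.
Qed.

(** In the coordinates (V, x_0, x_2) the first one is the next value of x_0, so the second component
    becomes x_0 and the map is shift-like with c = 1. *)
Lemma growth_VWU : tnth f o0 = V -> tnth f o1 = W -> tnth f o2 = U -> quadratic_growth f.
Proof.
move=> f0 f1 f2.
pose P' := comp_mpoly (endo3 (x o1) (x o0) (x o2)) P.
pose psi := endo3 V (x o0) (x o2).
pose phi := endo3 (x o1) (a1^-1 *: x o0 + (- a1^-1) *: P') (x o2).
have [psi0 psi1 psi2] : [/\ tnth psi o0 = V, tnth psi o1 = x o0 & tnth psi o2 = x o2].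
  exact: endo3E.
have [phi0 phi1 phi2] : [/\ tnth phi o0 = x o1,
    tnth phi o1 = a1^-1 *: x o0 + (- a1^-1) *: P' & tnth phi o2 = x o2].
  exact: endo3E.
have only0 (j : 'I_3) : (j < 1)%N -> j = o0.
  by rewrite ltnS leqn0 => /eqP j0; apply: val_inj.
have compP (g : endo k 3) : tnth g o0 = x o0 -> comp_mpoly g P = P.
  by move=> g0; apply: (comp_fix hP) => j /only0 ->.
have P'2 : below 2 P'.
  apply: (below_comp hP) => j /only0 ->; have [-> _ _] := endo3E (x o1) (x o0) (x o2).
  exact: belowX.
have phiP : comp_mpoly phi P = P'.
  apply: comp_mpoly_supp => m hm j mj.
  have -> : j = o0 by apply: only0; rewrite ltnNge; apply/negP => /(hP hm) e; rewrite e in mj.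
  by rewrite phi0; have [-> _ _] := endo3E (x o1) (x o0) (x o2).
have psiP' : comp_mpoly psi P' = P.
  rewrite -comp_mpolyA; apply: compP; rewrite tnth_comp.
  by have [-> _ _] := endo3E (x o1) (x o0) (x o2); rewrite comp_id_mpoly.
have phiV : comp_mpoly phi V = x o0.
  rewrite comp_linear phi1 phiP scalerDr !scalerA mulrN mulfV // scale1r scaleN1r.
  by rewrite subrK.
have phipsi : endo_comp phi psi = endo_id k 3.
  apply: endo3_eqP; rewrite tnth_comp tnth_id.
  - by rewrite phi0 comp_id_mpoly psi1.
  - rewrite phi1 comp_linear comp_mpolyZ psiP' psi0 scaleNr -scalerBr addrK scalerA.
    by rewrite mulVf // scale1r.
  - by rewrite phi2 comp_id_mpoly psi2.
have psiphi : endo_comp psi phi = endo_id k 3.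
  apply: endo3_eqP; rewrite tnth_comp tnth_id.
  - by rewrite psi0.
  - by rewrite psi1 comp_id_mpoly phi0.
  - by rewrite psi2 comp_id_mpoly phi2.
pose g := endo_comp psi (endo_comp f phi).
have fp0 : tnth (endo_comp f phi) o0 = x o0 by rewrite tnth_comp f0.
have g0 : tnth g o0 = (a1 * a2) *: x o2 + (a1 *: comp_mpoly phi Q + P).
  rewrite tnth_comp psi0 comp_linear (compP _ fp0) tnth_comp f1 comp_linear phi2.
  by rewrite scalerDr scalerA addrA.
have g1 : tnth g o1 = 0 *: x o1 + (1 *: x o0 + 0).
  by rewrite tnth_comp psi1 comp_id_mpoly fp0 scale0r add0r scale1r addr0.
have g2 : tnth g o2 = 0 *: x o0 + (a0 *: x o1 + C).
  by rewrite tnth_comp psi2 comp_id_mpoly tnth_comp f2 comp_linear phi0 below_const // scale0r add0r.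
have hQ' : below 2 (a1 *: comp_mpoly phi Q + P).
  apply: belowD; last exact: below_le hP.
  apply/belowZ/(below_comp hQ) => j j2; have [e|e|e] := ord3P j; rewrite e ?phi0 ?phi1 in j2 *.
  - exact: belowX.
  - by apply: belowD; [apply/belowZ/belowX | apply/belowZ].
  - by [].
have h0 : below 0 (0 : mpoly 3 k) by move=> m; rewrite msupp0.
have c1 := max_exp_linear (oner_neq0 k) h0.
have hP1 : below 1 (1 *: x o0 + 0) by rewrite addr0; apply/belowZ/belowX.
have [|th [a [b [t1 t2 t3]]]] := has_growth_shift R g0 hQ' g1 hP1 _ g2 hC (or_intror c1).
  by rewrite c1.
by exists g, th, a, b; split=> //; exists phi, psi.
Qed.

(** Replacing x_2 by x_2 - r, where r is the polynomial in x_1 with r(U) = P, reduces the last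
    component to a multiple of x_1. The map is then shift-like, with the linear U in second
    place. *)
Lemma growth_WUV : tnth f o0 = W -> tnth f o1 = U -> tnth f o2 = V -> quadratic_growth f.
Proof.
move=> f0 f1 f2.
pose rho := endo3 (a0^-1 *: x o1 + (- a0^-1) *: C) (x o1) (x o2).
have [rho0 _ _] : [/\ tnth rho o0 = a0^-1 *: x o1 + (- a0^-1) *: C,
    tnth rho o1 = x o1 & tnth rho o2 = x o2] by exact: endo3E.
pose r := comp_mpoly rho P.
pose psi := endo3 (x o0) (x o1) (x o2 - r); pose phi := endo3 (x o0) (x o1) (x o2 + r).
have [psi0 psi1 psi2] : [/\ tnth psi o0 = x o0, tnth psi o1 = x o1 &
    tnth psi o2 = x o2 - r] by exact: endo3E.
have [phi0 phi1 phi2] : [/\ tnth phi o0 = x o0, tnth phi o1 = x o1 &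
    tnth phi o2 = x o2 + r] by exact: endo3E.
have only0 (j : 'I_3) : (j < 1)%N -> j = o0.
  by rewrite ltnS leqn0 => /eqP j0; apply: val_inj.
have r2 : below 2 r.
  apply: (below_comp hP) => j /only0 ->; rewrite rho0.
  by apply: belowD; [apply/belowZ/belowX | apply/belowZ/(below_le _ hC)].
have phi_fix p : below 2 p -> comp_mpoly phi p = p.
  by move=> hp; apply: (comp_fix hp) => j; case: (ord3P j) => ->.
have psi_fix p : below 2 p -> comp_mpoly psi p = p.
  by move=> hp; apply: (comp_fix hp) => j; case: (ord3P j) => ->.
have phipsi : endo_comp phi psi = endo_id k 3.
  apply: endo3_eqP; rewrite tnth_comp tnth_id.
  - by rewrite phi0 comp_id_mpoly psi0.
  - by rewrite phi1 comp_id_mpoly psi1.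
  - by rewrite phi2 comp_mpolyD comp_id_mpoly psi2 psi_fix // subrK.
have psiphi : endo_comp psi phi = endo_id k 3.
  apply: endo3_eqP; rewrite tnth_comp tnth_id.
  - by rewrite psi0 comp_id_mpoly phi0.
  - by rewrite psi1 comp_id_mpoly phi1.
  - by rewrite psi2 comp_mpolyB comp_id_mpoly phi2 phi_fix // addrK.
have fp0 : tnth (endo_comp f phi) o0 = a2 *: x o2 + (a2 *: r + Q).
  by rewrite tnth_comp f0 comp_linear phi2 phi_fix // scalerDr addrA.
have fp1 : tnth (endo_comp f phi) o1 = U.
  by rewrite tnth_comp f1 comp_linear phi0 below_const.
have fp2 : tnth (endo_comp f phi) o2 = V.
  by rewrite tnth_comp f2 comp_linear phi1 phi_fix //; apply: below_le hP.
have fr : comp_mpoly (endo_comp f phi) r = P.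
  rewrite -comp_mpolyA; apply: (comp_fix hP) => j /only0 ->.
  rewrite tnth_comp rho0 comp_linear fp1 comp_mpolyZ below_const // scaleNr -scalerBr.
  by rewrite addrK scalerA mulVf // scale1r.
pose g := endo_comp psi (endo_comp f phi).
have g0 : tnth g o0 = a2 *: x o2 + (a2 *: r + Q).
  by rewrite tnth_comp psi0 comp_id_mpoly.
have g1 : tnth g o1 = 0 *: x o1 + (a0 *: x o0 + C).
  by rewrite tnth_comp psi1 comp_id_mpoly fp1 scale0r add0r.
have g2 : tnth g o2 = 0 *: x o0 + (a1 *: x o1 + 0).
  by rewrite tnth_comp psi2 comp_mpolyB comp_id_mpoly fp2 fr addrK scale0r add0r addr0.
have hQ' : below 2 (a2 *: r + Q) by apply: belowD => //; apply: belowZ.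
have h0 : below 0 (0 : mpoly 3 k) by move=> m; rewrite msupp0.
have c1 := max_exp_linear a00 hC.
have hU : below 1 (a0 *: x o0 + C).
  by apply: belowD; [apply/belowZ/belowX | apply: below_le hC].
have [|th [a [b [t1 t2 t3]]]] := has_growth_shift R g0 hQ' g1 hU _ g2 h0 (or_intror c1).
  by rewrite c1.
by exists g, th, a, b; split=> //; exists phi, psi.
Qed.

End Cases.

Lemma realized_dim3 (lambda : R) : 1 <= lambda -> realized k lambda 3 ->
  exists a b : nat, lambda ^+ 2 = a%:R * lambda + b%:R.
Proof.
move=> l1 [_ [f [fa ft dl]]]; have [s [h [th fh]]] := affine_triangular_normal fa ft.
suff [g [t [a [b [hg t1 ht gt]]]]] : quadratic_growth (endo_comp (perm_endo k s) h).
  by exists a, b; rewrite (has_growth_unique (endo_conj_trans fh hg) t1 l1 gt dl).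
have [a0 [C [a00 hC h0]]] := th o0; have [a1 [P [a10 hP h1]]] := th o1.
have [a2 [Q [a20 hQ h2]]] := th o2.
have [[e0 e1 e2]|[[e0 e1 e2]|[[e0 e1 e2]|[[e0 e1 e2]|[[e0 e1 e2]|[e0 e1 e2]]]]]] := perm3P s.
- apply: (@nat_quadratic _ h 1) => //; last exact: has_growth_tri.
  have -> : endo_comp (perm_endo k s) h = h.
    by apply: endo3_eqP; rewrite tnth_perm_comp ?e0 ?e1 ?e2 ?h0 ?h1 ?h2.
  exact: endo_conj_refl.
- by apply: (growth_VUW hC hP hQ); rewrite tnth_perm_comp ?e0 ?e1 ?e2 ?h0 ?h1 ?h2.
- by apply: (growth_UWV a00 hC hP hQ); rewrite tnth_perm_comp ?e0 ?e1 ?e2 ?h0 ?h1 ?h2.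
- by apply: (growth_WVU a10 hC hP hQ); rewrite tnth_perm_comp ?e0 ?e1 ?e2 ?h0 ?h1 ?h2.
- by apply: (growth_VWU a10 hC hP hQ); rewrite tnth_perm_comp ?e0 ?e1 ?e2 ?h0 ?h1 ?h2.
- by apply: (growth_WUV a00 hC hP hQ); rewrite tnth_perm_comp ?e0 ?e1 ?e2 ?h0 ?h1 ?h2.
Qed.

End SmallDimension.

(** * Semigroups stable under multiplication by a Perron number *)

Local Notation normc := Normc.normc.

Section Modulus.
Variable R : realType.
Implicit Types (x y : R[i]) (a : R).

Lemma normc_ge0 x : 0 <= normc x.
Proof. by case: x => a b; rewrite sqrtr_ge0. Qed.

Lemma normc_real a : normc a%:C = `|a|.
Proof. by rewrite /= expr0n addr0 sqrtr_sqr. Qed.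

Lemma normcX x n : normc (x ^+ n) = normc x ^+ n.
Proof.
elim: n => [|n ih]; first by rewrite !expr0 Normc.normc1.
by rewrite !exprS Normc.normcM ih.
Qed.

Lemma normc_sum (I : Type) (r : seq I) (F : I -> R[i]) :
  normc (\sum_(i <- r) F i) <= \sum_(i <- r) normc (F i).
Proof.
elim: r => [|i r ih]; first by rewrite !big_nil Normc.normc0.
by rewrite !big_cons (le_trans (le_normcD _ _)) // lerD2l.
Qed.

Lemma normc_conj x : normc x^*%C = normc x.
Proof. by case: x => a b /=; rewrite sqrrN. Qed.

End Modulus.

Section Evaluation.
Variable F : fieldType.
Implicit Types (u v : {poly int}) (z : F).

Definition ev v z : F := (map_poly intr v).[z].

Lemma evB u v z : ev (u - v) z = ev u z - ev v z.
Proof. by rewrite /ev rmorphB hornerD hornerN. Qed.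

Lemma evM u v z : ev (u * v) z = ev u z * ev v z.
Proof. by rewrite /ev rmorphM hornerM. Qed.

Lemma evX z : ev 'X z = z.
Proof. by rewrite /ev map_polyX hornerX. Qed.

Lemma ev_sum (I : Type) (r : seq I) (G : I -> {poly int}) z :
  ev (\sum_(i <- r) G i) z = \sum_(i <- r) ev (G i) z.
Proof. by rewrite /ev rmorph_sum horner_sum. Qed.

Lemma ev_coef e v z : (size v <= e)%N -> ev v z = \sum_(j < e) (v`_j)%:~R * z ^+ j.
Proof.
move=> h; have hs : (size (map_poly (intr : int -> F) v) <= e)%N.
  exact: leq_trans (size_poly _ _) h.
rewrite /ev (horner_coef_wide _ hs); apply: eq_bigr => j _.
by rewrite coef_map.
Qed.

End Evaluation.

Lemma ev_rmorph (F G : fieldType) (f : {rmorphism F -> G}) v z : ev v (f z) = f (ev v z).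
Proof.
rewrite /ev -horner_map -map_poly_comp; congr (_.[_]).
by apply: eq_map_poly => a; rewrite /= rmorph_int.
Qed.

Section Rounding.
Variable e : nat.
Implicit Types (u v : {poly int}).

(** Each coefficient is distributed evenly: every part gets its quotient by n, and the first parts,
    as many as the remainder says, get 1 more. *)
Lemma poly_split v n : (0 < n)%N -> (size v <= e)%N ->
  exists us : 'I_n -> {poly int},
    [/\ v = \sum_i us i, forall i, (size (us i) <= e)%N &
        forall i j, `|(us i)`_j *+ n - v`_j| <= n%:Z].
Proof.
move=> n0 hv; have n0' : n%:Z != 0 by rewrite -lt0n in n0 *; lia.
exists (fun i : 'I_n =>
  \poly_(j < e) ((v`_j %/ n)%Z + (i < `|(v`_j %% n)%Z|)%N%:Z)).
have hmod j : (v`_j %% n)%Z = `|(v`_j %% n)%Z|%:Z.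
  by rewrite gez0_abs // modz_ge0.
have hlt j : (`|(v`_j %% n)%Z| < n)%N.
  by rewrite -ltz_nat -hmod; apply: ltz_pmod; lia.
split=> [|i|i j]; last 2 first.
- exact: size_poly.
- rewrite coef_poly; case: ltnP => hj; last first.
    by rewrite mul0rn sub0r normrN nth_default ?normr0 // (leq_trans hv).
  have := hlt j; rewrite [X in _ - X](divz_eq v`_j n) hmod.
  move: `|(v`_j %% n)%Z|%N (v`_j %/ n)%Z => r q rn.
  rewrite -(mulr_natr (q + _)) natz mulrDl opprD addrACA subrr add0r.
  by case: (i < r)%N; rewrite ?mul1r ?mul0r; lia.
apply/polyP => j; rewrite coef_sum.
under eq_bigr do rewrite coef_poly.
case: ltnP => hj; last by rewrite big1 // nth_default // (leq_trans hv).
rewrite big_split /= sumr_const card_ord.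
rewrite [LHS](divz_eq _ n) -(mulr_natr (_ %/ _)%Z) natz; congr (_ + _); rewrite hmod.
have := ltnW (hlt j); move: `|(v`_j %% n)%Z|%N => r rn.
rewrite -(big_morph Posz PoszD (erefl _)); congr Posz.
suff -> : (\sum_(i < n) (i < r) = minn n r)%N by apply/esym/minn_idPr.
elim: n {n0 n0' hmod hlt rn hv} => [|n ih]; first by rewrite big_ord0 min0n.
by rewrite big_ord_recr /= ih; case: (ltnP n r) => h; lia.
Qed.

End Rounding.

Section Companion.
Variables (F : fieldType) (P : {poly int}).
Implicit Types (v : {poly int}) (z : F).

(** The remainder of X v modulo a monic P if deg v < deg P: [(size P).-2] is deg P - 1, the index of
    the coefficient that multiplication by X moves to degree deg P. *)
Definition mulX_mod v : {poly int} := 'X * v - v`_(size P).-2 *: P.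

Lemma size_mulX_mod v : P \is monic -> (1 < size P)%N -> (size v <= (size P).-1)%N ->
  (size (mulX_mod v) <= (size P).-1)%N.
Proof.
move=> Pm P1 hv; apply/leq_sizeP => j hj.
rewrite coefB coefXM coefZ; have j0 : (0 < j)%N by rewrite (leq_trans _ hj) // ltn_predRL.
rewrite -(prednK j0) /=; have [<-|ne] := eqVneq (size P).-1 j.
  by rewrite prednK -?lead_coefE ?(monicP Pm) ?mulr1 ?subrr // ltn_predRL.
have hj' : (size P <= j)%N by rewrite -(ltn_predK P1) ltn_neqAle ne.
rewrite prednK // (nth_default _ hj') mulr0 subr0 nth_default //.
by move: (size P) (size v) hv hj'; lia.
Qed.

Lemma ev_mulX_mod v z : ev P z = 0 -> ev (mulX_mod v) z = z * ev v z.
Proof. by move=> h; rewrite evB -mul_polyC !evM h mulr0 subr0 evX. Qed.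

End Companion.

(** The inverse of a Vandermonde matrix recovers the coefficients from the values at the distinct
    points of [rs]. *)
Lemma coef_bound (R : realType) (rs : seq R[i]) (M : R) : uniq rs ->
  exists B : nat, forall v : {poly int}, (size v <= size rs)%N ->
    (forall z, z \in rs -> normc (ev v z) <= M) -> forall j, (absz (v`_j)%R <= B)%N.
Proof.
move=> urs; set e := size rs; pose a : 'rV[R[i]]_e := \row_i rs`_i.
pose V := Vandermonde e a; pose W := invmx V.
have Vu : V \in unitmx.
  rewrite unitmxE det_Vandermonde unitfE; apply/prodf_neq0 => i _.
  apply/prodf_neq0 => j ij; rewrite !mxE subr_eq0 nth_uniq //.
  by rewrite gt_eqF // .
pose S := \sum_i \sum_j normc (W i j).
have hS i j : normc (W i j) <= S.
  rewrite /S (bigD1 i) //= (bigD1 j) //= -addrA lerDl.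
  by rewrite addr_ge0 ?sumr_ge0 // => l _; rewrite ?sumr_ge0 // => *; apply: normc_ge0.
exists (Num.bound (e%:R * (M * S))) => v hv hM j.
have [hj|hj] := ltnP j e; last by rewrite nth_default // (leq_trans hv).
pose r : 'rV[R[i]]_e := \row_j (v`_j)%:~R.
have rV : r *m V = \row_i ev v rs`_i.
  apply/rowP => i; rewrite !mxE (ev_coef _ hv); apply: eq_bigr => l _.
  by rewrite !mxE.
have hr : (v`_j)%:~R = (r *m V *m W) 0 (Ordinal hj).
  by rewrite -mulmxA mulmxV // mulmx1 mxE.
have : normc (v`_j)%:~R <= e%:R * (M * S).
  rewrite hr rV mxE (le_trans (normc_sum _ _)) //.
  have -> : e%:R * (M * S) = \sum_(i < e) (M * S).
    by rewrite sumr_const card_ord mulr_natl.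
  apply: ler_sum => i _; rewrite mxE Normc.normcM.
  by rewrite ler_pM ?normc_ge0 ?hS // hM // mem_nth.
have -> : normc ((v`_j)%:~R : R[i]) = (absz v`_j)%:R.
  rewrite -[X in normc X](rmorph_int (real_complex R)) normc_real.
  by rewrite -intr_norm -abszE -pmulrn.
move=> h; have := le_lt_trans h (archi_boundP (le_trans (ler0n _ _) h)).
by rewrite ltr_nat => /ltnW.
Qed.

Lemma bounded_polys (e B : nat) : exists L : seq {poly int},
  forall v : {poly int}, (size v <= e)%N -> (forall j, (absz (v`_j)%R <= B)%N) -> v \in L.
Proof.
pose g (x : {ffun 'I_e -> 'I_(2 * B).+1}) : {poly int} :=
  \poly_(j < e) (if insub j is Some i then (x i)%:Z - B%:Z else 0).
exists [seq g x | x : {ffun 'I_e -> 'I_(2 * B).+1}] => v hv hB.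
apply/mapP; exists [ffun j : 'I_e => inord (absz (v`_j + B%:Z))]; first by rewrite mem_enum.
apply/polyP => j; rewrite coef_poly; case: ltnP => hj; last first.
  by rewrite nth_default // (leq_trans hv).
rewrite insubT ffunE /= inordK; have := hB j; move: (v`_j) => x; lia.
Qed.

Section Lind.
Variables (R : realType) (b : R) (P : {poly int}) (rs : seq R[i]).
Hypotheses (b1 : 1 < b) (Pm : P \is monic).
Hypotheses (Prs : map_poly intr P = \prod_(z <- rs) ('X - z%:P)) (urs : uniq rs).
Hypotheses (brs : b%:C \in rs).
Hypothesis (hrs : forall z, z \in rs -> z != b%:C -> normc z < b).

Let b0 : 0 < b. Proof. exact: lt_trans b1. Qed.

Let size_rs : size P = (size rs).+1.
Proof.
rewrite -(size_prod_XsubC rs id) -Prs size_map_poly_id0 //.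
by rewrite (monicP Pm) oner_neq0.
Qed.

Let rs0 : (0 < size rs)%N. Proof. by case: rs brs. Qed.

Let e := size rs.

Let ratio : exists c : R, [/\ 0 <= c, c < 1 &
  forall z, z \in rs -> z != b%:C -> normc z <= c * b].
Proof.
suff: exists c : R, [/\ 0 <= c, c < 1 &
    forall z, z \in [seq z <- rs | z != b%:C] -> normc z <= c * b].
  move=> [c [c0 c1 h]]; exists c; split=> // z zr zb.
  by apply: h; rewrite mem_filter zb.
have: forall z, z \in [seq z <- rs | z != b%:C] -> normc z < b.
  by move=> z; rewrite mem_filter => /andP[zb zr]; apply: hrs.
elim: [seq z <- rs | z != b%:C] => [|z s ih] hs; first by exists 0.
have [z' hz'|c [c0 c1 hc]] := ih; first by apply: hs; rewrite inE hz' orbT.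
exists (Num.max c (normc z / b)); split.
- by rewrite le_max c0.
- by rewrite gt_max c1 ltr_pdivrMr // mul1r hs // inE eqxx.
- move=> y; rewrite inE => /orP[/eqP ->|/hc h].
    by rewrite -ler_pdivrMr // le_max lexx orbT.
  by apply: le_trans h _; rewrite ler_pM2r // le_max lexx.
Qed.

Let root_ev z : z \in rs -> ev P z = 0.
Proof. by move=> zr; apply/eqP; rewrite -/(root _ z) Prs root_prod_XsubC. Qed.

Let norm_le z : z \in rs -> normc z <= b.
Proof.
move=> zr; have [->|zb] := eqVneq z b%:C; last exact/ltW/hrs.
by rewrite normc_real ger0_norm // ltW.
Qed.

Let ev_real v : ev v b%:C = (ev v b)%:C.
Proof. exact: (ev_rmorph (real_complex R)). Qed.

Let ev_dist : exists2 K : R, 0 < K & forall (u v : {poly int}) (n : nat) z,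
  (size u <= e)%N -> (size v <= e)%N ->
  (forall j, `|u`_j *+ n - v`_j| <= n%:Z) -> z \in rs ->
  normc (ev u z *+ n - ev v z) <= n%:R * K.
Proof.
exists (\sum_(j < e) b ^+ j).
  move: rs0; rewrite -/e; case: e => // e' _.
  rewrite big_ord_recl expr0 ltr_wpDr // sumr_ge0 // => j _.
  by rewrite exprn_ge0 // ltW.
move=> u v n z hu hv h zr; rewrite (ev_coef _ hu) (ev_coef _ hv) -sumrMnl -sumrB.
apply: le_trans (normc_sum _ _) _; rewrite mulr_sumr; apply: ler_sum => j _.
rewrite -mulrnAl -mulrBl Normc.normcM normcX ler_pM ?exprn_ge0 ?normc_ge0 //.
  have -> : (u`_j)%:~R *+ n - (v`_j)%:~R = (u`_j *+ n - v`_j)%:~R :> R[i].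
    by rewrite rmorphB rmorphMn.
  rewrite -[X in normc X](rmorph_int (real_complex R)) normc_real -intr_norm.
  by rewrite [leRHS]pmulrn ler_int.
by rewrite lerXn2r ?nnegrE ?normc_ge0 ?(ltW b0) // norm_le.
Qed.

(* The semigroup is generated by the values at [b] of the integer polynomials v of
   degree < e, e = deg P, with |v(z)| <= v(b) <= M for all roots z of P. If X v mod P
   is too large, it is split into n roughly equal parts with integer coefficients;
   since |z| <= c b with c < 1 for z <> b, rounding does not violate |v(z)| <= v(b). *)
Lemma lind_semigroup : exists s : seq R, [/\ s != [::], forall x, x \in s -> 0 < x &
  forall x, x \in s -> exists2 t : seq R, {subset t <= s} & b * x = \sum_(y <- t) y].
Proof.
have [c [c0 c1 hc]] := ratio; have c1' : 0 < 1 - c by rewrite subr_gt0.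
have [K K0 dist] := ev_dist.
(* Let w = X v mod P and n = floor(w(b)/H) >= 1. Then nH <= w(b) < 2nH, and each part u has |u(z) -
   w(z)/n| <= K. So u(b) >= H - K > 0, u(b) <= 2H + K <= M, and |u(z)| <= c w(b)/n + K <= w(b)/n - K
   <= u(b), since (1 - c)H = 2K. The summand 1 in M admits the constant polynomial 1. *)
pose H := 2 * K / (1 - c); pose M := 2 * H + K + 1.
have HK : K < H.
  by rewrite /H ltr_pdivlMr // [2 * K]mulrC ltr_pM2l //; lra.
have H0 : 0 < H := lt_trans K0 HK.
have HE : H * (1 - c) = 2 * K by rewrite /H divfK // gt_eqF.
have ME : M = 2 * H + K + 1 by [].
clearbody M H.
have [B hB] := coef_bound M urs; have [L hL] := bounded_polys e B.
pose V (v : {poly int}) := [/\ (size v <= e)%N, 0 < ev v b, ev v b <= M &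
  forall z, z \in rs -> z != b%:C -> normc (ev v z) <= ev v b].
pose s := [seq ev v b | v <- L & `[< V v >]].
have sV v : V v -> ev v b \in s.
  move=> Vv; apply/mapP; exists v => //; rewrite mem_filter; apply/andP; split.
    exact/asboolP.
  have [hv v0 vM hz] := Vv; apply: hL => // j; apply: hB => // z zr.
  have [->|zb] := eqVneq z b%:C; first by rewrite ev_real normc_real gtr0_norm.
  exact: le_trans (hz z zr zb) vM.
have Vs x : x \in s -> exists2 v, V v & x = ev v b.
  by move=> /mapP[v]; rewrite mem_filter => /andP[/asboolP Vv _] ->; exists v.
exists s; split.
- have : V 1.
    have e1 (F : fieldType) (z : F) : ev 1 z = 1 by rewrite /ev rmorph1 hornerE.
    split=> [|||z _ _]; rewrite ?size_poly1 ?e1 //; first by rewrite ME; lra.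
    by rewrite Normc.normc1.
  by move=> /sV h; apply/eqP => s0; rewrite s0 in h.
- by move=> x /Vs[v [_ v0 _ _] ->].
move=> x /Vs[v [hv v0 vM hz] ->].
have P1 : (1 < size P)%N by rewrite size_rs ltnS.
have eP : (size P).-1 = e by rewrite size_rs.
pose w := mulX_mod P v.
have hw : (size w <= e)%N by rewrite -eP size_mulX_mod // eP.
have wz z : z \in rs -> ev w z = z * ev v z by move=> zr; rewrite ev_mulX_mod // root_ev.
have wb : ev w b = b * ev v b.
  by apply: complexI; rewrite -ev_real wz // ev_real rmorphM.
have w0 : 0 < ev w b by rewrite wb mulr_gt0.
have wc z : z \in rs -> z != b%:C -> normc (ev w z) <= c * ev w b.
  move=> zr zb; rewrite wz // Normc.normcM wb mulrA.
  by apply: ler_pM; rewrite ?normc_ge0 ?hc ?hz.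
rewrite -wb; have [wM|Mw] := leP (ev w b) M.
  exists [:: ev w b]; last by rewrite big_seq1.
  move=> y; rewrite inE => /eqP ->; apply: sV; split=> // z zr zb.
  by apply: le_trans (wc z zr zb) _; rewrite ger_pMl // ltW.
pose n := Num.truncn (ev w b / H).
have /andP[n1 n2] : n%:R <= ev w b / H < n.+1%:R.
  by apply: truncn_itv; rewrite divr_ge0 // ltW.
have n0 : (0 < n)%N.
  by rewrite truncn_gt0 ler_pdivlMr // mul1r; apply: le_trans (ltW Mw); rewrite ME; lra.
have n0' : (1 : R) <= n%:R by rewrite ler1n.
rewrite ler_pdivlMr // in n1; rewrite ltr_pdivrMr // in n2.
have [us [usE hus hdist]] := poly_split n0 hw.
exists [seq ev (us i) b | i : 'I_n]; last first.
  by rewrite big_map big_enum usE ev_sum.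
move=> y /mapP[i _ ->]; apply: sV.
have n0r : (0 : R) < n%:R by rewrite ltr0n.
have d z : z \in rs -> normc (ev (us i) z *+ n - ev w z) <= n%:R * K.
  by move=> zr; apply: dist.
have := d _ brs; rewrite !ev_real -rmorphMn -rmorphB normc_real.
rewrite ler_norml -mulr_natl => /andP[d1 d2].
have n3 : n.+1%:R <= 2 * n%:R :> R by rewrite -natr1; lra.
split=> //.
- rewrite -(pmulr_rgt0 _ n0r); nra.
- rewrite -(ler_pM2l n0r) ME; nra.
- move=> z zr zb; rewrite -(ler_pM2l n0r).
  have -> : n%:R * normc (ev (us i) z) = normc (ev (us i) z *+ n).
    by rewrite normcMn mulr_natl.
  have := le_normcD (ev (us i) z *+ n - ev w z) (ev w z); rewrite subrK => h.
  have := d z zr; have := wc z zr zb => h1 h2.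
  have : n%:R * (2 * K) <= (1 - c) * ev w b.
    by rewrite -HE mulrA [leRHS]mulrC ler_pM2r.
  lra.
Qed.

End Lind.

(** * Conjugates of maximal modulus *)

Section MinimalPolynomial.
Variables (F : numFieldType).
Implicit Types (x y : F) (p q : {poly rat}).

Lemma map_ratr_int (P : {poly int}) :
  map_poly ratr (map_poly intr P : {poly rat}) = map_poly intr P :> {poly F}.
Proof.
by rewrite -map_poly_comp; apply: eq_map_poly => a; rewrite /= ratr_int.
Qed.

Lemma minimal_polynomial_dvd x p q : minimal_polynomial x p ->
  root (map_poly ratr q) x -> p %| q.
Proof.
move=> [pm [p1 pirr] px] qx.
have : size (gcdp p q) != 1%N.
  apply/eqP => /eqP; rewrite -[_ == _]/(coprimep p q) -(coprimep_map (ratr : rat -> F)).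
  by move=> /coprimep_root/(_ px)/negP; apply.
move=> /pirr/(_ (dvdp_gcdl _ _)) e.
by rewrite -(eqp_dvdl _ e) dvdp_gcdr.
Qed.

(** By Gauss's lemma the minimal polynomial, which divides a monic integer polynomial, is a rational
    multiple of an integer polynomial with leading coefficient 1 or -1. *)
Lemma minimal_polynomial_exists x : algebraic_integer x ->
  exists P : {poly int}, P \is monic /\ minimal_polynomial x (map_poly intr P).
Proof.
move=> [Q Qm Qx].
pose A n := `[< exists q, [/\ q \is monic, root (map_poly ratr q) x & size q = n] >].
have exA : exists n, A n.
  exists (size (map_poly intr Q : {poly rat})); apply/asboolP.
  by exists (map_poly intr Q); rewrite map_ratr_int monic_map.
case: (ex_minnP exA) => n /asboolP[p [pm px sp]] hmin.
have p0 : p != 0 by rewrite monic_neq0.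
have minp q : q != 0 -> root (map_poly ratr q) x -> (size p <= size q)%N.
  move=> q0 qx; rewrite sp; apply: hmin; apply/asboolP.
  exists ((lead_coef q)^-1 *: q); split.
  - by rewrite monicE lead_coefZ mulVf // lead_coef_eq0.
  - by rewrite map_polyZ rootZ // fmorph_eq0 invr_eq0 lead_coef_eq0.
  - by rewrite size_scale // invr_eq0 lead_coef_eq0.
have irr : irreducible_poly p.
  split=> [|q q1 /dvdpP[r Dp]].
    by rewrite -(size_map_poly (ratr : rat -> F)) (root_size_gt1 _ px) // map_poly_eq0.
  have [r0 q0] : r != 0 /\ q != 0 by apply/norP; rewrite -mulf_eq0 -Dp.
  have : root (map_poly ratr r) x || root (map_poly ratr q) x by rewrite -rootM -rmorphM -Dp.
  case/orP => /minp => [/(_ r0)|/(_ q0)] h.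
    have : (0 < size q)%N by rewrite size_poly_gt0.
    move: h q1; rewrite Dp size_mul //.
    have : (0 < size r)%N by rewrite size_poly_gt0.
    by move: (size r) (size q); lia.
  rewrite -dvdp_size_eqp ?Dp ?dvdp_mull // -Dp eqn_leq h andbT.
  by rewrite dvdp_leq // Dp dvdp_mull.
have pQ : p %| map_poly intr Q.
  by apply: (@minimal_polynomial_dvd x) => //; rewrite map_ratr_int.
have [p1 [a a0 pE] [r Qr]] := dvdpP_rat_int pQ.
have : lead_coef p1 * lead_coef r = 1.
  by rewrite -lead_coefM -Qr (monicP Qm).
move=> h; have hu : lead_coef p1 * lead_coef p1 = 1.
  have : lead_coef p1 \is a GRing.unit by apply/unitrPr; exists (lead_coef r).
  by rewrite qualifE /= => /pred2P[] ->.
exists (lead_coef p1 *: p1); split.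
  by rewrite monicE lead_coefZ hu.
suff -> : map_poly intr (lead_coef p1 *: p1) = p by [].
have lp : a * (lead_coef p1)%:~R = 1.
  by have := monicP pm; rewrite pE lead_coefZ lead_coef_map_inj //; apply: intr_inj.
have l0 : (lead_coef p1)%:~R * (lead_coef p1)%:~R = 1 :> rat.
  by rewrite -intrM hu.
have ln0 : (lead_coef p1)%:~R != 0 :> rat.
  by apply/eqP => e0; move: l0; rewrite e0 mul0r => /eqP; rewrite eq_sym oner_eq0.
have -> : p = (lead_coef p1)%:~R *: map_poly intr p1.
  by rewrite pE; congr (_ *: _); apply: (mulIf ln0); rewrite lp l0.
by rewrite map_polyZ.
Qed.

End MinimalPolynomial.

Lemma irreducible_separable (p : {poly rat}) : irreducible_poly p -> separable_poly p.
Proof.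
move=> [p1 pirr]; rewrite unlock /coprimep.
apply/negPn/negP => /pirr/(_ (dvdp_gcdl _ _)) e.
have p'0 : p^`() != 0.
  apply/eqP => /(congr1 (fun q : {poly rat} => q`_(size p).-2)).
  rewrite coef_deriv coef0 prednK ?ltn_predRL // => /eqP.
  rewrite -lead_coefE mulrn_eq0 lead_coef_eq0 -size_poly_eq0.
  by case: (size p) p1 => [|[]].
have : (size p <= size p^`())%N.
  by apply: dvdp_leq => //; rewrite -(eqp_dvdl _ e) dvdp_gcdr.
by rewrite leqNgt lt_size_deriv // -size_poly_gt0 ltnW.
Qed.

Lemma minimal_polynomial_roots (R : realType) (P : {poly int}) :
  P \is monic -> irreducible_poly (map_poly intr P : {poly rat}) ->
  exists rs : seq R[i], map_poly intr P = \prod_(z <- rs) ('X - z%:P) /\ uniq rs.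
Proof.
move=> Pm Pirr; have [rs rsE] := closed_field_poly_normal (map_poly intr P : {poly R[i]}).
have {}rsE : map_poly intr P = \prod_(z <- rs) ('X - z%:P).
  by rewrite [LHS]rsE (monicP (monic_map _ Pm)) scale1r.
exists rs; split=> //; rewrite -separable_prod_XsubC -rsE -map_ratr_int.
by rewrite separable_map irreducible_separable.
Qed.

Section ConjugateTransfer.
Variables (F : numFieldType) (p : {poly rat}) (x y : F).
Hypotheses (p0 : p != 0) (px : root (map_poly ratr p) x).
Hypothesis conj : forall q : {poly rat}, root (map_poly ratr q) x -> root (map_poly ratr q) y.

Definition evq (z : F) : {rmorphism {poly rat} -> F} :=
  (horner_eval z \o map_poly ratr : {rmorphism {poly rat} -> F}).

Lemma evqE z q : evq z q = (map_poly ratr q).[z].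
Proof. by []. Qed.

(* The gcd is computed in K[X] with K = Q(x); lifting its coefficients to Q[Y]
   and substituting y for Y yields the required common divisor. *)
Lemma gcdp_transfer (A B : {poly {poly rat}}) : map_poly (evq x) A != 0 ->
  exists g : {poly F}, [/\ g \is monic,
    size g = size (gcdp (map_poly (evq x) A) (map_poly (evq x) B)),
    g %| map_poly (evq y) A & g %| map_poly (evq y) B].
Proof.
have [K [ev [inj [injE surj]]]] : exists (K : fieldType)
    (ev : {rmorphism {poly rat} -> K}) (inj : {rmorphism K -> F}),
    (forall q, inj (ev q) = evq x q) /\ (forall z, exists q, ev q = z).
  pose iota : {rmorphism rat -> F} := ratr.
  exists (subFExtend iota x p), (@subfx_eval _ _ iota x p), (@subfx_inj _ _ iota x p).
  split=> [q|z]; first exact: (@subfx_inj_eval _ _ iota x p px p0 q).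
  by have [q ->] := subfxE z; exists q.
have inj_map C : map_poly inj (map_poly ev C) = map_poly (evq x) C.
  by rewrite -map_poly_comp; apply: eq_map_poly => q; apply: injE.
have [lift liftE] := choice surj.
rewrite -!inj_map -gcdp_map size_map_poly map_poly_eq0.
set AK := map_poly ev A; set BK := map_poly ev B => A0.
have G0 : gcdp AK BK != 0 by rewrite gcdp_eq0 (negbTE A0).
pose G := (lead_coef (gcdp AK BK))^-1 *: gcdp AK BK.
have lG : (lead_coef (gcdp AK BK))^-1 != 0 by rewrite invr_eq0 lead_coef_eq0.
have Gm : G \is monic by rewrite monicE lead_coefZ mulVf // lead_coef_eq0.
have sG : size G = size (gcdp AK BK) by rewrite size_scale.
have GA : G %| AK by rewrite dvdpZl // dvdp_gcdl.
have GB : G %| BK by rewrite dvdpZl // dvdp_gcdr.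
have lifts (U : {poly K}) : exists u, map_poly ev u = U.
  exists (\poly_(j < size U) lift U`_j); apply/polyP => j.
  rewrite coef_map coef_poly; case: ltnP => h; first exact: liftE.
  by rewrite nth_default //; exact: (rmorph0 ev).
(* The lift is made monic itself, so that it keeps its degree when y is substituted. *)
have [g gm gG] : exists2 g, g \is monic & map_poly ev g = G.
  have [g' g'E] := lifts (G - 'X^((size G).-1)).
  have sg : (size (\poly_(j < (size G).-1) g'`_j)%R < size ('X^((size G).-1) : {poly {poly rat}}))%N.
    by rewrite size_polyXn ltnS size_poly.
  exists ('X^((size G).-1) + \poly_(j < (size G).-1) g'`_j).
    by rewrite monicE lead_coefDl // lead_coefXn.
  rewrite rmorphD /= map_polyXn; apply/polyP => j.
  rewrite coefD coef_map coef_poly coefXn; case: ltnP => h.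
    by rewrite -coef_map g'E coefB coefXn addrC subrK.
  rewrite [X in _ + X](_ : _ = 0) ?addr0; last exact: (rmorph0 ev).
  case: eqVneq h => [-> _|ne h].
    by rewrite -lead_coefE (monicP Gm).
  rewrite nth_default // -(@prednK (size G)) ?size_poly_gt0 ?monic_neq0 //.
  by rewrite ltn_neqAle eq_sym ne.
have transfer C : map_poly ev C = 0 -> map_poly (evq y) C = 0.
  move=> h; apply/polyP => j; rewrite coef_map coef0.
  apply/eqP; apply: conj; rewrite /root -evqE -injE.
  by rewrite -coef_map h coef0 rmorph0.
have dvd C : G %| map_poly ev C -> map_poly (evq y) g %| map_poly (evq y) C.
  move=> /dvdpP[U UE]; have [u uU] := lifts U.
  have := @transfer (C - u * g); rewrite !rmorphB !rmorphM /= uU gG UE subrr.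
  by move=> /(_ erefl)/eqP; rewrite subr_eq0 => /eqP ->; rewrite dvdp_mull.
exists (map_poly (evq y) g); split.
- exact: monic_map.
- by rewrite -sG -gG !size_map_poly_id0 // (monicP gm) rmorph1 oner_neq0.
- exact: dvd.
- exact: dvd.
Qed.

End ConjugateTransfer.

Section Circle.
Variables (R : realType) (x : R) (p : {poly rat}) (rs : seq R[i]).
Hypotheses (x0 : 0 < x) (pm : p \is monic) (pirr : irreducible_poly p).
Hypotheses (prs : map_poly ratr p = \prod_(z <- rs) ('X - z%:P)) (urs : uniq rs).
Hypotheses (xrs : x%:C \in rs) (hrs : forall z, z \in rs -> normc z <= x).

Let rootE z : root (map_poly ratr p) z = (z \in rs).
Proof. by rewrite prs root_prod_XsubC. Qed.

Let minp z : z \in rs -> minimal_polynomial z p.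
Proof. by move=> zr; split=> //; rewrite rootE. Qed.

Let conj z : z \in rs -> forall q : {poly rat},
  root (map_poly ratr q) x%:C -> root (map_poly ratr q) z.
Proof.
move=> zr q qx; have /dvdpP[u ->] := minimal_polynomial_dvd (minp xrs) qx.
by rewrite rmorphM rootM /= rootE zr orbT.
Qed.

Definition circle := [seq z <- rs | normc z == x].

Let nonzero z : z \in circle -> z != 0.
Proof.
rewrite mem_filter => /andP[/eqP h _]; apply/eqP => z0.
by move: x0; rewrite -h z0 Normc.normc0 ltxx.
Qed.

Let d := (size p).-1.

(* Up to a power of t, the value at t of [recip] specialised at z is p(z^2/t). *)
Let recip : {poly {poly rat}} := \poly_(j < d.+1) (p`_(d - j) *: 'X^(2 * (d - j))).

Let recipE (z t : R[i]) : t != 0 ->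
  (map_poly (evq z) recip).[t] = t ^+ d * (map_poly ratr p).[z ^+ 2 / t].
Proof.
move=> t0; have sd : (size (map_poly (evq z) recip) <= d.+1)%N.
  by rewrite (leq_trans (size_poly _ _)) // size_poly.
have sp : (size (map_poly ratr p : {poly R[i]}) <= d.+1)%N.
  by rewrite size_map_poly prednK // size_poly_gt0 monic_neq0.
rewrite (horner_coef_wide _ sd) (horner_coef_wide _ sp) mulr_sumr.
rewrite (reindex_inj rev_ord_inj) /=; apply: eq_bigr => j _.
have jd : (j <= d)%N by rewrite -ltnS.
have -> : (map_poly (evq z) recip)`_(d.+1 - j.+1) = ratr p`_j * (z ^+ 2) ^+ j.
  transitivity (map_poly ratr recip`_(d.+1 - j.+1)).[z]; first by rewrite coef_map.
  rewrite coef_poly ltnS subSS leq_subr subKn // map_polyZ /= map_polyXn.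
  by rewrite hornerZ hornerXn exprM.
rewrite subSS coef_map /= expr_div_n.
rewrite (_ : t ^+ d = t ^+ (d - j) * t ^+ j); last by rewrite -exprD subnK.
by field; rewrite expf_neq0.
Qed.

(** For |z| = x, x^2/z is the complex conjugate of z, which is a root because p has rational
    coefficients. *)
Let conj_circle z : z \in circle -> x%:C ^+ 2 / z \in circle.
Proof.
move=> zc; have := zc; rewrite !mem_filter => /andP[/eqP nz zr].
have -> : x%:C ^+ 2 / z = z^*%C.
  have zx : `|z| = x%:C by rewrite normc_def -nz; case: (z).
  by apply: (mulIf (nonzero zc)); rewrite divfK ?nonzero //; rewrite -zx sqr_normc mulrC.
rewrite normc_conj nz eqxx -rootE /=.
have -> : map_poly ratr p = map_poly conjc (map_poly ratr p) :> {poly R[i]}.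
  by rewrite -map_poly_comp; apply: eq_map_poly => a; apply/esym/fmorph_rat.
by rewrite fmorph_root rootE.
Qed.

(* The number of roots t of p for which z^2/t is also a root is the same for all
   roots z (it is a gcd degree); for z = x these t form the whole circle. *)
Lemma circle_closed z t : z \in circle -> t \in circle -> z ^+ 2 / t \in circle.
Proof.
move=> zc tc; pose pY : {poly {poly rat}} := map_poly polyC p.
have pYE y : map_poly (evq y) pY = map_poly ratr p.
  rewrite -map_poly_comp; apply: eq_map_poly => a.
  by rewrite /= /horner_eval map_polyC hornerC.
have p0 : map_poly ratr p != 0 :> {poly R[i]} by rewrite map_poly_eq0 monic_neq0.
have zr : z \in rs by move: zc; rewrite mem_filter => /andP[].
have xp : root (map_poly ratr p) x%:C by rewrite rootE.
have pY0 : map_poly (evq x%:C) pY != 0 by rewrite pYE.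
have [g [gm sg gp gr]] := gcdp_transfer (monic_neq0 pm) xp (conj zr) recip pY0.
rewrite !pYE in sg gp.
(* At x the gcd vanishes on the whole circle by [conj_circle], and [g] has the same degree. *)
have cg : (size circle < size g)%N.
  rewrite sg -(size_prod_XsubC circle id) dvdp_leq ?gcdp_eq0 ?(negbTE p0) //.
  rewrite dvdp_gcd; apply/andP; split; apply: uniq_roots_dvdp;
    rewrite ?uniq_rootsE ?filter_uniq //; apply/allP => y yc.
    by rewrite rootE; move: yc; rewrite mem_filter => /andP[].
  apply/rootP; rewrite recipE ?nonzero //; apply/eqP; rewrite mulf_eq0; apply/orP; right.
  rewrite -[_ == 0]/(root _ _) rootE.
  by have := conj_circle yc; rewrite mem_filter => /andP[].
have [m gE] : {m : bitseq | g %= \prod_(y <- mask m rs) ('X - y%:P)}.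
  by apply: dvdp_prod_XsubC; rewrite -prs.
have sm : size g = (size (mask m rs)).+1 by rewrite (eqp_size gE) size_prod_XsubC.
have groot y : y \in mask m rs -> root g y.
  by move=> ym; rewrite (eqp_root gE) root_prod_XsubC.
have hroot y : y \in mask m rs -> y \in circle /\ z ^+ 2 / y \in circle.
  move=> ym; have yr := mem_mask ym; have gy := groot y ym.
  have nz : normc z = x by move: zc; rewrite mem_filter => /andP[/eqP].
  have y0 : y != 0.
    apply/eqP => y0; have := minimal_polynomial_dvd (minp yr) (q := 'X).
    rewrite map_polyX y0 rootX eqxx => /(_ isT)/dvdpP[u uE].
    have := rootX x%:C; rewrite -(map_polyX (ratr : rat -> R[i])) uE rmorphM rootM /=.
    by rewrite rootE xrs orbT => /esym/eqP/complexI/eqP; rewrite gt_eqF.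
  have zyr : z ^+ 2 / y \in rs.
    have /rootP : root (map_poly (evq z) recip) y.
      by have /dvdpP[u ->] := gr; rewrite rootM gy orbT.
    rewrite recipE // => /eqP.
    by rewrite mulf_eq0 expf_eq0 (negbTE y0) andbF /= -[_ == 0]/(root _ _) rootE.
  (* The root z^2/y has modulus x^2/|y| <= x, hence |y| >= x. *)
  have ny : normc y = x.
    apply/eqP; rewrite eq_le hrs //=; have := hrs zyr.
    have ny0 : 0 < normc y.
      rewrite lt_neqAle normc_ge0 andbT eq_sym.
      by apply: contra y0 => /eqP/Normc.eq0_normc ->.
    by rewrite Normc.normcM normcX Normc.normcV nz ler_pdivrMr // expr2 ler_pM2l.
  rewrite !mem_filter ny yr zyr Normc.normcM normcX Normc.normcV nz ny.
  by rewrite expr2 mulfK ?(gt_eqF x0) // eqxx.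
have hsub : {subset mask m rs <= circle} by move=> y /hroot[].
have hs : (size circle <= size (mask m rs))%N by rewrite -ltnS -sm.
have [_ e] := uniq_min_size (mask_uniq urs m) hsub hs.
by move: tc; rewrite -e => /hroot[].
Qed.

(* For t in the circle and w = t/x, all x w^(2j) lie in the finite circle. *)
Lemma circle_power : exists2 m, (0 < m)%N &
  forall z, z \in rs -> normc z = x -> z ^+ m = x%:C ^+ m.
Proof.
(* Among h + 1 points of the circle two coincide, so the order of w^2 is at most h and divides
   h!. *)
set h := size circle; exists (2 * h`!)%N; first by rewrite muln_gt0 fact_gt0.
have xc : x%:C \in circle by rewrite mem_filter xrs normc_real ger0_norm ?eqxx // ltW.
have xC0 := nonzero xc.
move=> z zr nz; have zc : z \in circle by rewrite mem_filter zr nz eqxx.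
pose w := z / x%:C.
have wc j : x%:C * w ^+ (2 * j) \in circle.
  elim: j => [|j ih]; first by rewrite muln0 expr0 mulr1.
  have w0 : w != 0 by rewrite mulf_neq0 ?invr_eq0 ?nonzero.
  (* The maps t -> x^2/t and t -> z^2/t preserve the circle, and together they multiply by w^2. *)
  have -> : x%:C * w ^+ (2 * j.+1) = z ^+ 2 / (x%:C ^+ 2 / (x%:C * w ^+ (2 * j))).
    rewrite mulnS exprD /w; field.
    by rewrite xC0 !expf_neq0 // nonzero.
  by apply: circle_closed => //; apply: circle_closed.
have /(uniqPn 0) : ~~ uniq [seq x%:C * w ^+ (2 * j) | j <- iota 0 h.+1].
  apply/negP => hu; suff : (h.+1 <= h)%N by rewrite ltnn.
  have := uniq_leq_size (s2 := circle) hu; rewrite size_map size_iota; apply.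
  by move=> y /mapP[j _ ->].
move=> [a [b [ab]]]; rewrite size_map size_iota => bh.
rewrite !(nth_map 0%N) ?size_iota ?(ltn_trans ab) // !nth_iota ?(ltn_trans ab) //.
move=> /(mulfI xC0); rewrite !add0n => e.
have w0 : w != 0 by rewrite mulf_neq0 ?invr_eq0 ?nonzero.
have w1 : w ^+ (2 * (b - a)) = 1.
  apply: (mulfI (expf_neq0 (2 * a) w0)); rewrite -exprD -mulnDr subnKC ?mulr1 //.
  exact: ltnW.
have : w ^+ (2 * h`!) = 1.
  have /dvdnP[c ->] : (b - a %| h`!)%N by apply: dvdn_fact; move: ab bh; rewrite -/h; lia.
  by rewrite [(c * _)%N]mulnC mulnA exprM w1 expr1n.
rewrite /w expr_div_n => /(congr1 (fun u => u * x%:C ^+ (2 * h`!))).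
by rewrite divfK ?mul1r // expf_neq0.
Qed.

End Circle.

(** * Powers of algebraic integers *)

Section PowerRoots.
Variable F : closedFieldType.

(** A^m - y is the product of the A - r over the m-th roots r of y, so it is invertible unless some
    r is an eigenvalue of A. *)
Lemma eigenvalue_exp (d m : nat) (A : 'M[F]_d.+1) (y : F) : (0 < m)%N ->
  eigenvalue (A ^+ m) y <-> exists2 x, eigenvalue A x & y = x ^+ m.
Proof.
move=> m0; split; last first.
  move=> [x /eigenvalueP[v vA v0] ->]; apply/eigenvalueP; exists v => //.
  elim: m {m0} => [|m ih]; first by rewrite !expr0 mulmx1 scale1r.
  by rewrite exprSr mulmxA ih -scalemxAl vA scalerA exprSr.
have [rs rsE] := closed_field_poly_normal ('X^m - y%:P : {poly F}).
have lc : lead_coef ('X^m - y%:P : {poly F}) = 1 by rewrite lead_coefXnsubC.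
rewrite lc scale1r in rsE.
move=> ev; suff /hasP[x xrs ex] : has (eigenvalue A) rs.
  exists x => //; have : root ('X^m - y%:P) x by rewrite rsE root_prod_XsubC.
  by rewrite rootE !hornerE subr_eq0 => /eqP.
apply/negPn/negP; rewrite -all_predC => /allP h.
have : horner_mx A ('X^m - y%:P) \in unitmx.
  rewrite rsE rmorph_prod /= big_seq; apply: (big_ind (fun B => B \in unitmx)).
  - exact: unitmx1.
  - by move=> B C Bu Cu; rewrite unitmx_mul Bu.
  move=> x /h /=; rewrite rmorphB /= horner_mx_X horner_mx_C => hx.
  by move: hx; rewrite /eigenvalue /eigenspace kermx_eq0 negbK row_free_unit.
rewrite rmorphB /= rmorphXn /= horner_mx_X horner_mx_C -row_free_unit -kermx_eq0.
by move: ev; rewrite /eigenvalue /eigenspace => /negP.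
Qed.

(** Q is the characteristic polynomial of the m-th power of the companion matrix of P, an integer
    matrix. *)
Lemma power_roots (P : {poly int}) (m : nat) : P \is monic -> (1 < size P)%N ->
  (0 < m)%N -> exists2 Q : {poly int}, Q \is monic & forall y : F,
    root (map_poly intr Q) y <-> exists2 x, root (map_poly intr P) x & y = x ^+ m.
Proof.
move=> Pm P1 m0.
have [d [A AP]] : exists d (A : 'M[int]_d.+1), char_poly A = P.
  have := companionmxK Pm; move: (companionmx P).
  by case: (size P) P1 => [|[|d]] // _ A AP; exists d, A.
exists (char_poly (A ^+ m)) => [|y]; first exact: char_poly_monic.
rewrite map_char_poly -eigenvalue_root_char rmorphXn /= (eigenvalue_exp _ _ m0).
by split=> -[x hx ->]; exists x => //; move: hx;
   rewrite eigenvalue_root_char -map_char_poly AP.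
Qed.

End PowerRoots.

Section WeakPerron.
Variable R : realType.

(* [s] spans a finitely generated additive semigroup of positive reals that is
   stable under multiplication by [x]. *)
Definition stable_semigroup (x : R) (s : seq R) := [/\ s != [::],
  forall y, y \in s -> 0 < y &
  forall y, y \in s -> exists2 t : seq R, {subset t <= s} & x * y = \sum_(z <- t) z].

(** Multiplication by x shifts the generators x^i y, i < m; from i = m - 1 the relation for x^m
    leads back to i = 0. *)
Lemma stable_semigroup_root (x : R) m s : 0 < x -> (0 < m)%N ->
  stable_semigroup (x ^+ m) s -> exists s', stable_semigroup x s'.
Proof.
move=> x0 m0 [s0 spos hs]; exists [seq x ^+ i * y | i <- iota 0 m, y <- s].
have mem i y : (i < m)%N -> y \in s ->
    x ^+ i * y \in [seq x ^+ i * y | i <- iota 0 m, y <- s].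
  by move=> im ys; apply/allpairsP; exists (i, y); rewrite /= mem_iota add0n im.
split.
- case: s s0 {spos hs} mem => // y s _ mem.
  have := mem 0%N y m0; rewrite inE eqxx => /(_ isT) h.
  by apply/eqP => e; rewrite e in h.
- move=> _ /allpairsP[[i y] /= [_ ys ->]]; apply: mulr_gt0; [exact: exprn_gt0 | exact: spos].
move=> _ /allpairsP[[i y] /= [im ys ->]]; rewrite mem_iota add0n /= in im.
have [im'|im'] := ltnP i.+1 m.
  exists [:: x ^+ i.+1 * y]; last by rewrite big_seq1 mulrA exprS.
  by move=> z; rewrite inE => /eqP ->; apply: mem.
have {im im'} em : i.+1 = m by apply/eqP; rewrite eqn_leq im im'.
have [t ts e] := hs y ys; exists t; last by rewrite -e -em mulrA exprS.
by move=> z /ts zs; rewrite -[z]mul1r -(expr0 x); apply: mem.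
Qed.

Lemma root_real (P : {poly int}) (x : R) :
  root (map_poly intr P) (x%:C : R[i]) = root (map_poly intr P) x.
Proof. by rewrite /root -!/(ev P _) (ev_rmorph (real_complex R)) fmorph_eq0. Qed.

Lemma weak_perron_semigroup (x : R) : weak_perron x -> 1 < x ->
  exists s, stable_semigroup x s.
Proof.
move=> [_ xint xconj] x1; have x0 : 0 < x := lt_trans ltr01 x1.
have [P [Pm Pmin]] := minimal_polynomial_exists xint.
have [pm pirr px] := Pmin.
have [rs [rsE urs]] := minimal_polynomial_roots R Pm pirr.
have minC : minimal_polynomial (x%:C : R[i]) (map_poly intr P).
  by split=> //; rewrite map_ratr_int root_real -map_ratr_int.
have rootrs z : root (map_poly intr P) z = (z \in rs) by rewrite rsE root_prod_XsubC.
have xrs : x%:C \in rs by rewrite -rootrs -map_ratr_int; case: minC.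
have hrs z : z \in rs -> normc z <= x.
  move=> zr; have [->|zx] := eqVneq z x%:C; first by rewrite normc_real gtr0_norm.
  by apply: xconj => //; exists (map_poly intr P) => //; rewrite map_ratr_int rootrs.
have [m m0 hm] := circle_power x0 pm pirr (etrans (map_ratr_int _ P) rsE) urs xrs hrs.
have P1 : (1 < size P)%N.
  have [] := pirr; rewrite size_map_poly_id0 // (monicP Pm) //.
have [Q Qm Qroots] := power_roots (R[i] : closedFieldType) Pm P1 m0.
have Qx : root (map_poly intr Q) (x ^+ m).
  by rewrite -root_real; apply/Qroots; exists x%:C; rewrite ?rootrs // rmorphXn.
have yint : algebraic_integer (x ^+ m) by exists Q.
have [S [Sm Smin]] := minimal_polynomial_exists yint.
have [_ sirr Sy] := Smin.
have [ts [tsE uts]] := minimal_polynomial_roots R Sm sirr.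
suff [s hs] : exists s, stable_semigroup (x ^+ m) s by apply: stable_semigroup_root hs.
apply: (@lind_semigroup R (x ^+ m) S ts) => //.
- by rewrite exprn_egt1 // -lt0n.
- rewrite -(root_prod_XsubC ts) -tsE root_real.
  by rewrite -map_ratr_int.
- move=> z zt zy.
  (* The minimal polynomial [S] of x^m divides [Q], so z = w^m for a conjugate w of x. *)
  have : root (map_poly intr Q) z.
    have : map_poly intr S %| (map_poly intr Q : {poly rat}).
      by apply: (minimal_polynomial_dvd Smin); rewrite map_ratr_int.
    move=> /dvdpP[u uE]; rewrite -map_ratr_int uE rmorphM rootM /= map_ratr_int.
    by rewrite tsE root_prod_XsubC zt orbT.
  move=> /Qroots[w]; rewrite rootrs => wr zE; rewrite zE normcX.
  rewrite ltrXn2r ?normc_ge0 ?(ltW x0) -?lt0n ?m0 //= lt_neqAle hrs // andbT.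
  (* If |w| = x, then w^m = x^m, so z would be x^m itself. *)
  apply: contra zy => /eqP nw; rewrite zE rmorphXn /=.
  exact/eqP/hm.
Qed.

End WeakPerron.

(** The matrix counts how often each generator occurs in a chosen sum for x times another one;
    duplicates are removed so that every summand is counted once. *)
Lemma realized_semigroup (k : fieldType) (R : realType) (x : R) s : 1 < x ->
  stable_semigroup x s -> exists n, realized k x n.
Proof.
move=> x1 [s0 spos hs]; pose u := undup s; pose N := size u.
have us i : (i < N)%N -> u`_i \in s by move=> h; rewrite -mem_undup mem_nth.
have /choice[T hT] : forall i : 'I_N, exists t : seq R,
    {subset t <= s} /\ x * u`_i = \sum_(z <- t) z.
  by move=> i; have [t ? ?] := hs _ (us i (ltn_ord i)); exists t.
exists (N + N)%N.
apply: (@realized_system k R N (fun i j => count_mem u`_j (T i)) (fun i => u`_i)) => //.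
- by rewrite /N lt0n size_eq0; apply: contra s0 => /eqP/undup_nil ->.
- by move=> i; apply/spos/us.
move=> i; have [Ts ->] := hT i; elim: (T i) Ts => [|z t ih] ts.
  by rewrite big_nil big1 // => j _.
rewrite big_cons ih => [|y yt]; last by apply: ts; rewrite inE yt orbT.
have zu : (index z u < N)%N by rewrite index_mem mem_undup ts // inE eqxx.
under [RHS]eq_bigr do rewrite mulrnDr.
rewrite big_split /=; congr (_ + _).
rewrite (bigD1 (Ordinal zu)) //= nth_index -?index_mem // eqxx mulr1n.
rewrite big1 ?addr0 // => j ji; have [zj|zj] := eqVneq z u`_j; last by rewrite ?mulr0n.
by move: ji; rewrite -val_eqE /= zj index_uniq ?undup_uniq // eqxx.
Qed.

(** * Quadratic integers and the lower bounds *)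

(** [realized_system] needs th > 1, so the value 1 is left to the identity. *)
Lemma realized_one (k : fieldType) (R : realType) : realized k (1 : R) 1.
Proof.
split=> //; exists (endo_id k 1).
have ida : automorphism (endo_id k 1).
  by exists (endo_id k 1); rewrite endo_comp1.
have id_perm : perm_endo k (1%g : 'S_1) = endo_id k 1.
  by apply: endo_eqP => i; rewrite !tnth_mktuple perm1.
have idaff : affine_automorphism (endo_id k 1).
  by rewrite -id_perm; apply: perm_endo_affine.
split=> //.
  exists (endo_id k 1), (endo_id k 1); split=> //; last by rewrite endo_comp1.
  by move=> i j; rewrite (ord1 i) (ord1 j).
have idr r : endo_iter r (endo_id k 1) = endo_id k 1.
  by elim: r => [//|r ih]; rewrite endo_iterS ih endo_comp1.
have deg1 : endo_deg (endo_id k 1) = 1%N by have [] := idaff.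
by apply: growth_dynamical_degree => //; exists 1 => // r;
  rewrite idr deg1 expr1n mulr1.
Qed.

Lemma weak_perron_realized (k : fieldType) (R : realType) (lambda : R) :
  weak_perron lambda -> exists n, realized k lambda n.
Proof.
move=> wp; have [l1 _ _] := wp.
move: l1; rewrite le_eqVlt => /predU1P[<-|l1]; first by exists 1%N; apply: realized_one.
have [s hs] := weak_perron_semigroup wp l1.
exact: realized_semigroup l1 hs.
Qed.

Section Conjugates.
Variables (k : fieldType) (R : realType) (lambda : R) (mu : R[i]).
Hypotheses (hconj : galois_conjugate lambda%:C mu) (neq : mu != lambda%:C).

Lemma conjugate_root (p : {poly rat}) : root (map_poly ratr p) lambda ->
  root (map_poly ratr p) mu.
Proof.
move=> pl; have [q qmin qmu] := hconj.
have : root (map_poly ratr p) lambda%:C.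
  have -> : map_poly ratr p = map_poly (real_complex R) (map_poly ratr p).
    by rewrite -map_poly_comp; apply: eq_map_poly => a; rewrite /= fmorph_rat.
  by rewrite fmorph_root.
move=> /(minimal_polynomial_dvd qmin)/dvdpP[u ->].
by rewrite rmorphM rootM /= qmu orbT.
Qed.

Lemma conjugate_nat (d : nat) : lambda <> d%:R.
Proof.
move=> ld; have := @conjugate_root ('X - d%:R%:P).
rewrite !rmorphB /= !map_polyX !map_polyC /= !ratr_nat !root_XsubC ld eqxx => /(_ isT).
by move: neq; rewrite ld rmorph_nat => /negbTE ->.
Qed.

(** These are Vieta's formulas for the distinct roots lambda and mu of X^2 - uX - v. The relation is
    not assumed to come from a minimal polynomial, so the one found in dimension 3 is admissible. *)
Lemma conjugate_quadratic (u v : int) :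
  lambda ^+ 2 = u%:~R * lambda + v%:~R ->
  exists nu : R, [/\ mu = nu%:C, u%:~R = lambda + nu & v%:~R = - (lambda * nu)].
Proof.
move=> hl; have h1 : root (map_poly ratr ('X^2 - (u%:~R *: 'X + (v%:~R)%:P))) lambda.
  rewrite rmorphB rmorphD /= map_polyXn map_polyZ /= map_polyX map_polyC /= !ratr_int.
  by rewrite /root !hornerE -hl expr2 subrr.
have := conjugate_root h1.
rewrite rmorphB rmorphD /= map_polyXn map_polyZ /= map_polyX map_polyC /= !ratr_int.
rewrite /root !hornerE subr_eq0 => /eqP hmu.
have hmuC : mu ^+ 2 = u%:~R * mu + v%:~R by rewrite -hmu ?expr2.
have hlC : lambda%:C ^+ 2 = u%:~R * lambda%:C + v%:~R.
  by rewrite -rmorphXn hl rmorphD rmorphM /= !rmorph_int.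
have hsum : mu + lambda%:C = u%:~R.
  have ne : mu - lambda%:C != 0 by rewrite subr_eq0.
  apply: (mulIf ne); rewrite mulrBr !mulrDl.
  have -> : mu * mu + lambda%:C * mu - (mu * lambda%:C + lambda%:C * lambda%:C)
     = mu ^+ 2 - lambda%:C ^+ 2 by ring.
  by rewrite hlC hmuC; ring.
exists (u%:~R - lambda); split.
- by rewrite rmorphB rmorph_int -hsum addrK.
- by rewrite addrC subrK.
- have -> : v%:~R = lambda ^+ 2 - u%:~R * lambda by rewrite hl addrC addKr.
  ring.
Qed.

Lemma quadratic_integer_relation : quadratic_integer lambda ->
  exists u v : int, lambda ^+ 2 = u%:~R * lambda + v%:~R.
Proof.
move=> [lint [p pmin sp]].
have [P [Pm Pmin]] := minimal_polynomial_exists lint.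
have sP : size P = 3%N.
  rewrite -(size_map_poly_id0 (f := intr : int -> rat) (p := P)) ?(monicP Pm) ?oner_neq0 // -sp.
  have [pm _ pl] := pmin; have [Pm' _ Pl] := Pmin.
  have d1 := minimal_polynomial_dvd pmin Pl; have d2 := minimal_polynomial_dvd Pmin pl.
  by apply/eqP; rewrite eqn_leq !dvdp_leq ?monic_neq0.
exists (- P`_1), (- P`_0).
have [_ _] := Pmin; rewrite map_ratr_int /root -/(ev P lambda) (@ev_coef _ 3) ?sP //.
rewrite !big_ord_recl big_ord0 /= expr0 expr1 mulr1 addr0 /bump /= => /eqP e.
have lc : P`_2 = 1 by have := monicP Pm; rewrite lead_coefE sP.
move: e; rewrite lc mul1r !rmorphN /= => e.
apply/eqP; rewrite -subr_eq0 -e; apply/eqP; ring.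
Qed.

Lemma small_realized (n : nat) : 1 <= lambda -> realized k lambda n -> (n <= 2)%N ->
  exists d : nat, lambda = d%:R.
Proof.
move=> l1 h n2; have [n1 _] := h; case: n n1 n2 h => [|[|[|]]] // _ _ h.
  by exists 1%N; apply: realized_dim1 h.
exact: realized_dim2 h.
Qed.

End Conjugates.

Unset Implicit Arguments.

Theorem theorem2 (k : fieldType) (R : realType) (lambda : R)
    (hlambda : weak_perron lambda) :
  (exists n : nat, realized k lambda n) /\
  [/\ 1 < lambda -> lambda \is a Num.int -> least_nat (realized k lambda) 2,
      forall mu : R[i],
        quadratic_integer lambda -> galois_conjugate lambda%:C mu ->
        mu != lambda%:C -> mu < 0 -> least_nat (realized k lambda) 3
    & forall mu : R[i],
        quadratic_integer lambda -> galois_conjugate lambda%:C mu ->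
        mu != lambda%:C -> 0 < mu -> least_nat (realized k lambda) 4].
Proof.
have [l1 _ hmod] := hlambda; have l0 : 0 < lambda := lt_le_trans ltr01 l1.
split; first exact: weak_perron_realized.
have setup (mu : R[i]) : quadratic_integer lambda -> galois_conjugate lambda%:C mu ->
    mu != lambda%:C -> exists (u v : int) (nu : R),
    [/\ lambda ^+ 2 = u%:~R * lambda + v%:~R, mu = nu%:C, u%:~R = lambda + nu,
        v%:~R = - (lambda * nu) & `|nu| <= lambda /\ 1 < lambda].
  move=> lq lc ne; have [u [v huv]] := quadratic_integer_relation lq.
  have [nu [h1 h2 h3]] := conjugate_quadratic lc ne huv.
  exists u, v, nu; split=> //; split.
    by have := hmod mu lc ne; rewrite h1 normc_real.
  rewrite lt_neqAle l1 andbT; apply/eqP => e.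
  by apply: (@conjugate_nat R lambda mu lc ne 1).
split.
- move=> l2 lint; have [d ld] : exists d : nat, lambda = d%:R.
    have /intrP[z hz] := lint; exists `|z|%N.
    rewrite hz -[X in _ = X]/((`|z|%N)%:R) pmulrn abszE ger0_norm //.
    by rewrite -(ler_int R) -hz ltW.
  split.
    by rewrite ld; apply: realized_int; rewrite -(ltr_nat R) -ld.
  move=> [|[|m]] // h; first by have [] := h.
  by have := realized_dim1 l1 h => e; rewrite e ltxx in l2.
- move=> mu lq lc ne mu0; have [u [v [nu [huv h1 h2 h3 [h4 l2]]]]] := setup mu lq lc ne.
  have nu0 : nu < 0 by move: mu0; rewrite h1 -[0]/(0%:C) ltcR.
  (* Here the weak Perron condition enters: |nu| <= lambda gives u = lambda + nu >= 0. *)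
  have [a au] : exists a : nat, u = a%:Z.
    exists `|u|%N; rewrite gez0_abs // -(ler_int R) h2.
    by move: h4; rewrite ltr0_norm // => h4; lra.
  have [b bv] : exists b : nat, v = b%:Z.
    exists `|v|%N; rewrite gez0_abs // -(ler_int R) h3 oppr_ge0.
    by rewrite ltW // pmulr_rlt0.
  split; first by apply: (@realized_quadratic_neg k R a b) => //; rewrite huv au bv.
  move=> m h; rewrite leqNgt; apply/negP; rewrite ltnS => m2.
  by have [d] := small_realized l1 h m2; apply: conjugate_nat lc ne d.
move=> mu lq lc ne mu0; have [u [v [nu [huv h1 h2 h3 [h4 l2]]]]] := setup mu lq lc ne.
have nu0 : 0 < nu by move: mu0; rewrite h1 -[0]/(0%:C) ltcR.
have nul : nu < lambda.
  rewrite lt_neqAle; apply/andP; split; last by rewrite -[nu]gtr0_norm.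
  by apply: contra ne => /eqP <-; rewrite h1.
split.
  have [a au] : exists a : nat, u = a%:Z.
    by exists `|u|%N; rewrite gez0_abs // -(ler_int R) h2 ltW // addr_gt0.
  have [b bv] : exists b : nat, - v = b%:Z.
    by exists `|- v|%N; rewrite gez0_abs // -(ler_int R) mulrNz h3 opprK ltW // mulr_gt0.
  have aE : a%:R = lambda + nu by rewrite -h2 au.
  have bE : b%:R = lambda * nu by rewrite -[b%:R]/(b%:Z%:~R) -bv mulrNz h3 opprK.
  apply: (@realized_quadratic_pos k R a b) => //.
  - by rewrite aE; lra.
  - rewrite -(ler_nat R) natrM natrX aE bE -subr_ge0.
    have -> : (lambda + nu) ^+ 2 - 4%:R * (lambda * nu) = (lambda - nu) ^+ 2 by ring.
    exact: sqr_ge0.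
  - by rewrite aE bE; ring.
move=> m h; rewrite leqNgt; apply/negP; rewrite ltnS => m3.
have [a [b ab]] : exists a b : nat, lambda ^+ 2 = a%:R * lambda + b%:R.
  move: m3; rewrite leq_eqVlt => /orP[/eqP m3|]; first by rewrite m3 in h; apply: realized_dim3 h.
  rewrite ltnS => m2; have [d ->] := small_realized l1 h m2.
  by exists d, 0%N; rewrite addr0 expr2.
(* For the relation from dimension at most 3, Vieta gives b = - lambda nu < 0, although b is a
   natural number. *)
have [nu' [e1 _ e3]] := @conjugate_quadratic R lambda mu lc ne a%:Z b%:Z ab.
have enu : nu' = nu by move: e1; rewrite h1 => -[].
have : 0 <= b%:Z%:~R :> R by rewrite ler0n.
by rewrite e3 enu oppr_ge0 leNgt mulr_gt0.
Qed.
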